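(* For $\alpha\in(0,1)$ let $L_\alpha$ be the number of linearity intervals of the least concave majorant $\mathfrak{C}_\rho$ of a Poisson point process $\rho$ on $[0,1]\times(0,\infty)$ with intensity $\alpha v^{-(\alpha+1)}\,du\,dv$. For $\alpha\in(0,1)$, $\alpha\ne1/2$, $$\mathbb{E}L_\alpha=2+\frac{2-2\alpha}{2\alpha-1}\left(1-2C(1-\alpha)+\frac{\log(1-\alpha)-\alpha\gamma}{1-\alpha}\right),$$ where $C(\cdot)$ is the Barnes modular constant and $\gamma$ is the Euler--Mascheroni constant. For $\alpha=1/2$ the formula holds by continuity, i.e. $\mathbb{E}L_{1/2}$ equals the limit of the right-hand side as $\alpha\to1/2$.
   Context: Write $\rho=\sum_{k=1}^\infty\delta(U_k,V_k)$. The least concave majorant of $\rho$ is $\mathfrak{C}_\rho(t)=\inf_ff(t)$, $t\in[0,1]$, where the infimum is over all concave functions $f:[0,1]\to[0,\infty)$ with $f(U_k)\ge V_k$ for all $k$. Its linearity intervals are the maximal intervals on which it is affine; for $\alpha\in(0,1)$ it is a.s. piecewise linear with finitely many of them. With $\psi(z)=\Gamma'(z)/\Gamma(z)$, the Barnes modular constant is defined for $\beta>0$ by the (existing) limit $$C(\beta)=\lim_{n\to\infty}\left\{\sum_{m=1}^n\psi(m\beta)-\left(n+\frac12-\frac1{2\beta}\right)\log(n\beta)+n\right\},$$ and $\gamma=\lim_{n\to\infty}\bigl(\sum_{k=1}^n\frac1k-\log n\bigr)$. *)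

(* Defs.v *)
From HB Require Import structures.
From mathcomp Require Import all_boot all_order all_algebra.
From mathcomp Require Import all_classical all_reals all_analysis.
From mathcomp Require Import measurable_realfun.

Set Implicit Arguments.
Unset Strict Implicit.
Unset Printing Implicit Defensive.
Import Order.TTheory GRing.Theory Num.Theory.
Import numFieldNormedType.Exports.

Local Open Scope classical_set_scope.
Local Open Scope ring_scope.

(* Integral formula; meaningful for [0 < z] only. *)
Definition Gamma {R : realType} (z : R) : R :=
  \int[lebesgue_measure]_(t in `]0, +oo[) (t `^ (z - 1) * expR (- t)).

Definition digamma {R : realType} (z : R) : R :=
  (Gamma^`())%classic z / Gamma z.

Definition barnes_modular {R : realType} (beta : R) : R :=
  lim ((fun n : nat => \sum_(1 <= m < n.+1) digamma (m%:R * beta)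
          - (n%:R + 2^-1 - (2 * beta)^-1) * ln (n%:R * beta) + n%:R) @ \oo).

Definition euler_gamma (R : realType) : R :=
  lim ((fun n : nat => \sum_(1 <= k < n.+1) k%:R^-1 - ln n%:R) @ \oo).

Section poisson_point_process.
Context {d d' : measure_display} {T : measurableType d} {E : measurableType d'}
  {R : realType}.

(* The point measure with atoms [X 0 w], [X 1 w], ... *)
Definition point_measure (X : nat -> T -> E) (w : T) : set E -> \bar R :=
  mseries (fun k => \d_(X k w)) 0.

(* The law [poisson_prob] is used rather than [poisson_pmf], whose value at
   rate 0 is not that of the point mass at 0. *)
Definition poisson_count (P : probability T R) (N : T -> \bar R)
    (m : \bar R) : Prop :=
  if m == +oo%E then P (N @^-1` [set +oo%E]) = 1%E
  else forall k : nat,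
    P (N @^-1` [set k%:R%:E]) = poisson_prob (fine m) 0 [set k].

Definition poisson_point_process (P : probability T R) (S : set E)
    (mu : set E -> \bar R) (X : nat -> T -> E) : Prop :=
  [/\ forall k, measurable_fun setT (X k),
      forall k w, S (X k w),
      forall B, measurable B -> B `<=` S ->
        poisson_count P (fun w => point_measure X w B) (mu B)
    & forall (n : nat) (B : 'I_n -> set E),
        (forall i, measurable (B i) /\ B i `<=` S) -> trivIset setT B ->
        forall A : 'I_n -> set (\bar R), (forall i, measurable (A i)) ->
        P [set w | forall i, A i (point_measure X w (B i))] =
        (\prod_(i < n) P [set w | A i (point_measure X w (B i))])%E].

End poisson_point_process.

Definition strip (R : realType) : set (R * R) := `[0, 1] `*` `]0, +oo[.
Arguments strip : clear implicits.

Definition stable_intensity {R : realType} (alpha : R) (B : set (R * R))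
    : \bar R :=
  (\int[lebesgue_measure \x lebesgue_measure]_(z in B)
     (alpha * z.2 `^ (- (alpha + 1)))%:E)%E.

Section least_concave_majorant.
Context {R : realType}.

Definition concave_function (D : set R) (f : R -> R) : Prop :=
  convex_function (D : set R^o) (fun t => - f t).

(* Only the values of [f] on [0, 1] matter. *)
Definition concave_majorant (x : nat -> R * R) (f : R -> R) : Prop :=
  [/\ concave_function `[0, 1] f,
      forall t, t \in `[0, 1] -> 0 <= f t
    & forall k, (x k).2 <= f (x k).1].

(* If there is no finite concave majorant (a null event for the processes
   considered here), [inf set0] is 0. *)
Definition least_concave_majorant (x : nat -> R * R) (t : R) : R :=
  inf [set f t | f in concave_majorant x].

Definition affine_on (g : R -> R) (I : set R) : Prop :=
  exists a b : R, forall t, I t -> g t = a * t + b.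

Definition linearity_intervals (g : R -> R) : set (set R) :=
  [set I | [/\ I `<=` `[0, 1], is_interval I,
               exists s t, [/\ I s, I t & s < t],
               affine_on g I
             & forall J : set R, J `<=` `[0, 1] -> is_interval J ->
                 affine_on g J -> I `<=` J -> J = I]].

(* Possibly +oo. *)
Definition num_linearity_intervals (x : nat -> R * R) : \bar R :=
  counting (linearity_intervals (least_concave_majorant x)).

End least_concave_majorant.

Definition mean_formula {R : realType} (alpha : R) : R :=
  2 + (2 - 2 * alpha) / (2 * alpha - 1) *
      (1 - 2 * barnes_modular (1 - alpha)
       + (ln (1 - alpha) - alpha * euler_gamma R) / (1 - alpha)).

(* Main.v *)
From HB Require Import structures.
Require Import Defs.
From mathcomp Require Import all_boot all_order all_algebra finmap.
From mathcomp Require Import all_classical all_reals all_analysis.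
From mathcomp Require Import measurable_realfun ring lra zify.
Import Order.TTheory GRing.Theory Num.Theory.
Import numFieldNormedType.Exports.
Local Open Scope classical_set_scope.
Local Open Scope ring_scope.

(* Apart from the first and the last one, the linearity intervals correspond to
   the pairs of atoms p, q such that no atom lies above the line through p and q
   and such that the heights a, b of this line over 0 and 1 are positive.  With
   beta = 1 - alpha, the intensity of the region above this line is
     Lambda(a, b) = (b^beta - a^beta) / (beta (b - a)),
   so the mean number of these pairs is the integral of exp(- Lambda(a, b)) over
   all pairs (p, q).  This is proved by counting pairs of cells of a fine grid:
   between two small cells all the lines have heights within a factor t of fixed
   ones, which bounds the mean from both sides, and t tends to 1.

   Replacing the ordinates of p and q by (a, b), setting b = a x and integrating
   over the abscissas and over a, the integral becomes 2 beta K(beta), where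
     K(beta) = int_1^oo (x^beta - x^(beta - 1) - int_1^x y^(2 beta - 2) dy)
                         / ((x - 1) (x^beta - 1)^2) dx.
   Expanding 1 / (x^beta - 1)^2 in powers of x^(-beta) and integrating term by
   term with psi(w) - psi(z) = int_1^oo (x^(-z) - x^(-w)) / (x - 1) dx gives the
   partial sums of psi(m beta) that define the Barnes modular constant. *)

(** * Measurability, substitution and the fundamental theorem of calculus *)

(** The means over pairs of atoms are computed from void probabilities and independence alone: every
    event used says that two boxes are hit and that a third region, disjoint from them, is avoided.
    The number of intervals itself is only squeezed between two measurable counts of such events.
    The squeeze stays explicit because Lambda is homogeneous of degree - alpha. Heights that are
    wrong by a factor t replace Lambda by a multiple s Lambda with s a power of t, and the integral
    of exp(- s Lambda) over pairs is exactly s^(-2) times its value at s = 1. Both bounds on the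
    mean are thus the same constant times a power of t. The singularity of the formula at alpha =
    1/2 is only apparent. K is finite and continuous on the whole interval 0 < beta < 1, the
    integral in its numerator being a logarithm at beta = 1/2, and the series evaluates (1 - 2 beta)
    K(beta). The mean 2 + 2 beta K(beta) is therefore obtained for all alpha at once, and the limit
    at 1/2 is the continuity of K. The series also yields the convergence of the sequence that
    defines the Barnes constant. *)

Lemma measurable_inv (R : realType) : measurable_fun setT (fun x : R => x^-1).
Proof.
(* [powR] with exponent -1 agrees with the inverse at nonnegative bases only, hence the detour
   through the square of [x]. *)
rewrite [X in measurable_fun _ X](_ : _ = fun x : R => x * (x * x) `^ (-1)).
  apply: measurable_funM => //.
  apply: (@measurableT_comp _ _ _ _ _ _ (fun x : R => x `^ (-1))) => //.
  exact: measurable_funM.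
apply/funext => x; rewrite powR_inv1 ?sqr_ge0 -?expr2 ?sqr_ge0//.
have [->|x0] := eqVneq x 0; first by rewrite invr0 mul0r.
by field.
Qed.

Lemma measurable_funV d (T : measurableType d) (R : realType) (D : set T)
    (f : T -> R) :
  measurable_fun D f -> measurable_fun D (fun x => (f x)^-1).
Proof. by move=> mf; apply: measurableT_comp => //; exact: measurable_inv. Qed.

Lemma measurable_fun_bool_natr d (T : measurableType d) (R : realType)
    (D : set T) (b : T -> bool) :
  measurable_fun D b -> measurable_fun D (fun x => (b x)%:R : R).
Proof.
by move=> mb; apply: (@measurableT_comp _ _ _ _ _ _ (fun c : bool => c%:R : R)).
Qed.

Section affine_substitution.
Context {R : realType}.
Local Notation mu := (@lebesgue_measure R).

Lemma measurable_affine (c d : R) :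
  measurable_fun [set: R] ((fun x : R => c * x + d) : R -> measurableTypeR R).
Proof. by apply: measurable_funD => //; apply: measurable_funM. Qed.

Lemma ge0_integral_affine (c d : R) (f : R -> \bar R) : c != 0 ->
  measurable_fun setT f -> (forall x, 0 <= f x)%E ->
  (\int[mu]_x f x = `|c|%R%:E * \int[mu]_x f (c * x + d)%R)%E.
Proof.
move=> c0 mf f0; have nc : (0 <= `|c|)%R by [].
have mphi := measurable_affine c d.
unshelve epose (m := (pushforward mu ((fun x : R => (c * x + d)%R) :
  R -> measurableTypeR R) : {measure set (measurableTypeR R) -> \bar R})).
  exact: mphi.
transitivity (\int[mscale (NngNum nc) m]_x f x)%E; last first.
  by rewrite ge0_integral_mscale//= ge0_integral_pushforward.
apply: eq_measure_integral => A mA _.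
(* By uniqueness of Lebesgue measure it suffices to compare the two measures on half-open intervals.
   For negative [c] the preimage is closed at the other end, which leaves its length unchanged. *)
apply: (@lebesgue_measure_unique _ (mscale (NngNum nc) m)) => //.
move=> _ [[a b] _ <-]; pose Y := (fun x : R => c * x + d) @^-1` `]a, b]%classic.
change (mu `]a, b]%classic = (`|c|%R%:E * mu Y)%E).
have [cp|cn|/eqP] := ltrgtP c 0; last by rewrite (negbTE c0).
  have -> : Y =
      `[(b - d) / c, (a - d) / c[%classic.
    rewrite /Y; apply/seteqP; split => x /=; rewrite !in_itv/= ler_ndivrMr// ltr_ndivlMr//;
      rewrite [x * c]mulrC; lra.
  rewrite !lebesgue_measure_itv/= !lte_fin ltr_ndivrMr// divfK//.
  rewrite ltrD2r; case: ifPn => ab; last by rewrite mule0.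
  by rewrite -!EFinB -EFinM ltr0_norm//; congr EFin; field.
have -> : Y =
    `](a - d) / c, (b - d) / c]%classic.
  rewrite /Y; apply/seteqP; split => x /=; rewrite !in_itv/= ler_pdivlMr// ltr_pdivrMr//;
    rewrite [x * c]mulrC; lra.
rewrite !lebesgue_measure_itv/= !lte_fin ltr_pdivrMr// divfK//.
rewrite ltrD2r; case: ifPn => ab; last by rewrite mule0.
by rewrite -!EFinB -EFinM gtr0_norm//; congr EFin; field.
Qed.

End affine_substitution.

(* Thanks to this the measurability of the number of linearity intervals is
   never needed. *)
Lemma le_integral_nonmeasurable d (T : measurableType d) (R : realType)
    (mu : {measure set T -> \bar R}) (f g : T -> \bar R) :
  (forall x, 0 <= f x)%E -> (forall x, f x <= g x)%E ->
  (\int[mu]_x f x <= \int[mu]_x g x)%E.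
Proof.
move=> f0 fg; have g0 x : (0 <= g x)%E by exact: le_trans (f0 x) (fg x).
rewrite !ge0_integralTE//; apply: le_ereal_sup => _ [h hf <-].
by exists h => // x; exact: le_trans (hf x) (fg x).
Qed.

Section real_integrable.
Context d {T : measurableType d} {R : realType}.
Context {mu : {measure set T -> \bar R}}.
Implicit Types (D : set T) (f g : T -> R).

Lemma real_integrableZ D (k : R) f : measurable D ->
  mu.-integrable D (EFin \o f) -> mu.-integrable D (EFin \o (fun x => k * f x)).
Proof. by move=> mD /(integrableZl mD k); exact: eq_integrable. Qed.

Lemma real_integrableD D f g : measurable D ->
  mu.-integrable D (EFin \o f) -> mu.-integrable D (EFin \o g) ->
  mu.-integrable D (EFin \o (fun x => f x + g x)).
Proof. by move=> mD fi gi; apply: eq_integrable (integrableD mD fi gi). Qed.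

End real_integrable.

Section real_derivatives.
Context {R : realType}.
Implicit Types (a x l m : R) (f g : R -> R).

(* Not a class, unlike [is_derive], so that unification rather than instance
   resolution determines the derivative. *)
Definition has_derivative f x l : Prop := is_derive x 1 f l.

Lemma has_derivative_continuous f x l : has_derivative f x l -> {for x, continuous f}.
Proof.
move=> [df _]; apply: differentiable_continuous; exact/derivable1_diffP.
Qed.

Lemma has_derivative_eq f x l m : has_derivative f x l -> l = m -> has_derivative f x m.
Proof. by move=> ? <-. Qed.

Lemma has_derivative_cst x a : has_derivative (fun=> a) x 0.
Proof. exact: is_derive_cst. Qed.

Lemma has_derivative_id x : has_derivative (fun y : R => y) x 1.
Proof. exact: is_derive_id. Qed.

Lemma has_derivativeD f g x l m : has_derivative f x l -> has_derivative g x m ->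
  has_derivative (fun y => f y + g y) x (l + m).
Proof. by move=> ? ?; exact: is_deriveD. Qed.

Lemma has_derivativeB f g x l m : has_derivative f x l -> has_derivative g x m ->
  has_derivative (fun y => f y - g y) x (l - m).
Proof. by move=> ? ?; exact: is_deriveB. Qed.

Lemma has_derivativeN f x l : has_derivative f x l -> has_derivative (fun y => - f y) x (- l).
Proof. by move=> ?; exact: is_deriveN. Qed.

Lemma has_derivativeM f g x l m : has_derivative f x l -> has_derivative g x m ->
  has_derivative (fun y => f y * g y) x (f x * m + g x * l).
Proof. by move=> ? ?; exact: is_deriveM. Qed.

Lemma has_derivativeX f x l n : has_derivative f x l ->
  has_derivative (fun y => f y ^+ n.+1) x (n.+1%:R * f x ^+ n * l).
Proof.
move=> h; rewrite (_ : (fun y => _) = f ^+ n.+1).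
  exact: (@is_deriveX _ _ f n.+1 x 1 l h).
by apply/funext => y; rewrite fctE.
Qed.

Lemma one_powR a : 1 `^ a = 1 :> R.
Proof. by rewrite powR1. Qed.

Lemma has_derivativeV f x l : f x != 0 -> has_derivative f x l ->
  has_derivative (fun y => (f y)^-1) x (- (f x) ^- 2 * l).
Proof. by move=> ? ?; exact: is_deriveV. Qed.

Lemma has_derivative_expR_comp f x l : has_derivative f x l ->
  has_derivative (fun y => expR (f y)) x (expR (f x) * l).
Proof. by move=> h; exact: (@is_derive1_comp _ expR f x _ _ (is_derive_expR _) h). Qed.

Lemma has_derivative_ln_comp f x l : 0 < f x -> has_derivative f x l ->
  has_derivative (fun y => ln (f y)) x ((f x)^-1 * l).
Proof.
by move=> fx h; exact: (@is_derive1_comp _ (@ln R) f x _ _ (is_derive1_ln fx) h).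
Qed.

Lemma has_derivative_powR_comp f a x l : 0 < f x -> has_derivative f x l ->
  has_derivative (fun y => f y `^ a) x (a * f x `^ (a - 1) * l).
Proof.
move=> fx h.
exact: (@is_derive1_comp _ (@powR R ^~ a) f x _ _ (is_derive1_powR a fx) h).
Qed.

Lemma has_derivative_powR_exponent a x : 0 < a ->
  has_derivative (powR a) x (ln a * a `^ x).
Proof.
move=> a0; rewrite (_ : powR a = fun y => expR (y * ln a)); last first.
  by apply/funext => y; rewrite /powR gt_eqF.
apply: has_derivative_eq.
  apply: has_derivative_expR_comp; apply: has_derivativeM; first exact: has_derivative_id.
  exact: has_derivative_cst.
by rewrite /powR ?gt_eqF//; rewrite mulr0 mulr1 add0r mulrC.
Qed.

Lemma continuous_powRl a x : 0 < x -> {for x, continuous (@powR R ^~ a)}.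
Proof. by move=> x0; exact: has_derivative_continuous (is_derive1_powR a x0). Qed.

Lemma cvg_powR (T : Type) (F : set_system T) {FF : Filter F} (f : T -> R) (a z : R) :
  0 < a -> f x @[x --> F] --> a -> f x `^ z @[x --> F] --> a `^ z.
Proof.
move=> a0 fa; apply: (@continuous_cvg _ _ _ F FF f (@powR R ^~ z) a) => //.
exact: continuous_powRl.
Qed.

Lemma cvg_ln (T : Type) (F : set_system T) {FF : Filter F} (f : T -> R) (a : R) :
  0 < a -> f x @[x --> F] --> a -> ln (f x) @[x --> F] --> ln a.
Proof.
move=> a0 fa; apply: (@continuous_cvg _ _ _ F FF f (@ln R) a) => //.
exact: continuous_ln.
Qed.

Lemma cvg_invDry (c : R) : (c + x)^-1 @[x --> +oo] --> (0 : R).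
Proof.
apply/gtr0_cvgV0.
  by near=> x; rewrite -ltrBlDl sub0r; near: x; apply: nbhs_pinfty_gt; rewrite num_real.
apply: cvg_addrl; exact: cvg_id.
Unshelve. all: by end_near. Qed.

End real_derivatives.

Ltac derive :=
  lazymatch goal with
  | |- has_derivative (fun _ => ?a) _ _ => exact: has_derivative_cst
  | |- has_derivative (fun y => y) _ _ => exact: has_derivative_id
  | |- has_derivative (fun y => @?f y + @?g y) _ _ =>
      apply: (has_derivativeD f g); derive
  | |- has_derivative (fun y => - @?f y) _ _ => apply: (has_derivativeN f); derive
  | |- has_derivative (fun y => @?f y * @?g y) _ _ =>
      apply: (has_derivativeM f g); derive
  | |- has_derivative (fun y => @?f y ^+ ?n.+1) _ _ =>
      apply: (has_derivativeX f); derive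
  | |- has_derivative (fun y => (@?f y)^-1) _ _ =>
      apply: (has_derivativeV f); [|derive]
  | |- has_derivative (fun y => expR (@?f y)) _ _ =>
      apply: (has_derivative_expR_comp f); derive
  | |- has_derivative (fun y => ln (@?f y)) _ _ =>
      apply: (has_derivative_ln_comp f); [|derive]
  | |- has_derivative (fun y => @?f y `^ ?a) _ _ =>
      apply: (has_derivative_powR_comp f a); [|derive]
  end.

(** * The fundamental theorem of calculus on noncompact intervals *)

Section improper_ftc.
Context {R : realType}.
Local Notation mu := (@lebesgue_measure R).
Implicit Types (f g h F : R -> R) (D : set R).

(** Monotone convergence along compact intervals exhausting [D]. Splitting the derivative of [F] as
    [g - h] with both parts nonnegative makes the identity meaningful in the extended reals before
    any integrability is known: [h = 0] is the improper fundamental theorem, a nonzero [h] is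
    integration by parts. *)
Lemma ge0_FTC_exhaustion g h F D (s t : R^nat) (l L : R) :
  (forall n, s n < t n) -> nonincreasing_seq s -> nondecreasing_seq t ->
  \bigcup_n `[s n, t n]%classic = D ->
  (forall x, D x -> 0 <= g x) -> (forall x, D x -> 0 <= h x) ->
  (forall x, D x -> has_derivative F x (g x - h x)) ->
  (forall x, D x -> {for x, continuous g}) ->
  (forall x, D x -> {for x, continuous h}) ->
  F (t n) @[n --> \oo] --> l -> F (s n) @[n --> \oo] --> L ->
  (\int[mu]_(x in D) (g x)%:E = (l - L)%:E + \int[mu]_(x in D) (h x)%:E)%E.
Proof.
move=> st sd td UD g0 h0 dF cg ch Fl FL.
have subD n x : x \in `[s n, t n] -> D x by move=> xn; rewrite -UD; exists n.
have cW n k : (forall x, D x -> {for x, continuous k}) ->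
    {within `[s n, t n], continuous (k : R -> R)}.
  move=> ck; apply: continuous_in_subspaceT => x; rewrite inE/= => xn.
  by apply: ck; exact: subD xn.
have nd : {homo (fun n => `[s n, t n]%classic) : n m / (n <= m)%N >-> (n <= m)%O}.
  move=> n m nm; apply/subsetPset => x /=; rewrite !in_itv/= => /andP[sx xt].
  by rewrite (le_trans (sd _ _ nm))//= (le_trans xt)//; exact: td.
have mW n k : (forall x, D x -> {for x, continuous k}) ->
    measurable_fun `[s n, t n]%classic (fun x => (k x)%:E : \bar R).
  move=> ck; apply/measurable_EFinP; apply: subspace_continuous_measurable_fun => //.
  exact: cW.
have cvgD (k : R -> R) : (forall x, D x -> 0 <= k x) ->
    (forall x, D x -> {for x, continuous k}) ->
    (\int[mu]_(x in `[s n, t n]%classic) (k x)%:E)%E @[n --> \oo] -->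
    (\int[mu]_(x in D) (k x)%:E)%E.
  move=> k0 ck; rewrite -UD; apply: ge0_nondecreasing_set_cvg_integral => //.
    by move=> n; exact: mW.
  by move=> n x xn; rewrite lee_fin k0//; exact: subD xn.
have int n k : (forall x, D x -> {for x, continuous k}) ->
    mu.-integrable `[s n, t n] (fun x => (k x)%:E).
  move=> ck; apply: continuous_compact_integrable; first exact: segment_compact.
  exact: cW.
have key n : (\int[mu]_(x in `[s n, t n]%classic) (g x)%:E =
    (F (t n) - F (s n))%:E + \int[mu]_(x in `[s n, t n]%classic) (h x)%:E)%E.
  have cgh : forall x, D x -> {for x, continuous (fun y => g y - h y)}.
    by move=> x Dx; apply: continuousB; [exact: cg|exact: ch].
  rewrite EFinB -(@continuous_FTC2 _ (fun x => g x - h x) F _ _ (st n)).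
  - rewrite -integralD//=; [|exact: int..].
    by apply: eq_integral => x _; rewrite -EFinD subrK.
  - exact: cW.
  - have cF x : D x -> {for x, continuous F}.
      move=> Dx; apply: differentiable_continuous; apply/derivable1_diffP.
      by have [] := dF _ Dx.
    split.
    + by move=> x xn; have [] := dF _ (subD n _ (subset_itv_oo_cc xn)).
    + apply: cvg_at_right_filter; apply: cF; apply: (subD n).
      by rewrite in_itv/= lexx ltW.
    + apply: cvg_at_left_filter; apply: cF; apply: (subD n).
      by rewrite in_itv/= lexx ltW.
  - move=> x xn; rewrite derive1E.
    by have [_ ->] := dF _ (subD n _ (subset_itv_oo_cc xn)).
have h1 := cvgD _ g0 cg.
rewrite -(cvg_lim _ h1)//; apply: cvg_lim => //.
rewrite (funext key); apply: cvgeD; last exact: cvgD.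
- exact: fin_num_adde_defr.
- by apply: cvg_EFin; [exact: nearW|exact: cvgB].
Qed.

Lemma cvg_at_right_harmonic F (a L : R) : F x @[x --> a^'+] --> L ->
  F (a + n.+1%:R^-1) @[n --> \oo] --> L.
Proof.
move=> /cvg_at_rightP; apply; split.
  by move=> n; rewrite ltrDl invr_gt0 ltr0n.
rewrite -[X in _ --> X]addr0; apply: cvgD; first exact: cvg_cst.
exact: cvg_harmonic.
Qed.

Lemma cvg_at_left_harmonic F (a L : R) : F x @[x --> a^'-] --> L ->
  F (a - n.+1%:R^-1) @[n --> \oo] --> L.
Proof.
move=> /cvg_at_leftP; apply; split.
  by move=> n; rewrite ltrBlDr ltrDl invr_gt0 ltr0n.
rewrite -[X in _ --> X]subr0; apply: cvgB; first exact: cvg_cst.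
exact: cvg_harmonic.
Qed.

Lemma nonincreasing_harmonicD (a : R) (k : nat) :
  nonincreasing_seq (fun n => a + (n + k).+1%:R^-1).
Proof.
by move=> n m nm; rewrite lerD2l lef_pV2 ?posrE ?ltr0n// ler_nat ltnS leq_add2r.
Qed.

Lemma nondecreasing_harmonicB (a : R) (k : nat) :
  nondecreasing_seq (fun n => a - (n + k).+1%:R^-1).
Proof.
by move=> n m nm; rewrite lerD2l lerN2 lef_pV2 ?posrE ?ltr0n// ler_nat ltnS
  leq_add2r.
Qed.

Lemma ge0_FTC_ray g h F (a l L : R) :
  (forall x, a < x -> 0 <= g x) -> (forall x, a < x -> 0 <= h x) ->
  (forall x, a < x -> has_derivative F x (g x - h x)) ->
  (forall x, a < x -> {for x, continuous g}) ->
  (forall x, a < x -> {for x, continuous h}) ->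
  F x @[x --> +oo] --> l -> F x @[x --> a^'+] --> L ->
  (\int[mu]_(x in `]a, +oo[) (g x)%:E =
   (l - L)%:E + \int[mu]_(x in `]a, +oo[) (h x)%:E)%E.
Proof.
move=> g0 h0 dF cg ch Fl FL.
have aP (P : R -> Prop) : (forall x, a < x -> P x) ->
    forall x, `]a, +oo[%classic x -> P x.
  by move=> aP x; rewrite /= in_itv/= andbT; exact: aP.
(* The shift by one makes the left end a + 1/(n+2) smaller than a + n + 1 already for n = 0. *)
apply: (@ge0_FTC_exhaustion g h F _ (fun n => a + (n + 1).+1%:R^-1)
  (fun n => a + n.+1%:R) l L) => //; try exact: aP.
- move=> n; rewrite ltrD2l (@lt_le_trans _ _ 1) ?ler1n//.
  by rewrite invf_lt1 ?ltr0n// ltr1n addn1.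
- exact: nonincreasing_harmonicD.
- by move=> n m nm; rewrite lerD2l ler_nat ltnS.
- apply/seteqP; split => [x [n _]/=|x /=]; rewrite !in_itv/= ?andbT.
    by move=> /andP[+ _]; apply: lt_le_trans; rewrite ltrDl invr_gt0 ltr0n.
  move=> ax; have xa : 0 < x - a by rewrite subr_gt0.
  have [n _ nx] := near_infty_natSinv_lt (PosNum xa).
  pose N := maxn n (Num.truncn (x - a)); exists N => //=; rewrite in_itv/=.
  rewrite -lerBrDl; apply/andP; split.
    apply/ltW/nx; rewrite /= /N; rewrite addn1; apply: (leq_trans (leq_maxl _ _)).
    exact: leqnSn.
  rewrite -lerBlDl; apply: (@le_trans _ _ (Num.truncn (x - a)).+1%:R).
    by apply/ltW; rewrite Num.Theory.truncnS_gt.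
  by rewrite ler_nat ltnS leq_maxr.
- apply: (cvg_comp _ _ _ Fl); apply/cvgryPge => A.
  near=> n; rewrite -lerBlDl (@le_trans _ _ n%:R)// ?ler_nat//.
  by near: n; exact: nbhs_infty_ger.
- have := cvg_at_right_harmonic _ _ _ FL.
  by rewrite -(cvg_shiftn 1).
Unshelve. all: by end_near. Qed.

Lemma ge0_FTC_oo g h F (a b l L : R) : a < b ->
  (forall x, a < x < b -> 0 <= g x) -> (forall x, a < x < b -> 0 <= h x) ->
  (forall x, a < x < b -> has_derivative F x (g x - h x)) ->
  (forall x, a < x < b -> {for x, continuous g}) ->
  (forall x, a < x < b -> {for x, continuous h}) ->
  F x @[x --> b^'-] --> l -> F x @[x --> a^'+] --> L ->
  (\int[mu]_(x in `]a, b[) (g x)%:E =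
   (l - L)%:E + \int[mu]_(x in `]a, b[) (h x)%:E)%E.
Proof.
move=> ab g0 h0 dF cg ch Fl FL.
have aP (P : R -> Prop) : (forall x, a < x < b -> P x) ->
    forall x, `]a, b[%classic x -> P x.
  by move=> aP x; rewrite /= in_itv/=; exact: aP.
(* Both sequences start at an index [k] with 1/(k+1) below half the length, so that the ends are in
   order from the first interval on. *)
have ba : 0 < (b - a) / 2 by rewrite divr_gt0// subr_gt0.
have [k _ kP] := near_infty_natSinv_lt (PosNum ba).
apply: (@ge0_FTC_exhaustion g h F _ (fun n => a + (n + k).+1%:R^-1)
  (fun n => b - (n + k).+1%:R^-1) l L) => //; try exact: aP.
- move=> n; have /= := kP (n + k)%N (leq_addl _ _); move: (_^-1) => e; lra.
- exact: nonincreasing_harmonicD.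
- exact: nondecreasing_harmonicB.
- have H n : 0 < (n + k).+1%:R^-1 :> R by rewrite invr_gt0 ltr0n.
  apply/seteqP; split => [x [n _]/=|x /=]; rewrite !in_itv/=.
    by have := H n; move: (_^-1) => e; lra.
  move=> /andP[ax xb]; have m0 : 0 < Num.min (x - a) (b - x).
    by rewrite lt_min !subr_gt0 ax.
  have [n _ nx] := near_infty_natSinv_lt (PosNum m0).
  exists n => //=; have /= := nx (n + k)%N (leq_addr _ _).
  by have := H n; rewrite lt_min in_itv/= => + /andP[]; move: (_^-1) => e; lra.
- have := cvg_at_left_harmonic _ _ _ Fl.
  by rewrite -(cvg_shiftn k).
- have := cvg_at_right_harmonic _ _ _ FL.
  by rewrite -(cvg_shiftn k).
Qed.

End improper_ftc.

(** * The digamma function *)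

Section gamma_function.
Context {R : realType}.
Local Notation mu := (@lebesgue_measure R).
Implicit Types x z t : R.

Definition gamma_kernel z t : R := t `^ (z - 1) * expR (- t).

Lemma gamma_kernel_ge0 z t : 0 <= gamma_kernel z t.
Proof. by rewrite mulr_ge0 ?powR_ge0 ?expR_ge0. Qed.

Lemma has_derivative_expRN t : has_derivative (fun s : R => expR (- s)) t (- expR (- t)).
Proof.
have := has_derivative_expR_comp _ _ _ (has_derivativeN _ _ _ (has_derivative_id t)).
by rewrite mulrN1.
Qed.

Lemma continuous_gamma_kernel z t : 0 < t -> {for t, continuous (gamma_kernel z)}.
Proof.
move=> t0; apply: continuousM; first exact: continuous_powRl.
exact: has_derivative_continuous (has_derivative_expRN _).
Qed.

Lemma powRD1_expRN_bound z : 0 < z ->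
  exists2 C : R, 0 < C & forall t, 0 < t -> (1 + t) `^ (z + 1) * expR (- t) <= C.
Proof.
move=> z0; pose n := (Num.truncn (z + 1)).+1.
exists (n`!%:R * expR 1); first by rewrite mulr_gt0 ?expR_gt0// ltr0n fact_gt0.
move=> t t0; have t1 : 0 < 1 + t by lra.
rewrite expRN ler_pdivrMr ?expR_gt0// -mulrA -expRD.
have := @expR_ge1Dxn R (1 + t) n.-1 (ltW t1) => /= h.
apply: (@le_trans _ _ ((1 + t) ^+ n)).
  rewrite -powR_mulrn; last exact: ltW.
  apply: ler_powR; first lra.
  exact/ltW/Num.Theory.truncnS_gt.
rewrite -ler_pdivrMl ?ltr0n ?fact_gt0// mulrC.
by apply: le_trans h; rewrite lerDr.
Qed.

(** The majorant controls the kernel at 0 and at infinity simultaneously and has an elementary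
    primitive, (t / (1 + t))^z / z. *)
Lemma gamma_kernel_le z : 0 < z -> exists2 C : R, 0 < C & forall t, 0 < t ->
  gamma_kernel z t <= C * (t `^ (z - 1) * (1 + t) `^ (- (z + 1))).
Proof.
move=> z0; have [C C0 hC] := powRD1_expRN_bound z z0; exists C => // t t0.
have t1 : 0 < 1 + t by lra.
rewrite /gamma_kernel mulrCA ler_wpM2l ?powR_ge0// powRN.
by rewrite ler_pdivlMr ?powR_gt0// mulrC; exact: hC.
Qed.

Lemma integral_beta_kernel z : 0 < z ->
  (\int[mu]_(t in `]0%R, +oo[) (t `^ (z - 1) * (1 + t) `^ (- (z + 1)))%:E =
  z^-1%:E)%E.
Proof.
move=> z0.
have pw t : 0 < t -> 0 < t / (1 + t) by move=> t0; rewrite divr_gt0//; lra.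
transitivity ((z^-1 - 0)%:E + \int[mu]_(t in `]0%R, +oo[) (0 : R)%:E)%E; last first.
  by rewrite integral0_eq// adde0 subr0.
apply: (@ge0_FTC_ray _ _ (fun=> 0) (fun t => z^-1 * (t / (1 + t)) `^ z)).
- by move=> t _; rewrite mulr_ge0 ?powR_ge0.
- by [].
- move=> t t0; rewrite subr0; have t1 : 1 + t != 0 by rewrite gt_eqF//; lra.
  apply: has_derivative_eq; first by derive => //; exact: pw.
  rewrite /=.
  rewrite (_ : (t * _ + _) = (1 + t) ^- 2); last by field.
  rewrite mulr0 addr0.
  rewrite -!mulrA mulKf ?gt_eqF// powRM ?invr_ge0 ?ltW//; last lra.
  rewrite -mulrA; congr (_ * _).
  rewrite -powR_inv1; last lra.
  rewrite -powRrM -powR_invn; last lra.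
  by rewrite -powRD ?t1 ?implybT//; congr (_ `^ _); ring.
- by move=> t t0; apply: has_derivative_continuous; derive => //; lra.
- by move=> t _; exact: cst_continuous.
- rewrite -[X in _ --> X]mulr1; apply: cvgM; first exact: cvg_cst.
  rewrite [X in _ --> X](_ : 1 = 1 `^ z :> R); last by rewrite powR1.
  apply: cvg_powR => //.
  have : 1 - (1 + t)^-1 @[t --> +oo] --> (1 - 0 : R).
    by apply: cvgB; [exact: cvg_cst|exact: cvg_invDry].
  rewrite subr0; apply: cvg_trans; apply: near_eq_cvg.
  near=> t; have t0 : 0 < t by near: t; apply: nbhs_pinfty_gt; rewrite num_real.
  by field; rewrite gt_eqF//; lra.
- apply: (@squeeze_cvgr _ _ _ _ (fun=> 0) (fun t => z^-1 * t `^ z)).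
  + near=> t; have t0 : 0 < t by near: t; exact: nbhs_right_gt.
    have z1 : 0 < z^-1 by rewrite invr_gt0.
    rewrite mulr_ge0 ?powR_ge0 ?(ltW z1)//=.
    rewrite ler_pM2l//; apply: ge0_ler_powR; rewrite ?nnegrE ?ltW// ?pw//.
    by rewrite ltr_pdivrMr ?ltr_pMr//; lra.
  + exact: cvg_cst.
  + rewrite -[X in _ --> X](mulr0 z^-1); apply: cvgM; first exact: cvg_cst.
    exact: powR_cvg0.
Unshelve. all: by end_near. Qed.

Lemma mulr_powRB1_gt0 z t : 0 < t -> t * t `^ (z - 1) = t `^ z.
Proof.
move=> t0; rewrite -[X in X * _](powRr1 (ltW t0)) -powRD; last by rewrite (gt_eqF t0) implybT.
by rewrite addrC subrK.
Qed.

Lemma integrable_gamma_kernel z : 0 < z ->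
  mu.-integrable `]0, +oo[ (fun t => (gamma_kernel z t)%:E).
Proof.
move=> z0; have [C C0 hC] := gamma_kernel_le z z0.
have mk p : measurable_fun setT (fun t : R => t `^ p) by exact: measurable_powR.
have mg : measurable_fun (`]0, +oo[%classic : set R) (gamma_kernel z).
  apply: measurable_funTS; apply: measurable_funM => //.
  by apply: measurableT_comp => //; exact: oppr_measurable.
have mb : measurable_fun setT (fun t : R => t `^ (z - 1) * (1 + t) `^ (- (z + 1))).
  apply: measurable_funM => //.
  by apply: (@measurableT_comp _ _ _ _ _ _ (@powR R ^~ _)) => //;
    exact: measurable_funD.
apply: (@le_integrable _ _ _ mu _ _ _
  (fun t => (C%:E * (t `^ (z - 1) * (1 + t) `^ (- (z + 1)))%:E)%E)) => //.
- exact/measurable_EFinP.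
- move=> t /=; rewrite in_itv/= andbT => t0; rewrite lee_fin !ger0_norm.
  + exact: hC.
  + by rewrite !mulr_ge0 ?powR_ge0// ltW.
  + exact: gamma_kernel_ge0.
- apply: integrableZl => //; apply/integrableP; split.
    by apply/measurable_EFinP; exact: measurable_funTS.
  under eq_integral do rewrite /= ger0_norm ?mulr_ge0 ?powR_ge0//.
  by rewrite integral_beta_kernel// ltry.
Qed.

(** [Gamma] is the finite part of an extended integral; integrability makes the two agree. *)
Lemma integral_gamma_kernel z : 0 < z ->
  (\int[mu]_(t in `]0%R, +oo[) (gamma_kernel z t)%:E = (Gamma z)%:E)%E.
Proof.
move=> z0; rewrite /Gamma /Rintegral fineK//.
by apply: integrable_fin_num => //; exact: integrable_gamma_kernel.
Qed.

Lemma gamma_kernelD1 z t : 0 < t -> t * gamma_kernel z t = gamma_kernel (z + 1) t.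
Proof.
by move=> t0; rewrite /gamma_kernel mulrA addrK mulr_powRB1_gt0.
Qed.

Lemma cvg_powR_expRN z : 0 < z -> t `^ z * expR (- t) @[t --> +oo] --> (0 : R).
Proof.
move=> z0; have [C C0 hC] := powRD1_expRN_bound z z0.
apply: (@squeeze_cvgr _ _ _ _ (fun=> 0) (fun t => C * (1 + t)^-1)).
- near=> t; have t0 : 0 < t by near: t; apply: nbhs_pinfty_gt; rewrite num_real.
  have t1 : 0 < 1 + t by lra.
  rewrite mulr_ge0 ?powR_ge0 ?expR_ge0//= ler_pdivlMr// mulrC mulrA.
  apply: le_trans (hC _ t0); rewrite ler_pM2r ?expR_gt0//.
  rewrite -[in leRHS](mulr_powRB1_gt0 _ _ t1) addrK ler_pM2l//.
  by apply: ge0_ler_powR; rewrite ?nnegrE ?ltW//; lra.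
- exact: cvg_cst.
- rewrite -[X in _ --> X](mulr0 C); apply: cvgM; first exact: cvg_cst.
  exact: cvg_invDry.
Unshelve. all: by end_near. Qed.

Lemma cvg_powR_expRN0 z : 0 < z -> t `^ z * expR (- t) @[t --> 0^'+] --> (0 : R).
Proof.
move=> z0; apply: (@squeeze_cvgr _ _ _ _ (fun=> 0) (fun t => t `^ z)).
- near=> t; have t0 : 0 < t by near: t; exact: nbhs_right_gt.
  rewrite mulr_ge0 ?powR_ge0 ?expR_ge0//= ler_piMr ?powR_ge0//.
  by rewrite expR_le1; lra.
- exact: cvg_cst.
- exact: powR_cvg0.
Unshelve. all: by end_near. Qed.

Lemma GammaD1 z : 0 < z -> Gamma (z + 1) = z * Gamma z.
Proof.
move=> z0; apply: EFin_inj; rewrite EFinM -!integral_gamma_kernel//; last lra.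
rewrite -integralZl//; last exact: integrable_gamma_kernel.
(* Integration by parts: t^z exp(- t) has derivative z times the kernel at z minus the kernel at z +
   1, and vanishes at both ends. *)
transitivity ((0 - 0)%:E + \int[mu]_(t in `]0%R, +oo[) (gamma_kernel (z + 1) t)%:E)%E.
  by rewrite subr0 add0e.
apply/esym; under eq_integral do rewrite -EFinM.
apply: (@ge0_FTC_ray _ (fun t => z * gamma_kernel z t) (gamma_kernel (z + 1))
  (fun t => t `^ z * expR (- t))).
- by move=> t _; rewrite mulr_ge0 ?gamma_kernel_ge0 ?ltW.
- by move=> t _; exact: gamma_kernel_ge0.
- move=> t t0; apply: has_derivative_eq; first by derive.
  by rewrite /= /gamma_kernel addrK; ring.
- move=> t t0; apply: continuousM; first exact: cst_continuous.
  exact: continuous_gamma_kernel.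
- by move=> t t0; exact: continuous_gamma_kernel.
- exact: cvg_powR_expRN.
- exact: cvg_powR_expRN0.
Qed.

Lemma Gamma_gt0 z : 0 < z -> 0 < Gamma z.
Proof.
move=> z0; rewrite -lte_fin -integral_gamma_kernel//.
(* On [1, 2] the kernel is at least t^(-1) exp(- t), because z > 0, hence at least exp(- 2) / 2. *)
have c0 : 0 < 2^-1 * expR (- 2) :> R by rewrite mulr_gt0 ?expR_gt0.
apply: (@lt_le_trans _ _ (\int[mu]_(t in `[1%R, 2%R]) (2^-1 * expR (- 2))%:E)%E).
  rewrite integral_cst//= lebesgue_measure_itv/= lte_fin ltr1n -EFinB -EFinM lte_fin.
  by rewrite mulr_gt0//; lra.
have mg (A : set R) : measurable A -> A `<=` `]0, +oo[ ->
    measurable_fun A (fun t => (gamma_kernel z t)%:E).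
  move=> mA sA; have := measurable_int mu (integrable_gamma_kernel z z0).
  by apply: measurable_funS.
have sub : (`[1, 2]%classic : set R) `<=` `]0, +oo[%classic.
  by move=> t /=; rewrite !in_itv/= andbT => /andP[]; lra.
apply: (@le_trans _ _ (\int[mu]_(t in `[1%R, 2%R]) (gamma_kernel z t)%:E)%E).
  apply: ge0_le_integral => //.
  - exact: mg.
  - move=> t /=; rewrite in_itv/= lee_fin => /andP[t1 t2].
    have tt0 : 0 < t by lra.
    apply: ler_pM; rewrite ?expR_ge0//; last by rewrite ler_expR; lra.
    apply: (@le_trans _ _ (t `^ (-1))); last by apply: ler_powR => //; lra.
    by rewrite powR_inv1 ?(ltW tt0)// lef_pV2 ?posrE.
apply: ge0_subset_integral => //; first exact: mg.
by move=> t _; rewrite lee_fin gamma_kernel_ge0.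
Qed.

Lemma normr_ln_le (d t : R) : 0 < d -> 0 < t ->
  `|ln t| <= d^-1 * (t `^ d + t `^ (- d)).
Proof.
move=> d0 t0; have td p : 0 < t `^ p by exact: powR_gt0.
rewrite ler_pdivlMl// -{1}(gtr0_norm d0) -normrM -ln_powR ler_norml.
have /ltW h1 := ln_sublinear (td d); have /ltW h2 := ln_sublinear (td (- d)).
by move: h2 (td d) (td (- d)); rewrite !ln_powR in h1 *; lra.
Qed.

Lemma derivative_Gamma z : 0 < z ->
  [/\ derivable Gamma z 1,
      mu.-integrable `]0, +oo[ (fun t => (ln t * gamma_kernel z t)%:E)
    & Gamma^`()%classic z = \int[mu]_(t in `]0, +oo[) (ln t * gamma_kernel z t)].
Proof.
(* For exponents between [u] and [v] the kernel is at most the sum of the kernels at [u] and [v].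
   The logarithm costs a factor t^d + t^(-d), and d = z/4 keeps the smallest exponent u - d = z/4
   positive. *)
move=> z0; pose u := z / 2; pose v := z + 1; pose d := z / 4.
pose f (x t : R) := gamma_kernel x t.
have d0 : 0 < d by rewrite /d; lra.
have df x t : 0 < t -> has_derivative (f ^~ t) x (ln t * gamma_kernel x t).
  move=> t0; apply: has_derivative_eq.
    rewrite /f /gamma_kernel; apply: has_derivativeM; last exact: has_derivative_cst.
    have h := has_derivative_powR_exponent _ (x - 1) t0.
    have h' : has_derivative (fun y : R => y - 1) x (1 + 0) by derive.
    exact: (@is_derive1_comp _ (powR t) (fun y : R => y - 1) x _ _ h h').
  by rewrite /= /gamma_kernel; ring.
pose G (t : R) := d^-1 * (gamma_kernel (u + d) t + gamma_kernel (u - d) t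
   + gamma_kernel (v + d) t + gamma_kernel (v - d) t).
have zI : z \in `]u, v[ by rewrite in_itv/= /u /v; apply/andP; split; lra.
have intk x : x \in `]u, v[ -> mu.-integrable `]0, +oo[ (EFin \o f x).
  rewrite in_itv/= /u => /andP[ux _]; apply: integrable_gamma_kernel; lra.
have derf1 x t : `]u, v[%classic x -> `]0, +oo[%classic t -> derivable (f ^~ t) x 1.
  by move=> _ /=; rewrite in_itv/= andbT => t0; have [] := df x _ t0.
have G0 t : 0 <= G t.
  by rewrite mulr_ge0 ?invr_ge0 ?(ltW d0)// !addr_ge0// gamma_kernel_ge0.
have intG : mu.-integrable `]0, +oo[ (EFin \o G).
  rewrite (_ : EFin \o G = fun t => (d^-1%:E * ((gamma_kernel (u + d) t)%:E
    + (gamma_kernel (u - d) t)%:E + (gamma_kernel (v + d) t)%:E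
    + (gamma_kernel (v - d) t)%:E))%E); last by apply/funext => t; rewrite /= EFinM !EFinD.
  apply: integrableZl => //; do 3?apply: integrableD => //;
    apply: integrable_gamma_kernel; rewrite /u /v /d; lra.
have Gub x t : `]u, v[%classic x -> `]0, +oo[%classic t ->
    `|partial1of2 f x t| <= G t.
  rewrite /= !in_itv/= andbT => /andP[ux xv] t0.
  rewrite partial1of2E; have [_ ->] := df x _ t0.
  rewrite normrM [X in _ * X]ger0_norm ?gamma_kernel_ge0//.
  apply: (@le_trans _ _ (d^-1 * (t `^ d + t `^ (- d)) *
      (gamma_kernel u t + gamma_kernel v t))).
    apply: ler_pM; rewrite ?gamma_kernel_ge0 ?normr_ln_le//.
    rewrite /gamma_kernel -mulrDl ler_pM2r ?expR_gt0//.
    have [t1|t1] := lerP 1 t.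
      apply: (@le_trans _ _ (t `^ (v - 1))); last by rewrite lerDr powR_ge0.
      by apply: ler_powR => //; lra.
    apply: (@le_trans _ _ (t `^ (u - 1))); last by rewrite lerDl powR_ge0.
    by apply: ger_powR; [rewrite t0 ltW|lra].
  rewrite /G -mulrA ler_pM2l ?invr_gt0//.
  have E x' e : t `^ e * gamma_kernel x' t = gamma_kernel (x' + e) t.
    rewrite /gamma_kernel mulrA; congr (_ * _).
    by rewrite -powRD ?(gt_eqF t0) ?implybT//; congr (_ `^ _); ring.
  by rewrite mulrDl !mulrDr !E; lra.
split.
- exact: (@derivable_under_integral _ _ _ mu f `]0, +oo[ _ z u v zI intk derf1 G G0 intG Gub).
- apply: (@le_integrable _ _ _ mu _ _ _ (EFin \o G)) => //.
    apply/measurable_EFinP; apply: measurable_funM.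
      by apply: measurable_funTS; exact: measurable_ln.
    by apply/measurable_EFinP; apply: (measurable_int mu); exact: integrable_gamma_kernel.
  move=> t t0; rewrite lee_fin (ger0_norm (G0 t)).
  have := Gub z t zI t0; rewrite partial1of2E.
  by move: t0; rewrite /= in_itv/= andbT => t0; have [_ ->] := df z _ t0.
- rewrite [LHS](@differentiation_under_integral _ _ _ mu f `]0, +oo[ _ z u v zI
    intk derf1 G G0 intG Gub)//.
  apply: eq_Rintegral => t; rewrite inE/= in_itv/= andbT => t0.
  by rewrite partial1of2E; have [_ ->] := df z _ t0.
Qed.

Lemma digammaD1 z : 0 < z -> digamma (z + 1) = digamma z + z^-1.
Proof.
move=> z0; have [dz _ _] := derivative_Gamma z z0.
have z1 : 0 < z + 1 by lra.
have [dz1 _ _] := derivative_Gamma (z + 1) z1.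
have h1 : has_derivative (fun x => Gamma (x + 1)) z (Gamma^`()%classic (z + 1)).
  have h : has_derivative Gamma (z + 1) (Gamma^`()%classic (z + 1)).
    by rewrite derive1E; exact: (derivableP dz1).
  have h' : has_derivative (fun y : R => y + 1) z (1 + 0) by derive.
  apply: has_derivative_eq.
    exact: (@is_derive1_comp _ Gamma (fun y : R => y + 1) z _ _ h h').
  by rewrite addr0 mulr1.
have h2 : has_derivative (fun x => x * Gamma x) z (z * Gamma^`()%classic z + Gamma z * 1).
  apply: has_derivativeM; first exact: has_derivative_id.
  by rewrite derive1E; exact: (derivableP dz).
have h3 : has_derivative (fun x => Gamma (x + 1)) z (z * Gamma^`()%classic z + Gamma z * 1).
  apply: near_eq_is_derive h2; near=> x; apply/esym/GammaD1.
  by near: x; exact: lt_nbhsr.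
have [_ e1] := h1; have [_ e3] := h3.
have E := etrans (esym e1) e3; have G0 := Gamma_gt0 z z0.
transitivity ((z * Gamma^`()%classic z + Gamma z * 1) / (z * Gamma z)).
  by rewrite /digamma; congr (_ / _); [exact: E|exact: GammaD1].
rewrite /digamma; move: (Gamma^`()%classic z) (Gamma z) G0 => g' g g0.
by field; rewrite !gt_eqF.
Unshelve. all: by end_near. Qed.

(** Jensen's inequality for the logarithm under the Gamma law of parameter [z]: the tangent bound ln
    t <= ln z + t/z - 1 is integrated, and the mean of [t] is [z]. *)
Lemma digamma_le_ln z : 0 < z -> digamma z <= ln z.
Proof.
move=> z0; rewrite /digamma ler_pdivrMr ?Gamma_gt0//.
have [_ iz ->] := derivative_Gamma z z0.
have -> : ln z * Gamma z = \int[mu]_(t in `]0, +oo[)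
    ((ln z - 1) * gamma_kernel z t + z^-1 * gamma_kernel (z + 1) t).
  rewrite RintegralD//=.
  - rewrite !RintegralZl//; try by apply: integrable_gamma_kernel; lra.
    rewrite -[X in _ = _ + _ * X]/(Gamma (z + 1)) -[X in _ = _ * X + _]/(Gamma z).
    by rewrite GammaD1//; field; rewrite gt_eqF.
  - by apply: real_integrableZ => //; apply: integrable_gamma_kernel; lra.
  - by apply: real_integrableZ => //; apply: integrable_gamma_kernel; lra.
apply: le_Rintegral => //.
  by apply: real_integrableD => //; apply: real_integrableZ => //;
    apply: integrable_gamma_kernel; lra.
move=> t /=; rewrite in_itv/= andbT => t0.
rewrite -(gamma_kernelD1 z t t0).
move: (gamma_kernel z t) (gamma_kernel_ge0 z t) => K K0.
rewrite [z^-1 * _]mulrA -mulrDl; apply: ler_wpM2r => //.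
have tz : 0 < t / z by rewrite divr_gt0.
have := @le_ln1Dx R (t / z - 1); rewrite addrCA subrr addr0 ln_div ?posrE//.
move=> h; have {}h : ln t - ln z <= t / z - 1 by apply: h; lra.
by rewrite [z^-1 * _]mulrC; lra.
Qed.

(** The opposite tangent bound ln t >= ln z + 1 - z/t, integrated under the Gamma law of parameter z
    + 1, for which the mean of 1/t is 1/z. *)
Lemma ln_le_digammaD1 z : 0 < z -> ln z <= digamma (z + 1).
Proof.
move=> z0; have z1 : 0 < z + 1 by lra.
rewrite /digamma ler_pdivlMr ?Gamma_gt0//.
have [_ iz ->] := derivative_Gamma _ z1.
have -> : ln z * Gamma (z + 1) = \int[mu]_(t in `]0, +oo[)
    ((ln z + 1) * gamma_kernel (z + 1) t + - z * gamma_kernel z t).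
  rewrite RintegralD//=.
  - rewrite !RintegralZl//; try by apply: integrable_gamma_kernel; lra.
    rewrite -[X in _ = _ * X + _]/(Gamma (z + 1)) -[X in _ = _ + _ * X]/(Gamma z).
    by rewrite GammaD1//; ring.
  - by apply: real_integrableZ => //; apply: integrable_gamma_kernel; lra.
  - by apply: real_integrableZ => //; apply: integrable_gamma_kernel; lra.
apply: le_Rintegral => //.
  by apply: real_integrableD => //; apply: real_integrableZ => //;
    apply: integrable_gamma_kernel; lra.
move=> t /=; rewrite in_itv/= andbT => t0.
rewrite -(gamma_kernelD1 z t t0).
move: (gamma_kernel z t) (gamma_kernel_ge0 z t) => K K0.
rewrite !mulrA -mulrDl; apply: ler_wpM2r => //.
have tz : 0 < z / t by rewrite divr_gt0.
have := @le_ln1Dx R (z / t - 1); rewrite addrCA subrr addr0 ln_div ?posrE//.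
move=> h; have {}h : ln z - ln t <= z / t - 1 by apply: h; lra.
rewrite -(@ler_pM2l _ t) in h => //.
have -> : (ln z + 1) * t + - z = t * (ln z - (z / t - 1)) by field; rewrite gt_eqF.
by rewrite [leRHS]mulrC ler_pM2l//; rewrite ler_pM2l// in h; lra.
Qed.

Lemma has_derivative_ge0_le (f df : R -> R) (a b : R) : a <= b ->
  (forall x, a <= x <= b -> has_derivative f x (df x)) ->
  (forall x, a <= x <= b -> 0 <= df x) -> f a <= f b.
Proof.
rewrite le_eqVlt => /predU1P[->//|ab] fdf df0.
have inW x : x \in `]a, b[ -> a <= x <= b by rewrite in_itv/= => /andP[/ltW -> /ltW].
have [|c /inW cab] := @MVT _ f df a b ab (fun x xab => fdf x (inW x xab)).
  apply: continuous_in_subspaceT => x; rewrite inE/= in_itv/= => xab.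
  exact: has_derivative_continuous (fdf x xab).
by rewrite -subr_ge0 => ->; rewrite mulr_ge0 ?df0// subr_ge0 ltW.
Qed.

Lemma ln1D_ge (y : R) : 0 <= y -> 2 * y / (2 + y) <= ln (1 + y).
Proof.
move=> y0; rewrite -subr_ge0.
pose f (x : R) := ln (1 + x) - 2 * x / (2 + x).
pose df (x : R) := x ^+ 2 / ((1 + x) * (2 + x) ^+ 2).
suff : f 0 <= f y by rewrite /f addr0 ln1 mulr0 mul0r subr0.
apply: (has_derivative_ge0_le f df) => // x /andP[x0 _].
  apply: has_derivative_eq; first by rewrite /f; derive => //=; lra.
  by rewrite /df /=; field; rewrite !gt_eqF//; lra.
by rewrite divr_ge0 ?sqr_ge0// mulr_ge0 ?sqr_ge0//; lra.
Qed.

Lemma ln1D_le (y : R) : 0 <= y -> ln (1 + y) <= y * (2 + y) / (2 * (1 + y)).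
Proof.
move=> y0; rewrite -subr_ge0.
pose f (x : R) := x * (2 + x) / (2 * (1 + x)) - ln (1 + x).
pose df (x : R) := x ^+ 2 / (2 * (1 + x) ^+ 2).
suff : f 0 <= f y by rewrite /f !addr0 ln1 !mul0r subr0.
apply: (has_derivative_ge0_le f df) => // x /andP[x0 _].
  apply: has_derivative_eq; first by rewrite /f; derive => //=; lra.
  by rewrite /df /=; field; rewrite !gt_eqF//; lra.
by rewrite divr_ge0 ?sqr_ge0// mulr_ge0 ?sqr_ge0//; lra.
Qed.

(** Along x, x + 1, x + 2, ... the values increase while being bounded by a sequence tending to 0.
    This upgrades the crude logarithmic bounds on digamma to second-order ones, only the increments
    having to be estimated. *)
Lemma nondecreasing_step_le0 (u : R -> R) :
  (forall x, 0 < x -> u x <= u (x + 1)) -> (forall x, 0 < x -> u x <= x^-1) ->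
  forall x, 0 < x -> u x <= 0.
Proof.
move=> u1 uV x x0; rewrite leNgt; apply/negP => ux.
have un n : u x <= u (x + n%:R).
  elim: n => [|n IH]; first by rewrite addr0.
  apply: (le_trans IH); rewrite -natr1 addrA; apply: u1.
  by rewrite ltr_wpDr.
pose n := (Num.truncn (u x)^-1).+1.
have n0 : 0 < n%:R :> R by rewrite ltr0n.
have : u x < u x.
  have xn : 0 < x + n%:R by rewrite ltr_wpDr.
  apply: (le_lt_trans (un n)); apply: (le_lt_trans (uV _ xn)).
  rewrite -[ltRHS]invrK ltf_pV2 ?posrE ?invr_gt0//.
  apply: (@lt_le_trans _ _ n%:R); last by rewrite lerDr ltW.
  exact: Num.Theory.truncnS_gt.
by rewrite ltxx.
Qed.

(** With y = 1/x, [ln1D_le] is the trapezoidal bound ln(x+1) - ln x <= 1/(2x) + 1/(2(x+1)), which is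
    exactly the monotonicity of [u] under unit steps. *)
Lemma digamma_le z : 0 < z -> digamma z <= ln z - (2 * z)^-1.
Proof.
pose u (x : R) := digamma x - ln x + (2 * x)^-1.
suff h : forall x, 0 < x -> u x <= 0 by move=> /h; rewrite /u; lra.
apply: nondecreasing_step_le0 => x x0; rewrite /u.
  have x1 : 0 < 1 + x^-1 by rewrite addr_gt0// invr_gt0.
  have -> : ln (x + 1) = ln x + ln (1 + x^-1).
    by rewrite -lnM ?posrE//; congr ln; field; rewrite gt_eqF.
  rewrite digammaD1//; have := ln1D_le x^-1; rewrite invr_ge0 => /(_ (ltW x0)).
  set L := ln (1 + x^-1).
  have -> : x^-1 * (2 + x^-1) / (2 * (1 + x^-1)) = (2 * x)^-1 + (2 * (x + 1))^-1.
    by field; rewrite !gt_eqF//; lra.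
  have -> : x^-1 = (2 * x)^-1 + (2 * x)^-1 by field; rewrite gt_eqF.
  lra.
have := digamma_le_ln x x0; have x2 : 0 < x^-1 by rewrite invr_gt0.
rewrite invfM; lra.
Qed.

(** With y = 1/x, [ln1D_ge] is the midpoint bound ln(x+1) - ln x >= 1/(x + 1/2). The constant 8, in
    place of the optimal 12, is what this bound supports: the increments of [u] are at least 1/(8
    x^2 (x+1)^2 (2x+1)). *)
Lemma digamma_ge z : 0 < z -> ln z - (2 * z)^-1 - (8 * z ^+ 2)^-1 <= digamma z.
Proof.
pose u (x : R) := - (digamma x - ln x + (2 * x)^-1 + (8 * x ^+ 2)^-1).
suff h : forall x, 0 < x -> u x <= 0 by move=> /h; rewrite /u; lra.
apply: nondecreasing_step_le0 => x x0; rewrite /u.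
  have x1 : 0 < 1 + x^-1 by rewrite addr_gt0// invr_gt0.
  have -> : ln (x + 1) = ln x + ln (1 + x^-1).
    by rewrite -lnM ?posrE//; congr ln; field; rewrite gt_eqF.
  rewrite digammaD1//; have := ln1D_ge x^-1; rewrite invr_ge0 => /(_ (ltW x0)).
  set L := ln (1 + x^-1).
  have -> : 2 * x^-1 / (2 + x^-1) = 2 / (2 * x + 1).
    by field; rewrite !gt_eqF//; lra.
  move=> hL; rewrite lerN2.
  suff : x^-1 + (2 * (x + 1))^-1 + (8 * (x + 1) ^+ 2)^-1 <=
      2 / (2 * x + 1) + (2 * x)^-1 + (8 * x ^+ 2)^-1 by lra.
  rewrite -subr_ge0.
  have -> : 2 / (2 * x + 1) + (2 * x)^-1 + (8 * x ^+ 2)^-1 -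
      (x^-1 + (2 * (x + 1))^-1 + (8 * (x + 1) ^+ 2)^-1) =
      (8 * x ^+ 2 * (x + 1) ^+ 2 * (2 * x + 1))^-1.
    by field; rewrite !gt_eqF//; lra.
  by rewrite invr_ge0 !mulr_ge0 ?sqr_ge0//; lra.
have h := ln_le_digammaD1 x x0; rewrite digammaD1// in h.
have x2 : 0 < x^-1 by rewrite invr_gt0.
have x3 : 0 < (8 * x ^+ 2)^-1 by rewrite invr_gt0 mulr_gt0// exprn_gt0.
rewrite [(2 * x)^-1]invfM; lra.
Qed.

Lemma sum_inv_digamma n :
  \sum_(1 <= k < n.+1) (k%:R^-1 : R) = digamma n.+1%:R - digamma 1.
Proof.
elim: n => [|n IH]; first by rewrite big_geq// subrr.
have := digammaD1 n.+1%:R (ltr0Sn _ n); rewrite natr1 => ->.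
rewrite big_nat_recr//= IH.
by move: (digamma 1) (digamma _) => x y; rewrite addrAC.
Qed.

Lemma cvg_invn : (n%:R^-1 : R) @[n --> \oo] --> (0 : R).
Proof.
rewrite -(cvg_shiftn 1); under eq_fun do rewrite addn1; exact: cvg_harmonic.
Qed.

Lemma sum_inv_approx n : (0 < n)%N ->
  - (8 * n%:R ^+ 2)^-1 <= \sum_(1 <= k < n.+1) (k%:R^-1 : R) + digamma 1
    - ln n%:R - (2 * n%:R)^-1 <= 0.
Proof.
move=> n0; have n1 : 0 < n%:R :> R by rewrite ltr0n.
rewrite sum_inv_digamma subrK -[n.+1%:R]natr1 digammaD1//.
have := digamma_le _ n1; have := digamma_ge _ n1.
have -> : n%:R^-1 = (2 * n%:R)^-1 + (2 * n%:R)^-1 :> R by field; rewrite gt_eqF.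
by move=> h1 h2; apply/andP; split; lra.
Qed.

(** The partial sums that lead to the Barnes constant contain 2 n H_n, so harmonic numbers must be
    known up to o(1/n). The limit 1/2 found here becomes the summand 1 of the final formula. *)
Lemma cvg_sum_inv_scaled :
  n%:R * (\sum_(1 <= k < n.+1) (k%:R^-1 : R) + digamma 1 - ln n%:R) @[n --> \oo]
  --> (2^-1 : R).
Proof.
apply: (@squeeze_cvgr _ _ _ _ (fun n => 2^-1 - 8^-1 * n%:R^-1) (fun=> 2^-1)).
- near=> n; have n0 : (0 < n)%N by near: n; exact: nbhs_infty_gt.
  have n1 : 0 < n%:R :> R by rewrite ltr0n.
  have /andP[] := sum_inv_approx _ n0.
  move: (\sum_(1 <= k < n.+1) _ + _ - _) => S h1 h2.
  have -> : 2^-1 - 8^-1 * n%:R^-1 =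
      n%:R * ((2 * n%:R)^-1 - (8 * n%:R ^+ 2)^-1) :> R by field; rewrite gt_eqF.
  rewrite ler_pM2l//; apply/andP; split; first by lra.
  have -> : 2^-1 = n%:R * (2 * n%:R)^-1 :> R by field; rewrite gt_eqF.
  by rewrite ler_pM2l//; lra.
- rewrite -[X in _ --> X]subr0 -[X in _ - X](mulr0 (8^-1 : R)).
  apply: cvgB; first exact: cvg_cst.
  by apply: cvgM; [exact: cvg_cst|exact: cvg_invn].
- exact: cvg_cst.
Unshelve. all: by end_near. Qed.

Lemma cvg_sum_inv_ln :
  \sum_(1 <= k < n.+1) (k%:R^-1 : R) - ln n%:R @[n --> \oo] --> - digamma (1 : R).
Proof.
have h : n%:R^-1 * (n%:R * (\sum_(1 <= k < n.+1) (k%:R^-1 : R) + digamma 1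
    - ln n%:R)) - digamma 1 @[n --> \oo] --> (0 * 2^-1 - digamma 1 : R).
  apply: cvgB; last exact: cvg_cst.
  by apply: cvgM; [exact: cvg_invn|exact: cvg_sum_inv_scaled].
rewrite mul0r sub0r in h; apply: cvg_trans h; apply: near_eq_cvg.
near=> n; have n0 : (0 < n)%N by near: n; exact: nbhs_infty_gt.
by rewrite mulKf ?pnatr_eq0 -?lt0n//; ring.
Unshelve. all: by end_near. Qed.

Lemma digamma1 : digamma 1 = - euler_gamma R.
Proof. by rewrite /euler_gamma (cvg_lim _ cvg_sum_inv_ln)// opprK. Qed.

Lemma cvg_digamma_ln (b : R) : 0 < b ->
  digamma (n%:R * b) - ln (n%:R * b) @[n --> \oo] --> (0 : R).
Proof.
move=> b0; apply: (@squeeze_cvgr _ _ _ _ (fun n => - b^-1 * n%:R^-1) (fun=> 0)).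
- near=> n; have n0 : (0 < n)%N by near: n; exact: nbhs_infty_gt.
  have nb : 0 < n%:R * b by rewrite mulr_gt0// ltr0n.
  have := digamma_le_ln _ nb; have := ln_le_digammaD1 _ nb; rewrite digammaD1//.
  rewrite mulNr -invfM [b * _]mulrC => h1 h2.
  by rewrite lerBrDr lerBlDr; apply/andP; split; lra.
- rewrite -[X in _ --> X](mulr0 (- b^-1)).
  by apply: cvgM; [exact: cvg_cst|exact: cvg_invn].
- exact: cvg_cst.
Unshelve. all: by end_near. Qed.

End gamma_function.

Section real_integral_value.
Context {d} {T : measurableType d} {R : realType}.
Context {mu : {measure set T -> \bar R}} {D : set T}.
Implicit Types (f g : T -> R) (v w : R).

Definition has_integral f v : Prop := [/\ measurable D,
  mu.-integrable D (EFin \o f) & (\int[mu]_(x in D) (f x)%:E = v%:E)%E].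

Lemma ge0_has_integral f v : measurable D -> measurable_fun D f ->
  (forall x, D x -> 0 <= f x) ->
  (\int[mu]_(x in D) (f x)%:E = v%:E)%E -> has_integral f v.
Proof.
move=> mD mf f0 fv; split => //; apply/integrableP; split; first exact/measurable_EFinP.
under eq_integral => x /[!inE] Dx do rewrite /= (ger0_norm (f0 x Dx)).
by rewrite fv ltry.
Qed.

Lemma has_integral_eq {f v} g w : has_integral f v ->
  (forall x, D x -> f x = g x) -> v = w -> has_integral g w.
Proof.
move=> [mD fi fv] fg <-; split => //.
  by apply: eq_integrable fi => // x /[!inE] Dx /=; rewrite fg.
by rewrite -fv; apply: eq_integral => x /[!inE] Dx; rewrite fg.
Qed.

Lemma has_integralD {f g v w} : has_integral f v -> has_integral g w ->
  has_integral (fun x => f x + g x) (v + w).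
Proof.
move=> [mD fi fv] [_ gi gw]; split => //; first exact: real_integrableD.
by under eq_integral do rewrite EFinD; rewrite integralD//= fv gw.
Qed.

Lemma has_integralZ {f v} k : has_integral f v ->
  has_integral (fun x => k * f x) (k * v).
Proof.
move=> [mD fi fv]; split => //; first exact: real_integrableZ.
by under eq_integral do rewrite EFinM; rewrite integralZl//= fv.
Qed.

Lemma has_integralN {f v} : has_integral f v ->
  has_integral (fun x => - f x) (- v).
Proof.
move=> /(has_integralZ (-1)) h; apply: has_integral_eq h _ _ => [x _|];
  by rewrite mulN1r.
Qed.

Lemma has_integralB {f g v w} : has_integral f v -> has_integral g w ->
  has_integral (fun x => f x - g x) (v - w).
Proof. by move=> fv /has_integralN; exact: has_integralD. Qed.

Lemma has_integral_sum n (f : nat -> T -> R) (v : nat -> R) :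
  (forall j, has_integral (f j) (v j)) ->
  has_integral (fun x => \sum_(0 <= j < n) f j x) (\sum_(0 <= j < n) v j).
Proof.
move=> fv; elim: n => [|n IH].
  apply: (has_integral_eq _ _ (has_integralZ 0 (fv 0%N))) => [x _|];
    by rewrite big_geq ?mul0r.
by apply: has_integral_eq (has_integralD IH (fv n)) _ _ => [x _|];
  rewrite big_nat_recr.
Qed.

End real_integral_value.
Arguments has_integral {d T R} mu D f v.

(** * Bernoulli's inequality for real exponents *)

Section power_bounds.
Context {R : realType}.
Implicit Types b x z w : R.

(** After taking logarithms: ln(1 + b (y - 1)) - b ln y has a derivative of the sign of y - 1, hence
    its minimum 0 at y = 1. *)
Lemma powR_le_bernoulli b x : 0 < b < 1 -> 0 < x -> x `^ b <= 1 + b * (x - 1).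
Proof.
move=> /andP[b0 b1] x0.
have [h|h] := lerP (1 + b * (x - 1)) 0.
  suff : 0 < 1 + b * (x - 1) by rewrite ltNge h.
  have -> : 1 + b * (x - 1) = (1 - b) + b * x by ring.
  by rewrite addr_gt0 ?mulr_gt0 ?subr_gt0.
rewrite /powR gt_eqF// -[leRHS](lnK (x := 1 + b * (x - 1))) ?posrE// ler_expR.
pose f (y : R) := ln (1 + b * (y - 1)) - b * ln y.
pose df (y : R) := b * (1 - b) * (y - 1) / ((1 + b * (y - 1)) * y).
have pos y : 0 < y -> 0 < 1 + b * (y - 1).
  move=> y0; have -> : 1 + b * (y - 1) = (1 - b) + b * y by ring.
  by rewrite addr_gt0 ?mulr_gt0 ?subr_gt0.
have dfP y : 0 < y -> has_derivative f y (df y).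
  move=> y0; have := pos _ y0 => y1; apply: has_derivative_eq.
    by rewrite /f; derive.
  rewrite /df /=; field.
  by rewrite !gt_eqF.
have f1 : f 1 = 0 by rewrite /f subrr mulr0 addr0 !ln1 mulr0 subr0.
rewrite -subr_ge0 -[leRHS]/(f x) -f1; have [x1|x1] := lerP 1 x.
  apply: (has_derivative_ge0_le f df) => // y /andP[y1 _].
    by apply: dfP; lra.
  have y0 : 0 < y by lra.
  by rewrite divr_ge0 ?mulr_ge0 ?subr_ge0// ltW// pos.
rewrite -lerN2.
apply: (has_derivative_ge0_le (fun y => - f y) (fun y => - df y)); first exact: ltW.
  by move=> y /andP[y1 _]; apply: (has_derivativeN f); apply: dfP; lra.
move=> y /andP[xy y1]; have y0 : 0 < y by lra.
rewrite -mulNr -mulrN divr_ge0 ?mulr_ge0 ?subr_ge0 ?oppr_ge0 ?subr_le0//; try lra.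
by rewrite ltW// pos.
Qed.

Lemma powRN_inv x b : (x^-1) `^ b = (x `^ b)^-1.
Proof.
have [x0|x0|->] := ltrgtP x 0; last first.
- by rewrite invr0; have [->|b0] := eqVneq b 0; rewrite ?powRr0 ?invr1// powR0// invr0.
- by rewrite -powR_inv1 ?ltW// -powRrM mulN1r powRN.
- by rewrite !lt0_powR1 ?invr_lt0// invr1.
Qed.

Lemma powR_sub1_le b x : 0 < b < 1 -> 0 < x -> x `^ b - 1 <= b * (x - 1).
Proof. by move=> b01 x0; have := powR_le_bernoulli b x b01 x0; lra. Qed.

(** Bernoulli's inequality at 1/x, multiplied by x^b. *)
Lemma powR_sub1_ge b x : 0 < b < 1 -> 1 < x -> b * (x - 1) / x * x `^ b <= x `^ b - 1.
Proof.
move=> b01 x1; have x0 : 0 < x by lra.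
have := powR_le_bernoulli b x^-1 b01; rewrite invr_gt0 powRN_inv => /(_ x0) h.
have y0 : 0 < x `^ b by exact: powR_gt0.
have : (x `^ b)^-1 * x `^ b <= (1 + b * (x^-1 - 1)) * x `^ b by rewrite ler_pM2r.
rewrite mulVf ?gt_eqF// => {}h.
have -> : b * (x - 1) / x = - (b * (x^-1 - 1)) by field; rewrite gt_eqF.
lra.
Qed.

Lemma powR_gt1 b x : 0 < b -> 1 < x -> 1 < x `^ b.
Proof.
move=> b0 x1; have <- : 1 `^ b = 1 :> R by rewrite powR1.
by apply: gt0_ltr_powR; rewrite ?nnegrE//; lra.
Qed.

Lemma powR_sub1_ge' b x : 0 < b < 1 -> 1 < x -> b * (x - 1) / x <= x `^ b - 1.
Proof.
move=> b01 x1; apply: le_trans (powR_sub1_ge b x b01 x1).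
have /andP[b0 b1] := b01; apply: ler_peMr.
  by rewrite divr_ge0 ?mulr_ge0//; lra.
by apply/ltW/powR_gt1.
Qed.

End power_bounds.

(** * The edge integral and the Barnes modular constant *)

Section edge_density.
Context {R : realType}.
Local Notation mu := (@lebesgue_measure R).
Implicit Types b x z w : R.

(* The primitive of [x^(2b-2)] vanishing at 1. *)
Definition powR_primitive b x : R :=
  if b == 2^-1 then ln x else (x `^ (2 * b - 1) - 1) / (2 * b - 1).

Definition edge_numerator b x : R := x `^ b - x `^ (b - 1) - powR_primitive b x.

Definition edge_density b x : R :=
  edge_numerator b x / ((x - 1) * (x `^ b - 1) ^+ 2).

Lemma powR_primitive1 b : powR_primitive b 1 = 0.
Proof. by rewrite /powR_primitive; case: ifPn => _; rewrite ?ln1 ?powR1 ?subrr ?mul0r. Qed.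

Lemma has_derivative_powR_primitive b x : 0 < x ->
  has_derivative (powR_primitive b) x (x `^ (2 * b - 2)).
Proof.
move=> x0; have [->|b2] := eqVneq b 2^-1.
  rewrite (_ : powR_primitive _ = fun y => ln y); last first.
    by apply/funext => y; rewrite /powR_primitive eqxx.
  apply: has_derivative_eq; first by derive.
  have -> : 2 * 2^-1 - 2 = -1 :> R by lra.
  by rewrite powR_inv1 ?ltW// mulr1.
rewrite (_ : powR_primitive _ = fun y => (y `^ (2 * b - 1) - 1) / (2 * b - 1));
  last by apply/funext => y; rewrite /powR_primitive (negbTE b2).
apply: has_derivative_eq; first by derive.
rewrite /= mulr0 add0r addr0 mulr1.
have -> : 2 * b - 1 - 1 = 2 * b - 2 by ring.
have b0 : 2 * b - 1 != 0.
  by apply: contra b2 => /eqP h; apply/eqP; lra.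
by rewrite mulrA mulVf// mul1r.
Qed.

Lemma powR_primitive_ge0 b x : 1 <= x -> 0 <= powR_primitive b x.
Proof.
move=> x1; rewrite -[leLHS](powR_primitive1 b).
apply: (has_derivative_ge0_le _ (fun y => y `^ (2 * b - 2))) => // y /andP[y1 _].
  by apply: has_derivative_powR_primitive; lra.
exact: powR_ge0.
Qed.

(** The factored form exhibits the sign of the derivative through Bernoulli's inequality. *)
Lemma has_derivative_edge_numerator b x : 0 < x ->
  has_derivative (edge_numerator b) x (x `^ (b - 2) * (1 + b * (x - 1) - x `^ b)).
Proof.
move=> x0; apply: has_derivative_eq.
  apply: has_derivativeB; last exact: has_derivative_powR_primitive.
  by derive.
rewrite /= !mulr1 mulrBr -powRD; last by rewrite (gt_eqF x0) implybT.
have -> : b - 2 + b = 2 * b - 2 by ring.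
have -> : b - 1 - 1 = b - 2 by ring.
have -> : x `^ (b - 1) = x * x `^ (b - 2).
  by rewrite -(mulr_powRB1_gt0 (b - 1))//; congr (_ * _ `^ _); ring.
ring.
Qed.

Lemma edge_numerator1 b : edge_numerator b 1 = 0.
Proof. by rewrite /edge_numerator powR_primitive1 !powR1 subrr subr0. Qed.

Lemma edge_numerator_ge0 b x : 0 < b < 1 -> 1 <= x -> 0 <= edge_numerator b x.
Proof.
move=> b01 x1; rewrite -[leLHS](edge_numerator1 b).
apply: (has_derivative_ge0_le _ (fun y => y `^ (b - 2) * (1 + b * (y - 1) - y `^ b)))
  => // y /andP[y1 _].
  by apply: has_derivative_edge_numerator; lra.
by rewrite mulr_ge0 ?powR_ge0// subr_ge0 powR_le_bernoulli//; lra.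
Qed.

(** The denominator of [edge_density] vanishes like b^2 (x - 1)^3 at 1, so the numerator must vanish
    to third order. By the two Bernoulli bounds its derivative is at most (b/y) (y - 1)^2. *)
Lemma edge_numerator_le_cube b x : 0 < b < 1 -> 1 <= x ->
  edge_numerator b x <= (x - 1) ^+ 3.
Proof.
move=> b01 x1; have /andP[b0 b1] := b01.
pose f (y : R) := (y - 1) ^+ 3 - edge_numerator b y.
pose df (y : R) := 3 * (y - 1) ^+ 2 - y `^ (b - 2) * (1 + b * (y - 1) - y `^ b).
rewrite -subr_ge0 -[leRHS]/(f x).
have <- : f 1 = 0 by rewrite /f edge_numerator1 subrr expr0n subr0.
apply: (has_derivative_ge0_le f df _ _ x1) => y /andP[y1 _].
  apply: has_derivativeB; last by apply: has_derivative_edge_numerator; lra.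
  have -> : (fun y => (y - 1) ^+ 3) = (fun y : R => (y - 1) * ((y - 1) * (y - 1))).
    by apply/funext => z; rewrite !exprS expr0 mulr1.
  by apply: has_derivative_eq; [derive|rewrite /=; ring].
rewrite /df subr_ge0; have y0 : 0 < y by lra.
have := powR_le_bernoulli b y b01 y0 => h.
apply: (@le_trans _ _ (1 + b * (y - 1) - y `^ b)).
  apply: ler_piMl; first by rewrite subr_ge0.
  apply: (@le_trans _ _ (y `^ 0)); last by rewrite powRr0.
  by apply: ler_powR => //; lra.
move: y1; rewrite le_eqVlt => /predU1P[<-|y1]; first by rewrite !subrr powR1 !mulr0 expr0n mulr0; lra.
have := powR_sub1_ge' b y b01 y1 => h'.
apply: (@le_trans _ _ (b * (y - 1) - b * (y - 1) / y)); first by lra.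
have -> : b * (y - 1) - b * (y - 1) / y = b / y * (y - 1) ^+ 2.
  by field; rewrite gt_eqF.
apply: ler_wpM2r; first exact: sqr_ge0.
by rewrite ler_pdivrMr//; lra.
Qed.

Lemma edge_density_ge0 b x : 0 < b < 1 -> 1 < x -> 0 <= edge_density b x.
Proof.
move=> b01 x1; rewrite divr_ge0 ?edge_numerator_ge0 ?(ltW x1)//.
by rewrite mulr_ge0 ?sqr_ge0//; lra.
Qed.

(** The first summand bounds the density for 1 < x <= 2, the second one for x > 2. *)
Definition edge_majorant_const (b0 : R) : R :=
  16 / b0 ^+ 2 + ((1 - 2 `^ (- b0)) ^+ 2)^-1.

(** Uniform in [b >= b0], as required to pass to the limit in [b] under the integral. Near 1 the
    cube of x - 1 cancels; beyond 2 the numerator is at most x^(b-1) (x - 1) and x^b - 1 is at least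
    a fixed fraction of x^b. *)
Lemma edge_density_le b0 b x : 0 < b0 -> b0 <= b < 1 -> 1 < x ->
  edge_density b x <= edge_majorant_const b0 * x `^ (- b0 - 1).
Proof.
move=> b00 /andP[b0b b1] x1; have x0 : 0 < x by lra.
have b01 : 0 < b < 1 by apply/andP; split; lra.
have c0 : 0 < 1 - 2 `^ (- b0).
  rewrite subr_gt0 powRN invf_lt1 ?powR_gt0//.
  by apply: powR_gt1 => //; lra.
have pb : 0 < x `^ (- b0 - 1) by exact: powR_gt0.
have xb := powR_gt1 b x _ x1.
have dpos : 0 < (x - 1) * (x `^ b - 1) ^+ 2.
  by rewrite mulr_gt0 ?exprn_gt0 ?subr_gt0//; apply: powR_gt1 => //; lra.
have [x2|x2] := lerP x 2.
  apply: (@le_trans _ _ (16 / b0 ^+ 2 * x `^ (- b0 - 1))); last first.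
    by rewrite ler_pM2r// lerDl invr_ge0 sqr_ge0.
  (* For x <= 2 and b0 < 1, x^(-b0-1) >= x^(-2) >= 1/4. *)
  apply: (@le_trans _ _ (16 / b0 ^+ 2 * 4^-1)); last first.
    rewrite ler_pM2l ?divr_gt0 ?exprn_gt0//.
    apply: (@le_trans _ _ (x `^ (-2))); last by apply: ler_powR; lra.
    rewrite (@powR_invn _ x 2 (ltW x0)) lef_pV2 ?posrE ?exprn_gt0//; nra.
  rewrite /edge_density ler_pdivrMr//.
  apply: (le_trans (edge_numerator_le_cube b x b01 (ltW x1))).
  have h : b0 * (x - 1) / 2 <= x `^ b - 1.
    apply: le_trans (powR_sub1_ge' b x b01 x1).
    have bb : b0 * x <= b * 2 by nra.
    have -> : b0 * (x - 1) / 2 = (x - 1) / (2 * x) * (b0 * x).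
      by field; rewrite gt_eqF.
    have -> : b * (x - 1) / x = (x - 1) / (2 * x) * (b * 2).
      by field; rewrite gt_eqF.
    by rewrite ler_pM2l// divr_gt0//; lra.
  have h2 : (b0 * (x - 1) / 2) ^+ 2 <= (x `^ b - 1) ^+ 2.
    rewrite lerXn2r ?nnegrE//; first by rewrite divr_ge0 ?mulr_ge0//; lra.
    by apply: le_trans h; rewrite divr_ge0 ?mulr_ge0//; lra.
  apply: (@le_trans _ _ (16 / b0 ^+ 2 * 4^-1 * ((x - 1) * (b0 * (x - 1) / 2) ^+ 2))).
    rewrite le_eqVlt; apply/orP; left; apply/eqP; field.
    by rewrite gt_eqF.
  rewrite ler_pM2l; last by rewrite !mulr_gt0 ?invr_gt0 ?exprn_gt0.
  by rewrite ler_pM2l// subr_gt0.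
apply: (@le_trans _ _ (((1 - 2 `^ (- b0)) ^+ 2)^-1 * x `^ (- b0 - 1))); last first.
  by rewrite ler_pM2r// lerDr divr_ge0// sqr_ge0.
rewrite /edge_density ler_pdivrMr// mulrC.
apply: (@le_trans _ _ (x `^ (b - 1) * (x - 1))).
  rewrite /edge_numerator mulrBr mulr1 mulrC mulr_powRB1_gt0//.
  by have := powR_primitive_ge0 b x (ltW x1); lra.
rewrite [leLHS]mulrC -[leRHS]mulrA ler_pM2l ?subr_gt0//.
have h : (1 - 2 `^ (- b0)) * x `^ b <= x `^ b - 1.
  rewrite mulrBl mul1r lerD2l lerN2.
  apply: (@le_trans _ _ (x `^ (- b) * x `^ b)).
    by rewrite powRN mulVf// gt_eqF// powR_gt0.
  rewrite ler_pM2r ?powR_gt0//.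
  apply: (@le_trans _ _ (x `^ (- b0))); first by apply: ler_powR; lra.
  rewrite !powRN lef_pV2 ?posrE ?powR_gt0//.
  by apply: ge0_ler_powR; rewrite ?nnegrE; lra.
have h2 : ((1 - 2 `^ (- b0)) * x `^ b) ^+ 2 <= (x `^ b - 1) ^+ 2.
  rewrite lerXn2r ?nnegrE//; first by rewrite mulr_ge0 ?powR_ge0 ?ltW.
  by apply: le_trans h; rewrite mulr_ge0 ?powR_ge0 ?ltW.
apply: (@le_trans _ _ (((1 - 2 `^ (- b0)) * x `^ b) ^+ 2 *
   (((1 - 2 `^ (- b0)) ^+ 2)^-1 * x `^ (- b0 - 1)))); last first.
  by rewrite ler_pM2r ?mulr_gt0 ?invr_gt0 ?exprn_gt0.
rewrite exprMn mulrACA mulfV ?gt_eqF ?exprn_gt0// mul1r.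
rewrite expr2 -!powRD; try by rewrite (gt_eqF x0) implybT.
by apply: ler_powR; lra.
Qed.

Lemma cvg_powRN z : 0 < z -> t `^ (- z) @[t --> +oo] --> (0 : R).
Proof.
move=> z0; under eq_fun do rewrite powRN; apply/gtr0_cvgV0.
  near=> t; apply: powR_gt0; near: t; apply: nbhs_pinfty_gt; rewrite num_real//.
apply/cvgryPge => A; near=> t.
have A0 : 0 < `|A| + 1 by rewrite ltr_wpDl.
have tA : (`|A| + 1) `^ z^-1 <= t.
  by near: t; apply: nbhs_pinfty_ge; rewrite num_real.
apply: (@le_trans _ _ (((`|A| + 1) `^ z^-1) `^ z)).
  rewrite -powRrM mulVf ?gt_eqF// powRr1 ?(ltW A0)//.
  by apply: (le_trans (ler_norm A)); rewrite lerDl.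
have t0 : 0 <= t := le_trans (powR_ge0 _ _) tA.
by apply: ge0_ler_powR; rewrite ?nnegrE ?powR_ge0// ltW.
Unshelve. all: by end_near. Qed.

Lemma has_integral_powRN z : 0 < z ->
  has_integral mu `]1, +oo[ (fun x => x `^ (- z - 1)) z^-1.
Proof.
move=> z0; apply: ge0_has_integral => //.
- by apply: measurable_funTS; exact: measurable_powR.
- by move=> x _; exact: powR_ge0.
transitivity ((0 - - z^-1)%:E + \int[mu]_(t in `]1%R, +oo[) (0 : R)%:E)%E; last first.
  by rewrite integral0_eq// adde0 sub0r opprK.
apply: (@ge0_FTC_ray _ _ (fun=> 0) (fun x => - z^-1 * x `^ (- z))).
- by move=> t _; exact: powR_ge0.
- by [].
- move=> t t1; apply: has_derivative_eq; first by derive; lra.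
  by rewrite /= subr0 mulr1 mulr0 addr0 mulrA mulrNN mulVf ?gt_eqF// mul1r.
- by move=> t t1; apply: continuous_powRl; lra.
- by move=> t _; exact: cst_continuous.
- rewrite -[X in _ --> X](mulr0 (- z^-1)).
  by apply: cvgM; [exact: cvg_cst|exact: cvg_powRN].
- have c : {for (1 : R), continuous (fun x => - z^-1 * x `^ (- z))}.
    by apply: has_derivative_continuous; derive.
  by have := cvg_at_right_filter c; rewrite one_powR mulr1.
Qed.

Lemma measurable_edge_density b : 0 < b -> measurable_fun (`]1, +oo[%classic : set R) (edge_density b).
Proof.
move=> b0.
apply: open_continuous_measurable_fun => // x; rewrite inE/= in_itv/= andbT => x1.
have x0 : 0 < x by lra.
apply: has_derivative_continuous; rewrite /edge_density.
apply: has_derivativeM; first exact: has_derivative_edge_numerator.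
apply: has_derivativeV; last by derive.
by rewrite mulf_neq0 ?expf_neq0// gt_eqF// subr_gt0//; apply: powR_gt1.
Qed.

End edge_density.

#[local] Opaque digamma.

Section edge_integral.
Context {R : realType}.
Local Notation mu := (@lebesgue_measure R).
Implicit Types b x z w : R.

Lemma integrable_edge_density b : 0 < b < 1 ->
  mu.-integrable `]1, +oo[ (EFin \o edge_density b).
Proof.
move=> b01; have /andP[b0 b1] := b01.
have [_ ig _] := has_integralZ (edge_majorant_const b) (has_integral_powRN b b0).
apply: le_integrable ig => //.
  by apply/measurable_EFinP; exact: measurable_edge_density.
move=> x /=; rewrite in_itv/= andbT => x1; rewrite lee_fin ger0_norm ?edge_density_ge0//.
apply: le_trans (ler_norm _); apply: edge_density_le => //.
by rewrite lexx.
Qed.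

Definition edge_integral b : R := \int[mu]_(x in `]1, +oo[) edge_density b x.

Lemma has_integral_edge_density b : 0 < b < 1 ->
  has_integral mu `]1, +oo[ (edge_density b) (edge_integral b).
Proof.
move=> b01; have i := integrable_edge_density b b01; split => //.
by rewrite /edge_integral /Rintegral fineK//; exact: integrable_fin_num.
Qed.

Lemma cvg_digammaB z w : 0 < z -> 0 < w ->
  digamma (z + n%:R) - digamma (w + n%:R) @[n --> \oo] --> (0 : R).
Proof.
move=> z0 w0.
have main y : 0 < y -> digamma (y + n%:R) - ln n%:R @[n --> \oo] --> (0 : R).
  move=> y0.
  apply: (@squeeze_cvgr _ _ _ _ (fun n => - n%:R^-1) (fun n => y * n%:R^-1)).
  - near=> n; have n0 : (0 < n)%N by near: n; exact: nbhs_infty_gt.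
    have n1 : 0 < n%:R :> R by rewrite ltr0n.
    have yn : 0 < y + n%:R by rewrite addr_gt0.
    have := digamma_le_ln _ yn; have := ln_le_digammaD1 _ yn; rewrite digammaD1//.
    have E : ln (y + n%:R) = ln n%:R + ln (1 + y / n%:R).
      rewrite -lnM ?posrE//; last by rewrite addr_gt0// divr_gt0.
      by congr ln; field; rewrite gt_eqF.
    have l0 : 0 <= ln (1 + y / n%:R) by rewrite ln_ge0// lerDl divr_ge0// ltW.
    have l1 : ln (1 + y / n%:R) <= y / n%:R.
      by apply: le_ln1Dx; apply: (@lt_trans _ _ 0); rewrite ?ltrN10// divr_gt0.
    have i : (y + n%:R)^-1 <= n%:R^-1 :> R.
      by rewrite lef_pV2 ?posrE// lerDr ltW.
    by rewrite E => h1 h2; apply/andP; split; lra.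
  - by rewrite -oppr0; apply: cvgN; exact: cvg_invn.
  - rewrite -[X in _ --> X](mulr0 y).
    by apply: cvgM; [exact: cvg_cst|exact: cvg_invn].
rewrite (_ : (fun n => _) = (fun n : nat => (digamma (z + n%:R) - ln n%:R) -
    (digamma (w + n%:R) - ln n%:R))); last first.
  apply/funext => n; move: (digamma (z + n%:R)) (digamma (w + n%:R)) => *; ring.
by rewrite -[X in _ --> X]subr0; apply: cvgB; exact: main.
Unshelve. all: by end_near. Qed.

(** 1/(x - 1) is expanded into the powers x^(-k-1). The k-th term integrates to 1/(z+k) - 1/(w+k),
    and these differences telescope by the recurrence of digamma. The reduction to [z <= w] makes
    all terms nonnegative, which justifies the exchange. *)
Lemma has_integral_digammaB z w : 0 < z -> 0 < w ->
  has_integral mu `]1, +oo[ (fun x => (x `^ (- z) - x `^ (- w)) / (x - 1))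
    (digamma w - digamma z).
Proof.
wlog zw : z w / z <= w.
  move=> H z0 w0; have [|wz] := lerP z w; first by move=> zw; exact: H.
  apply: has_integral_eq (has_integralN (H w z (ltW wz) w0 z0)) _ _ => [x _|];
    last by ring.
  by rewrite -mulNr opprB.
move=> z0 w0.
pose f k (x : R) := x `^ (- (z + k%:R) - 1) - x `^ (- (w + k%:R) - 1).
have fk k : has_integral mu `]1, +oo[ (f k) ((z + k%:R)^-1 - (w + k%:R)^-1).
  by apply: has_integralB; apply: has_integral_powRN; rewrite ltr_wpDr.
have f0 k x : 1 < x -> 0 <= f k x.
  by move=> x1; rewrite subr_ge0; apply: ler_powR; lra.
have sumf n x : 1 < x -> \sum_(0 <= k < n) f k x =
    (x `^ (- z) - x `^ (- w)) / (x - 1) * (1 - x^-1 ^+ n).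
  move=> x1; have x0 : 0 < x by lra.
  have E y k : x `^ (- (y + k%:R) - 1) = x `^ (- y) * x^-1 ^+ k.+1.
    have -> : - (y + k%:R) - 1 = - y - k.+1%:R by rewrite -natr1; ring.
    rewrite powRD; last by rewrite (gt_eqF x0) implybT.
    by rewrite (powR_invn _ (ltW x0)) exprVn.
  elim: n => [|n IH]; first by rewrite big_geq// expr0 subrr mulr0.
  rewrite big_nat_recr//= IH /f !E -mulrBl exprS.
  by field; rewrite !gt_eqF//; lra.
apply: ge0_has_integral => //.
- have mp p : measurable_fun (`]1, +oo[%classic : set R) (fun x : R => x `^ p).
    by apply: measurable_funTS; exact: measurable_powR.
  apply: measurable_funM; first by apply: measurable_funB; exact: mp.
  by apply: measurable_funV; apply: measurable_funB.
- move=> x /=; rewrite in_itv/= andbT => x1.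
  by rewrite divr_ge0 ?subr_ge0//; [apply: ler_powR; lra|lra].
- have lim1 x : 1 < x -> (\sum_(0 <= k <oo) (f k x)%:E =
      ((x `^ (- z) - x `^ (- w)) / (x - 1))%:E)%E.
    move=> x1; apply: cvg_lim => //; under eq_fun do rewrite sumEFin sumf//.
    apply: cvg_EFin; first exact: nearW.
    rewrite -[X in _ --> X]mulr1; apply: cvgM; first exact: cvg_cst.
    rewrite -[X in _ --> X]subr0; apply: cvgB; first exact: cvg_cst.
    by apply: cvg_expr; rewrite normfV ger0_norm ?invf_lt1; lra.
  transitivity (\int[mu]_(x in `]1%R, +oo[) (\sum_(0 <= k <oo) (f k x)%:E))%E.
    by apply: eq_integral => x; rewrite inE/= in_itv/= andbT => x1; rewrite lim1.
  rewrite integral_nneseries//; last 2 first.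
    by move=> k; have [_ /measurable_int] := fk k.
    by move=> k x /=; rewrite in_itv/= andbT => x1; rewrite lee_fin f0.
  apply: cvg_lim => //.
  have dS (y : R) k : 0 < y -> digamma (y + k.+1%:R) = digamma (y + k%:R) + (y + k%:R)^-1.
    move=> y0; have yk : 0 < y + k%:R by rewrite ltr_wpDr.
    by have := digammaD1 (y + k%:R) yk; rewrite -addrA natr1.
  have E (D : R -> R) : (forall (y : R) k, 0 < y -> D (y + k.+1%:R) = D (y + k%:R) + (y + k%:R)^-1) ->
      forall n, (\sum_(0 <= k < n) \int[mu]_(x in `]1%R, +oo[) (f k x)%:E =
      ((D w - D z) + (D (z + n%:R) - D (w + n%:R)))%:E)%E.
    move=> DS; elim=> [|n IH]; first by rewrite big_geq// !addr0 addrC subrKA subrr.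
    rewrite big_nat_recr//= IH; have [_ _ ->] := fk n.
    by rewrite !DS// -EFinD; congr EFin; ring.
  under eq_fun do rewrite (E digamma dS).
  apply: cvg_EFin; first exact: nearW.
  rewrite -[X in _ --> X]addr0; apply: cvgD; first exact: cvg_cst.
  exact: cvg_digammaB.
Qed.

(** The integrand is minus the derivative of ln((1 - x^(-b)) / (1 - 1/x)), which tends to ln b at 1
    and to 0 at infinity. Subtracting the two fractions cancels their poles at 1. *)
Lemma has_integral_log_ratio b : 0 < b < 1 ->
  has_integral mu `]1, +oo[
    (fun x => (x * (x - 1))^-1 - b * x `^ (- b) / (x * (1 - x `^ (- b)))) (ln b).
Proof.
move=> b01; have /andP[b0 b1] := b01.
pose g x := b * x `^ (- b) / (x * (1 - x `^ (- b))) - (x * (x - 1))^-1.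
have q1 x : 1 < x -> 0 < 1 - x `^ (- b).
  move=> x1; rewrite subr_gt0 powRN invf_lt1 ?powR_gt0//; last lra.
  exact: powR_gt1.
have gE x : 1 < x -> g x = (b * (x - 1) - (x `^ b - 1)) / (x * (x - 1) * (x `^ b - 1)).
  move=> x1; rewrite /g powRN; have := powR_gt1 b x b0 x1 => y1.
  by field; rewrite !gt_eqF//; lra.
have g0 x : 1 < x -> 0 <= g x.
  move=> x1; rewrite gE// divr_ge0//.
    by have := powR_sub1_le b x b01; rewrite subr_ge0; apply; lra.
  have := powR_gt1 b x b0 x1 => y1.
  by rewrite !mulr_ge0//; lra.
suff h : has_integral mu `]1, +oo[ g (- ln b).
  by apply: has_integral_eq (has_integralN h) _ _ => [x _|]; rewrite ?opprB ?opprK.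
have dg x : 1 < x -> exists l, has_derivative g x l.
  move=> x1; eexists; rewrite /g; derive => //=; rewrite ?gt_eqF//; try lra.
    by rewrite mulr_gt0 ?q1//; lra.
  by rewrite mulr_gt0 ?subr_gt0//; lra.
have cg x : 1 < x -> {for x, continuous g}.
  by move=> /dg[l]; exact: has_derivative_continuous.
apply: ge0_has_integral => //.
- apply: open_continuous_measurable_fun => // x; rewrite inE/= in_itv/= andbT.
  exact: cg.
- by move=> x /=; rewrite in_itv/= andbT; exact: g0.
transitivity ((0 - ln b)%:E + \int[mu]_(t in `]1%R, +oo[) (0 : R)%:E)%E; last first.
  by rewrite integral0_eq// adde0 sub0r.
apply: (@ge0_FTC_ray _ _ (fun=> 0) (fun x => ln ((1 - x `^ (- b)) / (1 - x^-1)))) => //.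
- move=> x x1; rewrite subr0; have x0 : 0 < x by lra.
  have x2 : 0 < 1 - x^-1 by rewrite subr_gt0 invf_lt1.
  apply: has_derivative_eq.
    derive => //=; rewrite ?gt_eqF// divr_gt0//; exact: q1.
  rewrite /= /g; have := q1 x x1.
  have <- : x * x `^ (- b - 1) = x `^ (- b) by exact: mulr_powRB1_gt0.
  move: (x `^ (- b - 1)) => y y0.
  by field; rewrite !gt_eqF//; lra.
- by move=> x _; exact: cst_continuous.
- rewrite -(ln1 R); apply: cvg_ln => //.
  rewrite [X in _ --> X](_ : 1 = (1 - 0) / (1 - 0) :> R); last by rewrite subr0 divr1.
  apply: cvgM.
    by apply: cvgB; [exact: cvg_cst|exact: cvg_powRN].
  apply: cvgV; first by rewrite subr0 oner_neq0.
  apply: cvgB; first exact: cvg_cst.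
  by have := @cvg_invDry R 0; under eq_fun do rewrite add0r.
- apply: cvg_ln => //.
  apply: (@squeeze_cvgr _ _ _ _ (fun=> b) (fun x => b * x)).
  + near=> x; have x1 : 1 < x by near: x; exact: nbhs_right_gt.
    have x0 : 0 < x by lra.
    have x2 : 0 < 1 - x^-1 by rewrite subr_gt0 invf_lt1.
    have xb := powR_gt0 b x0.
    rewrite ler_pdivlMr// ler_pdivrMr// powRN; apply/andP; split.
      have := powR_sub1_ge b x b01 x1; rewrite -(@ler_pM2r _ (x `^ b)^-1) ?invr_gt0//.
      rewrite mulfK ?gt_eqF// mulrBl mulfV ?gt_eqF// mul1r.
      by apply: le_trans; rewrite le_eqVlt; apply/orP; left; apply/eqP; field; rewrite gt_eqF.
    have := powR_sub1_le b x b01 x0 => h.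
    have -> : b * x * (1 - x^-1) = b * (x - 1) by field; rewrite gt_eqF.
    apply: le_trans h; rewrite -subr_ge0.
    have -> : x `^ b - 1 - (1 - (x `^ b)^-1) = (x `^ b - 1) ^+ 2 / x `^ b.
      by field; rewrite gt_eqF.
    by rewrite divr_ge0 ?sqr_ge0// ltW.
  + exact: cvg_cst.
  + rewrite -[X in _ --> X]mulr1; apply: cvgM; first exact: cvg_cst.
    exact: cvg_at_right_filter (cvg_id).
Unshelve. all: by end_near. Qed.

End edge_integral.

(** * Termwise integration and the Barnes constant *)

Section edge_series.
Context {R : realType}.
Local Notation mu := (@lebesgue_measure R).
Local Notation harm n := (\sum_(1 <= i < n.+1) (i%:R^-1 : R)).
Implicit Types b x : R.

(** General term of a geometric expansion of (1 - 2b) [edge_density b]; the factor 1 - 2b clears the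
    denominator of [powR_primitive]. Only one of the two factors 1/(x^b - 1) is expanded: the other
    one cancels in the first fraction and remains in the second. *)
Definition edge_term b (j : nat) x : R :=
  (x `^ (- (j%:R * b + 1)) + x `^ (- (j.+1%:R * b))) / (x - 1)
  - 2 * b * x `^ (- (j.+1%:R * b)) / (x * (1 - x `^ (- b))).

Lemma powRN_natM x b j : 0 < x -> x `^ (- (j%:R * b)) = (x `^ b)^-1 ^+ j.
Proof.
move=> x0; rewrite -powRN -powR_mulrn ?powR_ge0// -powRrM; congr (_ `^ _); ring.
Qed.

Lemma edge_term_geometric b j x : 1 < x -> edge_term b j x =
  (x `^ b)^-1 ^+ j * ((x^-1 + (x `^ b)^-1) / (x - 1)
    - 2 * b * (x `^ b)^-1 / (x * (1 - (x `^ b)^-1))).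
Proof.
move=> x1; have x0 : 0 < x by lra.
rewrite /edge_term opprD powRD; last by rewrite (gt_eqF x0) implybT.
rewrite !powRN_natM// powR_inv1 ?(ltW x0)// powRN exprS.
by ring.
Qed.

Lemma sum_edge_term b n x : 0 < b < 1 -> b != 2^-1 -> 1 < x ->
  \sum_(0 <= j < n) edge_term b j x =
  (1 - 2 * b) * (edge_density b x * (1 - (x `^ b)^-1 ^+ n)).
Proof.
move=> /andP[b0 b1] b2 x1; have x0 : 0 < x by lra.
have y1 := powR_gt1 b x b0 x1.
have b20 : 2 * b - 1 != 0 by apply: contra b2 => /eqP h; apply/eqP; lra.
under eq_bigr do rewrite edge_term_geometric//.
rewrite -mulr_suml; have -> : \sum_(0 <= j < n) (x `^ b)^-1 ^+ j =
    (1 - (x `^ b)^-1 ^+ n) / (1 - (x `^ b)^-1).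
  elim: n => [|n IH]; first by rewrite big_geq// expr0 subrr mul0r.
  rewrite big_nat_recr//= IH exprS.
  by field; rewrite !gt_eqF//; lra.
rewrite /edge_density /edge_numerator /powR_primitive (negbTE b2).
have -> : x `^ (b - 1) = x `^ b / x.
  by rewrite powRD ?(gt_eqF x0) ?implybT// powR_inv1// ltW.
have -> : x `^ (2 * b - 1) = (x `^ b) ^+ 2 / x.
  rewrite powRD ?(gt_eqF x0) ?implybT// powR_inv1 ?(ltW x0)//; congr (_ / _).
  by rewrite -powR_mulrn ?powR_ge0// -powRrM mulrC.
move: ((x `^ b)^-1 ^+ n) (x `^ b) y1 => qn y y1.
by field; rewrite b20 !gt_eqF//; lra.
Qed.

(** The poles at x = 1 are removed by comparison with 1/(x (x - 1)). The first fraction gives two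
    digamma differences. With q = x^(-b), the second is treated by q^(j+1)/(1-q) = q/(1-q) - (q +
    ... + q^j): the quotient yields ln b, the finite sum yields the harmonic number. *)
Lemma has_integral_edge_term b j : 0 < b < 1 ->
  has_integral mu `]1, +oo[ (edge_term b j)
    (2 * digamma 1 - digamma (j%:R * b + 1) - digamma (j.+1%:R * b)
     + 2 * ln b + 2 * harm j).
Proof.
move=> b01; have /andP[b0 b1] := b01.
have jb : 0 < j%:R * b + 1 by rewrite ltr_wpDl ?mulr_ge0// ltW.
have j1b : 0 < j.+1%:R * b by rewrite mulr_gt0.
have hA := has_integral_digammaB _ _ jb (@ltr01 R).
have hB := has_integral_digammaB _ _ j1b (@ltr01 R).
have hE := has_integralZ 2 (has_integral_log_ratio b b01).
have hS := has_integralZ (2 * b) (@has_integral_sum _ _ _ mu `]1, +oo[%classic j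
  (fun i x => x `^ (- (i.+1%:R * b) - 1)) (fun i => (i.+1%:R * b)^-1)
  (fun i => has_integral_powRN _ (mulr_gt0 (ltr0Sn R i) b0))).
apply: has_integral_eq (has_integralD (has_integralD (has_integralD hA hB) hE) hS) _ _.
  move=> x /=; rewrite in_itv/= andbT => x1; have x0 : 0 < x by lra.
  have y1 := powR_gt1 b x b0 x1.
  have -> : \sum_(0 <= i < j) x `^ (- (i.+1%:R * b) - 1) =
      (x * x `^ b)^-1 * (1 - (x `^ b)^-1 ^+ j) / (1 - (x `^ b)^-1).
    elim: j {jb j1b hA hB hS} => [|n IH]; first by rewrite big_geq// expr0 subrr mulr0 mul0r.
    rewrite big_nat_recr//= IH powRD ?(gt_eqF x0) ?implybT// powRN_natM//.
    rewrite powR_inv1 ?(ltW x0)// exprS.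
    move: ((x `^ b)^-1 ^+ n) (x `^ b) y1 => qn y y1.
    by field; rewrite !gt_eqF//; lra.
  rewrite edge_term_geometric// opprD powRD ?(gt_eqF x0) ?implybT//.
  rewrite !powRN_natM// powR_inv1 ?(ltW x0)// powRN exprS.
  move: ((x `^ b)^-1 ^+ j) (x `^ b) y1 => qn y y1.
  by field; rewrite !gt_eqF//; lra.
have -> : 2 * b * (\sum_(0 <= i < j) (i.+1%:R * b)^-1) = 2 * harm j.
  rewrite big_add1/= -mulrA mulr_sumr; congr (_ * _); apply: eq_bigr => i _.
  by field; rewrite !gt_eqF.
move: (digamma 1) (digamma (j%:R * b + 1)) (digamma (j.+1%:R * b)) => *; ring.
Qed.

Lemma cvg_edge_integral b : 0 < b < 1 -> exists2 K : R^nat,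
  forall n, has_integral mu `]1, +oo[
    (fun x => edge_density b x * (1 - (x `^ b)^-1 ^+ n)) (K n)
  & K n @[n --> \oo] --> edge_integral b.
Proof.
move=> b01; have /andP[b0 b1] := b01.
pose f n (x : R) := edge_density b x * (1 - (x `^ b)^-1 ^+ n).
have q01 x : 1 < x -> 0 <= (x `^ b)^-1 < 1.
  move=> x1; have y1 := powR_gt1 b x b0 x1.
  by rewrite invr_ge0 powR_ge0 invf_lt1 ?y1//; lra.
have f0 n x : 1 < x -> 0 <= f n x.
  move=> x1; rewrite mulr_ge0 ?edge_density_ge0// subr_ge0.
  by have /andP[q0 q1] := q01 _ x1; rewrite exprn_ile1// ltW.
have mf n : measurable_fun (`]1, +oo[%classic : set R) (f n).
  apply: measurable_funM; first exact: measurable_edge_density.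
  apply: measurable_funB => //; apply: measurable_funX; apply: measurable_funV.
  by apply: measurable_funTS; exact: measurable_powR.
have fle n x : 1 < x -> f n x <= edge_density b x.
  move=> x1; rewrite ler_piMr ?edge_density_ge0// lerBlDr lerDl exprn_ge0//.
  by have /andP[] := q01 _ x1.
have intf n : mu.-integrable `]1, +oo[ (EFin \o f n).
  apply: le_integrable (integrable_edge_density b b01) => //.
    by apply/measurable_EFinP; exact: mf.
  move=> x /=; rewrite in_itv/= andbT => x1.
  by rewrite lee_fin !ger0_norm ?edge_density_ge0 ?f0 ?fle.
exists (fun n => \int[mu]_(x in `]1, +oo[) f n x).
  move=> n; split => //; first exact: intf.
  by rewrite /Rintegral fineK//; apply: integrable_fin_num => //; exact: intf.
have [_ ik vk] := has_integral_edge_density b b01.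
have lf x : 1 < x -> (f n x)%:E @[n --> \oo] --> (edge_density b x)%:E.
  move=> x1; apply: cvg_EFin; first exact: nearW.
  rewrite -[X in _ --> X]mulr1; apply: cvgM; first exact: cvg_cst.
  rewrite -[X in _ --> X]subr0; apply: cvgB; first exact: cvg_cst.
  by have /andP[q0 q1] := q01 _ x1; apply: cvg_expr; rewrite ger0_norm.
have mf' n : measurable_fun (`]1, +oo[%classic : set R) (fun x => (f n x)%:E).
  by apply/measurable_EFinP; exact: mf.
have mk : measurable_fun (`]1, +oo[%classic : set R) (EFin \o edge_density b).
  by apply/measurable_EFinP; exact: measurable_edge_density.
have lf' : {ae mu, forall x, (`]1, +oo[%classic : set R) x ->
    (f n x)%:E @[n --> \oo] --> (EFin \o edge_density b) x}.
  by apply: aeW => x /=; rewrite in_itv/= andbT => x1; exact: lf.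
have fle' : {ae mu, forall x n, (`]1, +oo[%classic : set R) x ->
    (`|(f n x)%:E| <= (EFin \o edge_density b) x)%E}.
  apply: aeW => x n /=; rewrite in_itv/= andbT => x1.
  by rewrite lee_fin ger0_norm ?f0 ?fle.
have [_ _] := @dominated_convergence _ _ _ mu _ (measurable_itv _) _ _ _ mf' mk lf' ik fle'.
by rewrite vk => /fine_cvg.
Qed.

(** For j > 0 the recurrence replaces psi(j b + 1) by psi(j b) + 1/(j b), so that both digamma
    families add up to the same sum, apart from psi(1) and the boundary term psi(n b); the harmonic
    numbers of index below n add up to n H_n - n. *)
Lemma sum_edge_term_value b n : 0 < b -> (0 < n)%N ->
  \sum_(0 <= j < n) (2 * digamma 1 - digamma (j%:R * b + 1) - digamma (j.+1%:R * b)
     + 2 * ln b + 2 * harm j) =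
  2 * n%:R * digamma 1 + 2 * n%:R * ln b + 2 * (n%:R * harm n - n%:R) - digamma 1
  - 2 * \sum_(1 <= m < n.+1) digamma (m%:R * b) + digamma (n%:R * b)
  - (harm n - n%:R^-1) / b.
Proof.
move=> b0; case: n => // n _.
have dS k : digamma (k.+1%:R * b + 1) = digamma (k.+1%:R * b) + (k.+1%:R * b)^-1.
  by apply: digammaD1; rewrite mulr_gt0.
elim: n => [|n IH].
  rewrite big_nat1 !big_nat1 big_geq// mul0r add0r mul1r invr1 subrr mul0r.
  by move: (digamma 1) (digamma b) => *; ring.
rewrite big_nat_recr//= IH dS [in RHS]big_nat_recr//=.
rewrite [X in _ = _ - 2 * X + _ - _]big_nat_recr//=.
move: (\sum_(1 <= m < n.+2) digamma _) (harm n.+1) => D H.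
move: (digamma 1) (digamma (n.+1%:R * b)) (digamma (n.+2%:R * b)) => d1 dn dn1.
rewrite -[n.+2%:R]natr1; have : 0 < n.+1%:R :> R by rewrite ltr0n.
move: (n.+1%:R : R) => m m0.
by field; rewrite !gt_eqF//; lra.
Qed.

(** The partial sums satisfy M = E - 2 C with [C] the Barnes sequence. [M] converges by dominated
    convergence and [E] by the digamma asymptotics, so [C] converges and its limit is read off. *)
Lemma edge_integral_formula b : 0 < b < 1 -> b != 2^-1 ->
  (1 - 2 * b) * edge_integral b =
  1 - 2 * barnes_modular b + (ln b - (1 - b) * euler_gamma R) / b.
Proof.
move=> b01 b2; have /andP[b0 b1] := b01.
have [K hK Kl] := cvg_edge_integral b b01.
pose M n : R := \sum_(0 <= j < n) (2 * digamma 1 - digamma (j%:R * b + 1)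
  - digamma (j.+1%:R * b) + 2 * ln b + 2 * harm j).
have KM n : (1 - 2 * b) * K n = M n.
  have [_ _ h1] := has_integralZ (1 - 2 * b) (hK n).
  have [_ _ h2] := @has_integral_sum _ _ _ mu `]1, +oo[%classic n _ _
    (fun j => has_integral_edge_term b j b01).
  apply: EFin_inj; rewrite -h1 -h2; apply: eq_integral => x.
  by rewrite inE/= in_itv/= andbT => x1; rewrite sum_edge_term.
pose C (n : nat) : R := \sum_(1 <= m < n.+1) digamma (m%:R * b)
  - (n%:R + 2^-1 - (2 * b)^-1) * ln (n%:R * b) + n%:R.
(* What remains once twice the Barnes sequence is split off. The first summand tends to 1; the terms
   in ln n have been distributed so that every group converges. *)
pose E (n : nat) : R := 2 * (n%:R * (harm n + digamma 1 - ln n%:R)) - digamma 1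
  + (digamma (n%:R * b) - ln (n%:R * b)) - (harm n - ln n%:R) / b + ln b / b
  + b^-1 * n%:R^-1.
have MCE n : (0 < n)%N -> M n = E n - 2 * C n.
  move=> n0; have n1 : 0 < n%:R :> R by rewrite ltr0n.
  rewrite /M sum_edge_term_value// /E /C lnM ?posrE//.
  move: (\sum_(1 <= m < n.+1) digamma _) (harm n) (digamma 1) (digamma (n%:R * b)) => D H d1 dn.
  by field; rewrite !gt_eqF.
have El : E n @[n --> \oo] --> 2 * 2^-1 - digamma (1 : R) + 0 - (- digamma (1 : R)) / b
    + ln b / b + b^-1 * 0.
  apply: cvgD; last by apply: cvgM; [exact: cvg_cst|exact: cvg_invn].
  apply: cvgD; last exact: cvg_cst.
  apply: cvgB; last by apply: cvgM; [exact: cvg_sum_inv_ln|exact: cvg_cst].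
  apply: cvgD; last exact: cvg_digamma_ln.
  apply: cvgB; last exact: cvg_cst.
  by apply: cvgM; [exact: cvg_cst|exact: cvg_sum_inv_scaled].
have Ml : M n @[n --> \oo] --> (1 - 2 * b) * edge_integral b.
  rewrite (_ : M = fun n => (1 - 2 * b) * K n); last by apply/funext => n; rewrite KM.
  by apply: cvgM => //; exact: cvg_cst.
have Cl : C n @[n --> \oo] --> 2^-1 * ((2 * 2^-1 - digamma (1 : R) + 0
    - (- digamma (1 : R)) / b + ln b / b + b^-1 * 0) - (1 - 2 * b) * edge_integral b).
  have h : 2^-1 * (E n - M n) @[n --> \oo] --> 2^-1 * ((2 * 2^-1 - digamma (1 : R) + 0
    - (- digamma (1 : R)) / b + ln b / b + b^-1 * 0) - (1 - 2 * b) * edge_integral b).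
    by apply: cvgM; [exact: cvg_cst|exact: cvgB].
  apply: cvg_trans h; apply: near_eq_cvg; near=> n.
  rewrite MCE; last by near: n; exact: nbhs_infty_gt.
  by rewrite opprB addrC subrK mulrA mulVf// mul1r.
rewrite /barnes_modular (cvg_lim _ Cl)// digamma1.
by field; rewrite gt_eqF.
Unshelve. all: by end_near. Qed.

End edge_series.

(** * Continuity in the exponent and the value at one half *)

Section edge_integral_continuity.
Context {R : realType}.
Local Notation mu := (@lebesgue_measure R).
Implicit Types a b c x : R.

Lemma continuous_powR_exponent x b : 0 < x -> {for b, continuous (powR x)}.
Proof.
by move=> x0; exact: has_derivative_continuous (has_derivative_powR_exponent x b x0).
Qed.

Lemma continuous_comp_real (f g : R -> R) b :
  {for b, continuous f} -> {for f b, continuous g} ->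
  {for b, continuous (fun c => g (f c))}.
Proof. exact: continuous_comp. Qed.

Lemma continuous_powR_primitive x b : 0 < x ->
  {for b, continuous (fun c => powR_primitive c x)}.
Proof.
move=> x0.
have cl : {for b, continuous (fun c : R => 2 * c - 1)}.
  by apply: has_derivative_continuous; derive.
have [bE|b2] := eqVneq b 2^-1; last first.
  have bd : 2 * b - 1 != 0 by apply: contra b2 => /eqP h; apply/eqP; lra.
  have c : {for b, continuous (fun c : R => (x `^ (2 * c - 1) - 1) / (2 * c - 1))}.
    apply: continuousM; last exact: continuousV.
    apply: continuousB; last exact: cst_continuous.
    by apply: (continuous_comp_real _ (powR x) _ cl); exact: continuous_powR_exponent.
  rewrite /prop_for /continuous_at {2}/powR_primitive (negbTE b2).
  have nb : \forall c \near b, c != 2^-1.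
    by apply: open_nbhs_nbhs; split => //; exact: open_neq.
  apply: cvg_trans c; apply: near_eq_cvg; near=> c.
  by rewrite /powR_primitive ifF//; apply/negbTE; near: c.
(* At b = 1/2 the primitive is a difference quotient of z -> x^z at 0. Caratheodory's form of the
   derivative gives a continuous slope [g] with g(0) = ln x, and [powR_primitive c x] is g(2c - 1)
   in both cases of its definition. *)
have [g [gE cg g0]] := (is_derive1_caratheodory (powR x) 0 _).1
  (has_derivative_powR_exponent x 0 x0).
rewrite (_ : (fun c => _) = fun c => g (2 * c - 1)).
  by apply: (continuous_comp_real _ g _ cl); rewrite bE mulfV// subrr.
apply/funext => c; rewrite /powR_primitive; case: ifPn => [/eqP ->|c2].
  by rewrite mulfV// subrr g0 powRr0 mulr1.
have cd : 2 * c - 1 != 0 by apply: contra c2 => /eqP h; apply/eqP; lra.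
by rewrite -[X in _ - X](powRr0 x) gE subr0 mulfK.
Unshelve. all: by end_near. Qed.

Lemma continuous_edge_density x b : 0 < b -> 1 < x ->
  {for b, continuous (fun c => edge_density c x)}.
Proof.
move=> b0 x1; have x0 : 0 < x by lra.
have cx : {for b, continuous (powR x)} by exact: continuous_powR_exponent.
apply: continuousM.
  apply: continuousB; last exact: continuous_powR_primitive.
  apply: continuousB => //.
  apply: (continuous_comp_real (fun c => c - 1) (powR x)).
    by apply: has_derivative_continuous; derive.
  exact: continuous_powR_exponent.
apply: continuousV.
  by rewrite mulf_neq0 ?expf_neq0// gt_eqF// subr_gt0//; apply: powR_gt1.
apply: continuousM; first exact: cst_continuous.
apply: (continuous_comp_real (powR x) (fun y => (y - 1) ^+ 2)) => //.
by apply: has_derivative_continuous; derive.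
Qed.

Lemma continuous_edge_integral b : 0 < b < 1 ->
  {for b, continuous (@edge_integral R)}.
Proof.
move=> /andP[b0 b1]; pose u := b / 2; pose v := (1 + b) / 2.
have uvW c : c \in `]u, v[ -> u <= c < 1.
  by rewrite in_itv/= /u /v => /andP[uc cv]; apply/andP; split; lra.
have u0 : 0 < u by rewrite /u; lra.
have [_ ig _] := has_integralZ (edge_majorant_const u) (has_integral_powRN u u0).
apply: (@continuity_under_integral _ _ _ mu (fun b x => edge_density b x) `]1, +oo[%classic
  (measurable_itv _) u v _ _ (fun x => edge_majorant_const u * x `^ (- u - 1)) ig).
- move=> c /= /uvW /andP[uc c1]; apply: integrable_edge_density.
  by apply/andP; split; lra.
- apply: aeW => x /=; rewrite in_itv/= andbT => x1 c; rewrite inE/= => /uvW /andP[uc c1].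
  by apply: continuous_edge_density => //; lra.
- move=> c /= /uvW uc; apply: aeW => x /=; rewrite in_itv/= andbT => x1.
  have c01 : 0 < c < 1 by move: uc => /andP[? ?]; apply/andP; split; lra.
  by rewrite ger0_norm ?edge_density_ge0// edge_density_le.
- by rewrite inE/= in_itv/= /u /v; apply/andP; split; lra.
Qed.

Lemma mean_formula_edge_integral (alpha : R) : 0 < alpha < 1 -> alpha != 2^-1 ->
  mean_formula alpha = 2 + 2 * (1 - alpha) * edge_integral (1 - alpha).
Proof.
move=> /andP[a0 a1] a2; rewrite /mean_formula.
have ad : 2 * alpha - 1 != 0 by apply: contra a2 => /eqP h; apply/eqP; lra.
have b01 : 0 < 1 - alpha < 1 by apply/andP; split; lra.
have b2 : 1 - alpha != 2^-1 by apply: contra a2 => /eqP h; apply/eqP; lra.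
have := edge_integral_formula (1 - alpha) b01 b2.
rewrite subKr => <-.
have -> : 1 - 2 * (1 - alpha) = 2 * alpha - 1 by ring.
by rewrite mulrA divfK//; ring.
Qed.

Lemma cvg_mean_formula_half :
  mean_formula a @[a --> (2^-1 : R)^'] --> 2 + edge_integral (2^-1 : R).
Proof.
have h2 : 0 < (2^-1 : R) < 1 by apply/andP; split; lra.
have c : {for (2^-1 : R), continuous (fun a => 2 + 2 * (1 - a) * edge_integral (1 - a))}.
  apply: continuousD; first exact: cst_continuous.
  have c1 : {for (2^-1 : R), continuous (fun a : R => 1 - a)}.
    by apply: has_derivative_continuous; derive.
  apply: continuousM.
    by apply: continuousM => //; exact: cst_continuous.
  apply: (continuous_comp_real _ (@edge_integral R) _ c1).
  by apply: continuous_edge_integral; apply/andP; split; lra.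
have e : 1 - 2^-1 = 2^-1 :> R by lra.
have : 2 + 2 * (1 - a) * edge_integral (1 - a) @[a --> (2^-1 : R)^'] -->
    2 + edge_integral (2^-1 : R).
  rewrite [X in _ --> X](_ : _ = 2 + 2 * (1 - 2^-1) * edge_integral (1 - 2^-1 : R)).
    apply: cvg_trans c; apply: cvg_app; exact: nbhs_dnbhs.
  by rewrite e mulfV// mul1r.
apply: cvg_trans; apply: near_eq_cvg; near=> a.
rewrite mean_formula_edge_integral//; last by near: a; exact: nbhs_dnbhs_neq.
have : `|a - 2^-1| < 2^-1.
  near: a; apply: nbhs_dnbhs; have := @nbhsx_ballx _ R (2^-1 : R) 2^-1.
  move=> /(_ _)/filterS; apply => //; last first.
    by move=> z; rewrite /ball/= distrC.
rewrite ltr_norml => /andP[]; lra.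
Unshelve. all: by end_near. Qed.

End edge_integral_continuity.

(** * Geometry of the least concave majorant *)

Section least_concave_majorant_geometry.
Context {R : realType}.
Implicit Types (g : R -> R) (a b c s t r : R) (p q : R * R) (I J : set R).

Definition three_point_concave g : Prop := forall s r t, 0 <= s -> s <= r ->
  r <= t -> t <= 1 -> (t - r) * g s + (r - s) * g t <= (t - s) * g r.

Lemma concave_functionP g : concave_function `[0, 1] g <->
  forall l s t, 0 <= l <= 1 -> 0 <= s <= 1 -> 0 <= t <= 1 ->
    l * g s + (1 - l) * g t <= g (l * s + (1 - l) * t).
Proof.
split=> [h l s t l01 s01 t01|h l s t].
  have := h (Itv01 (andP l01).1 (andP l01).2) s t.
  rewrite !inE/= !in_itv/= => /(_ s01 t01); rewrite !convRE/= /unstable.onem.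
  by rewrite !mulrN -opprD lerN2.
rewrite !inE/= !in_itv/= => s01 t01; rewrite !convRE/= /unstable.onem.
rewrite !mulrN -opprD lerN2; apply: h => //.
by apply/andP; split.
Qed.

Lemma seq_argmax (T : eqType) (f : T -> R) (s : seq T) : s != [::] ->
  exists2 z, z \in s & forall y, y \in s -> f y <= f z.
Proof.
elim: s => // z s IH _; have [->|/IH[w ws wmax]] := eqVneq s [::].
  by exists z; rewrite ?mem_head// => y; rewrite inE => /eqP ->.
have [zw|wz] := lerP (f z) (f w).
  exists w; first by rewrite inE ws orbT.
  by move=> y; rewrite inE => /predU1P[->//|/wmax].
exists z; first exact: mem_head.
by move=> y; rewrite inE => /predU1P[->//|/wmax/le_trans]; apply; exact: ltW.
Qed.

(** The deterministic properties, almost sure for the process, on which the geometry rests: all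
    atoms lie under some tent min(m t, m (1 - t)), and only finitely many points lie above any given
    tent, however flat. *)
Definition regular_atoms (x : nat -> R * R) : Prop := [/\
  forall k, 0 < (x k).2,
  exists m, forall k, (x k).2 <= m * (x k).1 /\ (x k).2 <= m * (1 - (x k).1)
  & forall c, 0 < c -> finite_set (range x `&`
      [set p | c * p.1 < p.2 \/ c * (1 - p.1) < p.2])].

Variable x : nat -> R * R.
Hypothesis xreg : regular_atoms x.
Local Notation C := (least_concave_majorant x).

Let v_gt0 k : 0 < (x k).2. Proof. by case: xreg. Qed.

Lemma atom_abscissa k : 0 < (x k).1 < 1.
Proof.
have [_ [m /(_ k)[h1 h2]] _] := xreg; have v0 := v_gt0 k.
have m0 : 0 < m by lra.
by apply/andP; split; nra.
Qed.

Let min_majorant : exists2 m, 0 < m &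
  concave_majorant x (fun t => Num.min (m * t) (m * (1 - t))).
Proof.
have [_ [m hm] _] := xreg; have v0 := v_gt0 0.
have m0 : 0 < m by have [h1 h2] := hm 0%N; lra.
exists m => //; split.
- apply/concave_functionP => l s t /andP[l0 l1] _ _; rewrite le_min; apply/andP; split.
    apply: (@le_trans _ _ (l * (m * s) + (1 - l) * (m * t))); last by lra.
    by apply: lerD; apply: ler_wpM2l; rewrite ?subr_ge0// ge_min lexx.
  apply: (@le_trans _ _ (l * (m * (1 - s)) + (1 - l) * (m * (1 - t)))); last by lra.
  by apply: lerD; apply: ler_wpM2l; rewrite ?subr_ge0// ge_min lexx orbT.
- move=> t; rewrite in_itv/= => /andP[t0 t1].
  by rewrite le_min !mulr_ge0 ?subr_ge0// ltW.
- by move=> k; rewrite le_min; have [-> ->] := hm k.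
Qed.

Let lbC t : 0 <= t <= 1 -> lbound [set f t | f in concave_majorant x] 0.
Proof. by move=> t01 _ [f [_ f0 _] <-]; apply: f0; rewrite in_itv. Qed.

Let neC t : [set f t | f in concave_majorant x] !=set0.
Proof. by have [m _ h] := min_majorant; eexists; eexists; [exact: h|]. Qed.

Lemma lcm_le f t : 0 <= t <= 1 -> concave_majorant x f -> C t <= f t.
Proof.
by move=> t01 hf; apply: ge_inf; [exists 0; exact: lbC|exists f].
Qed.

Lemma lcm_ge0 t : 0 <= t <= 1 -> 0 <= C t.
Proof. by move=> t01; apply: lb_le_inf => //; exact: lbC. Qed.

Lemma lcm_atom k : (x k).2 <= C (x k).1.
Proof. by apply: lb_le_inf => // _ [f [_ _ fk] <-]. Qed.

Lemma lcm_affine_le a b : 0 <= b -> 0 <= a + b ->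
  (forall k, (x k).2 <= a * (x k).1 + b) ->
  forall t, 0 <= t <= 1 -> C t <= a * t + b.
Proof.
move=> b0 ab0 h t t01; apply: (lcm_le (fun t => a * t + b)) => //; split => //.
- by apply/concave_functionP => l s r _ _ _; lra.
- move=> r; rewrite in_itv/= => /andP[r0 r1].
  have -> : a * r + b = r * (a + b) + (1 - r) * b by ring.
  by rewrite addr_ge0// mulr_ge0// subr_ge0.
Qed.

Lemma lcm_concave : three_point_concave C.
Proof.
move=> s r t s0 sr rt t1.
have [st|ts] := ltrP s t; last first.
  have -> : r = s by lra. have -> : t = s by lra. lra.
have d0 : 0 < t - s by rewrite subr_gt0.
pose l := (t - r) / (t - s).
have l01 : 0 <= l <= 1.
  by rewrite /l divr_ge0 ?subr_ge0 ?(ltW st)//= ler_pdivrMr// mul1r lerD2l lerN2.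
have rE : l * s + (1 - l) * t = r by rewrite /l; field; rewrite gt_eqF.
have h : l * C s + (1 - l) * C t <= C r.
  apply: lb_le_inf => // _ [f fm <-]; have [/concave_functionP fc _ _] := fm.
  rewrite -rE; apply: (le_trans _ (fc l s t l01 _ _)); try by apply/andP; split; lra.
  have /andP[l0 l1] := l01.
  by apply: lerD; apply: ler_wpM2l; rewrite ?subr_ge0//; apply: lcm_le => //;
    apply/andP; split; lra.
have -> : (t - r) * C s + (r - s) * C t = (t - s) * (l * C s + (1 - l) * C t).
  by rewrite /l; field; rewrite gt_eqF.
by rewrite ler_pM2l.
Qed.

Lemma lcm_linear_bound : exists2 m, 0 < m &
  forall t, 0 <= t <= 1 -> C t <= m * t /\ C t <= m * (1 - t).
Proof.
have [m m0 h] := min_majorant; exists m => // t t01.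
have := lcm_le _ t t01 h; rewrite le_min => /andP[]; by split.
Qed.

Lemma lcm0 : C 0 = 0.
Proof.
have [m m0 h] := lcm_linear_bound; have z01 : 0 <= (0 : R) <= 1 by apply/andP; split.
have [+ _] := h _ z01.
by rewrite mulr0 => C0; apply/eqP; rewrite eq_le C0/= lcm_ge0.
Qed.

Lemma lcm1 : C 1 = 0.
Proof.
have [m m0 h] := lcm_linear_bound; have z01 : 0 <= (1 : R) <= 1 by apply/andP; split.
have [_] := h _ z01.
by rewrite subrr mulr0 => C0; apply/eqP; rewrite eq_le C0/= lcm_ge0.
Qed.

(* Finitely many points determine the majorant: the lines dominating [hull]
   dominate the tent over [x 0], hence all the remaining atoms. *)
Lemma finite_hull : exists hull : seq (R * R), [/\
  (0, 0) \in hull, (1, 0) \in hull,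
  forall p, p \in hull -> [\/ p = (0, 0), p = (1, 0) | exists k, x k = p],
  forall k, C (x k).1 = (x k).2 -> x k \in hull
  & forall a b, (forall p, p \in hull -> p.2 <= a * p.1 + b) ->
      forall k, (x k).2 <= a * (x k).1 + b].
Proof.
have [_ _ fin] := xreg; pose u0 := (x 0%N).1; pose v0 := (x 0%N).2.
have vpos : 0 < v0 := v_gt0 0; have /andP[upos u1] := atom_abscissa 0.
(* Points under the tent of slope c = v0/2 lie strictly below the two segments joining [x 0] to (0,
   0) and (1, 0), whose slopes are at least v0 in absolute value. Halving v0 provides the strictness
   that keeps points of the majorant, and [x 0] itself, in the finite set. *)
rewrite -/u0 in upos u1; pose c := v0 / 2; have c0 : 0 < c by rewrite /c; lra.
have [F FE] := (finite_seqP _).1 (fin c c0).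
have inF k : c * (x k).1 < (x k).2 \/ c * (1 - (x k).1) < (x k).2 -> x k \in F.
  by move=> h; have : [set` F] (x k) by rewrite -FE; split; [exists k|].
have x0F : x 0%N \in F by apply: inF; left; rewrite -/u0 -/v0 /c; nra.
exists ((0, 0) :: (1, 0) :: F); split.
- by rewrite mem_head.
- by rewrite !inE eqxx orbT.
- move=> p; rewrite !inE => /orP[/eqP ->|/orP[/eqP ->|pF]].
  + exact: Or31.
  + exact: Or32.
  + have : [set` F] p by []. by rewrite -FE => -[[k _ <-] _]; apply: Or33; exists k.
- move=> k Ck; rewrite !inE; apply/orP; right; apply/orP; right; apply: inF.
  have /andP[k0 k1] := atom_abscissa k.
  have C0 := lcm_atom 0; rewrite -/u0 -/v0 in C0.
  have [ku|uk] := lerP (x k).1 u0.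
    left; have := lcm_concave 0 (x k).1 u0 (lexx _) (ltW k0) ku (ltW u1).
    rewrite lcm0 Ck /c => h.
    have h1 : (x k).1 * v0 <= (x k).1 * C u0 by rewrite ler_pM2l.
    have h2 : u0 * (x k).2 <= (x k).2 by rewrite ger_pMl// ltW.
    have h3 : 0 < (x k).1 * v0 by rewrite mulr_gt0.
    by lra.
  right; have := lcm_concave u0 (x k).1 1 (ltW upos) (ltW uk) (ltW k1) (lexx _).
  rewrite lcm1 Ck /c => h.
  have h1 : (1 - (x k).1) * v0 <= (1 - (x k).1) * C u0 by rewrite ler_pM2l// subr_gt0.
  have h2 : (1 - u0) * (x k).2 <= (x k).2 by rewrite ger_pMl//; lra.
  have h3 : 0 < (1 - (x k).1) * v0 by rewrite mulr_gt0// subr_gt0.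
  by lra.
- move=> a b h k; have /andP[k0 k1] := atom_abscissa k.
  have h0 : 0 <= a * 0 + b by apply: (h (0, 0)); rewrite mem_head.
  have h1 : 0 <= a * 1 + b by apply: (h (1, 0)); rewrite !inE eqxx orbT.
  have h2 : v0 <= a * u0 + b by apply: h; rewrite !inE x0F !orbT.
  have [kF|kF] := boolP (x k \in F).
    by apply: h; rewrite !inE kF !orbT.
  have n1 : (x k).2 <= c * (x k).1.
    by rewrite leNgt; apply: contra kF => hk; apply: inF; left.
  have n2 : (x k).2 <= c * (1 - (x k).1).
    by rewrite leNgt; apply: contra kF => hk; apply: inF; right.
  have [ku|uk] := lerP (x k).1 u0.
    rewrite -(@ler_pM2l _ u0)//; rewrite /c in n1.
    have e1 : (x k).1 * v0 <= (x k).1 * (a * u0 + b) by rewrite ler_pM2l.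
    have e2 : 0 <= (u0 - (x k).1) * b by rewrite mulr_ge0//; lra.
    have e3 : u0 * (x k).2 <= (x k).2 by rewrite ger_pMl// ltW.
    have e4 : 0 < (x k).1 * v0 by rewrite mulr_gt0.
    by lra.
  rewrite -(@ler_pM2l _ (1 - u0)) ?subr_gt0//; rewrite /c in n2.
  have e1 : (1 - (x k).1) * v0 <= (1 - (x k).1) * (a * u0 + b).
    by rewrite ler_pM2l// subr_gt0.
  have e2 : 0 <= ((x k).1 - u0) * (a + b) by rewrite mulr_ge0//; lra.
  have e3 : (1 - u0) * (x k).2 <= (x k).2 by rewrite ger_pMl//; lra.
  have e4 : 0 < (1 - (x k).1) * v0 by rewrite mulr_gt0// subr_gt0.
  by lra.
Qed.

Lemma lcm_chord_le a b s t : 0 <= s -> t <= 1 -> a * s + b <= C s -> a * t + b <= C t ->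
  forall r, s <= r <= t -> a * r + b <= C r.
Proof.
move=> s0 t1 hs ht r /andP[sr rt].
have := lcm_concave s r t s0 sr rt t1.
have [st|ts] := ltrP s t; last by have -> : r = s by lra.
have : (t - r) * (a * s + b) <= (t - r) * C s by apply: ler_wpM2l => //; lra.
have : (r - s) * (a * t + b) <= (r - s) * C t by apply: ler_wpM2l => //; lra.
move=> h1 h2 h3; rewrite -(@ler_pM2l _ (t - s)) ?subr_gt0//; lra.
Qed.

Lemma chord_dominated (a b s p1 q1 q2 r1 r2 H : R) : r1 < s -> s < q1 ->
  H = a * s + b -> q2 = a * q1 + b ->
  (r2 * (q1 - s) + q2 * (s - r1)) / (q1 - r1) <= H -> r2 <= a * r1 + b.
Proof.
move=> rs sq -> ->; rewrite ler_pdivrMr; last lra.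
move=> h; rewrite -(@ler_pM2r _ (q1 - s)); last lra.
lra.
Qed.

Definition hull_point p : Prop := p = (p.1, C p.1) /\
  [\/ p.1 = 0, p.1 = 1 | exists k, x k = p].

(** Among the pairs of hull points on either side of [s], the chord that is highest over [s]
    dominates every hull point of another abscissa: exchanging an end for a point above the line
    would raise the chord. Either it dominates everything, or a hull point over [s] lies above it
    and is a contact point. *)
Lemma lcm_supporting_line s : 0 < s < 1 -> (exists k, x k = (s, C s)) \/
  exists p q a b, [/\ p.1 < s < q.1, hull_point p, hull_point q,
    forall t, p.1 <= t <= q.1 -> C t = a * t + b
  & forall k, (x k).2 <= a * (x k).1 + b].
Proof.
move=> /andP[s0 s1]; have [F [F0 F1 Fatom _ Fdom]] := finite_hull.
pose height (pq : (R * R) * (R * R)) :=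
  (pq.1.2 * (pq.2.1 - s) + pq.2.2 * (s - pq.1.1)) / (pq.2.1 - pq.1.1).
pose pairs := [seq pq <- [seq (p, q) | p <- F, q <- F] | pq.1.1 < s < pq.2.1].
have inpairs p q : p \in F -> q \in F -> p.1 < s -> s < q.1 -> (p, q) \in pairs.
  by move=> pF qF ps sq; rewrite mem_filter/= ps sq/=; apply/allpairsP; exists (p, q).
have p01 := inpairs _ _ F0 F1 s0 s1.
have /(seq_argmax _ height)[[p q]] : pairs != [::] by case: (pairs) p01.
rewrite mem_filter/= => /andP[/andP[ps sq]] /allpairsP[[p' q']]/= [pF qF [pE qE]] hmax.
rewrite -{p'}pE -{q'}qE in pF qF.
have F01 (r : R * R) : r \in F -> 0 <= r.1 <= 1.
  move=> /Fatom[->|->|[k <-]]/=; rewrite ?lexx ?ler01//.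
  by have /andP[k0 k1] := atom_abscissa k; rewrite !ltW.
have FC (r : R * R) : r \in F -> r.2 <= C r.1.
  by move=> /Fatom[->|->|[k <-]]/=; [rewrite lcm0|rewrite lcm1|exact: lcm_atom].
pose a := (q.2 - p.2) / (q.1 - p.1); pose b := p.2 - a * p.1.
have pqn : q.1 - p.1 != 0 by rewrite subr_eq0 gt_eqF//; lra.
have pl : p.2 = a * p.1 + b by rewrite /b; ring.
have ql : q.2 = a * q.1 + b by rewrite /b /a; field.
have hE : height (p, q) = a * s + b by rewrite /height/= /b /a; field.
have side (r : R * R) : r \in F -> r.1 != s -> r.2 <= a * r.1 + b.
  move=> rF; rewrite neq_lt => /orP[rs|sr].
    apply: (@chord_dominated a b s p.1 q.1 q.2 r.1 r.2 _ rs sq hE ql).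
    by have := hmax _ (inpairs _ _ rF qF rs sq).
  have := hmax _ (inpairs _ _ pF rF ps sr); rewrite hE /height/=.
  rewrite ler_pdivrMr; last lra.
  move=> h; rewrite -(@ler_pM2r _ (s - p.1)); last lra.
  rewrite pl in h; lra.
have dom_le a' b' : (forall r : R * R, r \in F -> r.2 <= a' * r.1 + b') ->
    forall t, 0 <= t <= 1 -> C t <= a' * t + b'.
  move=> h; apply: lcm_affine_le; last exact: Fdom.
    by have := h _ F0; rewrite /= mulr0 add0r.
  by have := h _ F1; rewrite /= mulr1.
have [top|/existsNP[r0 /not_implyP[r0F /not_implyP[r0s /negP]]]] := pselect
    (forall r : R * R, r \in F -> r.1 = s -> r.2 <= a * s + b).
  right; have dom (r : R * R) : r \in F -> r.2 <= a * r.1 + b.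
    by move=> rF; have [rs|rs] := eqVneq r.1 s; [rewrite rs; exact: top|exact: side].
  have Cle := dom_le a b dom.
  have onhull (r : R * R) : r \in F -> r.2 = a * r.1 + b -> hull_point r.
    move=> rF rl; have r2 : C r.1 = r.2.
      by apply/eqP; rewrite eq_le FC// rl Cle// F01.
    by split; [rewrite r2; case: (r)|case: (Fatom r rF) => [->|->|h];
      [exact: Or31|exact: Or32|exact: Or33]].
  exists p, q, a, b; split => //; [by rewrite ps|exact: onhull|exact: onhull| |exact: Fdom].
  have /andP[p0 p1] := F01 p pF; have /andP[q0 q1] := F01 q qF.
  move=> t pqt; apply/eqP; rewrite eq_le Cle/=; last by move: pqt => /andP[]; lra.
  by apply: (lcm_chord_le a b p.1 q.1) => //; rewrite -?pl -?ql; exact: FC.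
rewrite -ltNge => r0h; left.
pose tops := [seq r <- F | r.1 == s].
have r0t : r0 \in tops by rewrite mem_filter r0F r0s eqxx.
have /(seq_argmax _ (fun r : R * R => r.2))[r] : tops != [::] by case: (tops) r0t.
rewrite mem_filter => /andP[/eqP rs rF] rmax.
have rh : a * s + b < r.2 by exact: (lt_le_trans r0h (rmax _ r0t)).
pose lefts := [seq l <- F | l.1 < s].
(* The supporting line through [r] has the smallest slope from a left neighbour. Points on the left
   are below it by minimality; points on the right, because their chord to [l] passes over [s] no
   higher than the maximal chord, hence below [r]. *)
pose slope (l : R * R) := (r.2 - l.2) / (s - l.1).
have l0 : (0, 0) \in lefts by rewrite mem_filter F0/= s0.
have /(seq_argmax _ (fun l => - slope l))[l] : lefts != [::] by case: (lefts) l0.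
rewrite mem_filter => /andP[ls lF] lmin.
pose m := slope l.
have lE : l.2 = r.2 - m * (s - l.1).
  by rewrite /m /slope divfK ?subKr// subr_eq0 gt_eqF.
have dom (z : R * R) : z \in F -> z.2 <= m * z.1 + (r.2 - m * s).
  move=> zF; have [zs|sz|zs] := ltrgtP z.1 s.
  - have := lmin z; rewrite mem_filter zs zF => /(_ isT); rewrite lerN2 -/m /slope.
    by rewrite ler_pdivlMr ?subr_gt0//; lra.
  - have := hmax _ (inpairs _ _ lF zF ls sz); rewrite hE /height/= ler_pdivrMr; last lra.
    rewrite lE => h.
    have : (a * s + b) * (z.1 - l.1) < r.2 * (z.1 - l.1) by rewrite ltr_pM2r//; lra.
    move=> h'; rewrite -(@ler_pM2l _ (s - l.1)) ?subr_gt0//; lra.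
  - have := rmax z; rewrite mem_filter zs eqxx zF => /(_ isT); lra.
have Cs : C s = r.2.
  apply/eqP; rewrite eq_le -{2}rs FC// andbT.
  have := dom_le _ _ dom s; rewrite addrC subrK; apply.
  by apply/andP; split; lra.
case: (Fatom r rF) => [rE|rE|[k kE]]; first by move: rs; rewrite rE/=; lra.
  by move: rs; rewrite rE/=; lra.
by exists k; rewrite Cs kE -rs; case: (r).
Qed.

Lemma affine_coef_unique a b a' b' s t : s < t ->
  a * s + b = a' * s + b' -> a * t + b = a' * t + b' -> a = a' /\ b = b'.
Proof.
move=> st hs ht; have : (a - a') * (t - s) = 0 by lra.
move=> /eqP; rewrite mulf_eq0 => /orP[|]; rewrite subr_eq0 => /eqP h; last by lra.
by split => //; move: hs; rewrite h; lra.
Qed.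

Lemma affine_on_glue g I J s t : is_interval I -> is_interval J ->
  affine_on g I -> affine_on g J -> I s -> I t -> J s -> J t -> s < t ->
  affine_on g (I `|` J) /\ is_interval (I `|` J).
Proof.
move=> iI iJ [a [b gI]] [a' [b' gJ]] Is It Js Jt st.
have [ea eb] : a = a' /\ b = b'.
  by apply: (affine_coef_unique a b a' b' s t st); rewrite -gI// -gJ.
split; first by exists a, b => r [/gI//|/gJ ->]; rewrite ea eb.
move=> y z [Iy|Jy] [Iz|Jz] r /andP[yr rz].
- by left; apply: (iI y z) => //; rewrite yr.
- have [rt|tr] := lerP r t.
    by left; apply: (iI y t) => //; rewrite yr.
  by right; apply: (iJ t z) => //; rewrite rz ltW.
- have [rt|tr] := lerP r t.
    by right; apply: (iJ y t) => //; rewrite yr.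
  by left; apply: (iI t z) => //; rewrite rz ltW.
- by right; apply: (iJ y z) => //; rewrite yr.
Qed.

(** Two common points determine the line, so [g] is affine on the union, and maximality forces both
    intervals to equal it. Linearity intervals are identified in this way throughout. *)
Lemma linearity_interval_eq g I J s t : linearity_intervals g I ->
  linearity_intervals g J -> I s -> I t -> J s -> J t -> s < t -> I = J.
Proof.
move=> [I01 iI _ aI mI] [J01 iJ _ aJ mJ] Is It Js Jt st.
have [aU iU] := affine_on_glue g I J s t iI iJ aI aJ Is It Js Jt st.
have U01 : I `|` J `<=` `[0, 1] by move=> r [/I01|/J01].
by rewrite -(mI _ U01 iU aU (@subsetUl _ _ _)); apply: mJ => //; exact: subsetUr.
Qed.

(** The union of all affine intervals containing [s, t] is again one of them: all share the
    coefficients fixed on [s, t]. *)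
Lemma linearity_interval_extend g s t : 0 <= s -> s < t -> t <= 1 ->
  affine_on g `[s, t] -> exists2 I, linearity_intervals g I & `[s, t] `<=` I.
Proof.
move=> s0 st t1 [a [b gab]].
pose fam : set (set R) := [set J | [/\ `[s, t] `<=` J, J `<=` `[0, 1],
  is_interval J & affine_on g J]].
have Js J : fam J -> J s by move=> [h _ _ _]; apply: h; rewrite /= in_itv/= lexx ltW.
have Jt J : fam J -> J t by move=> [h _ _ _]; apply: h; rewrite /= in_itv/= lexx ltW.
have gJ J : fam J -> forall r, J r -> g r = a * r + b.
  move=> fJ; have [_ _ _ [a' [b' h]]] := fJ => r /h ->.
  suff [-> ->] : a' = a /\ b' = b by [].
  apply: (affine_coef_unique a' b' a b s t st); rewrite -h; try exact: Js; try exact: Jt;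
    by apply: gab; rewrite /= in_itv/= lexx ltW.
exists (\bigcup_(J in fam) J).
  split.
  - by move=> r [J [_ J01 _ _] /J01].
  - move=> y z [J fJ Jy] [K fK Kz] r /andP[yr rz].
    have [rs|sr] := lerP r s.
      by exists J => //; have [_ _ iJ _] := fJ; apply: (iJ y s) => //;
        [exact: Js|rewrite yr].
    by exists K => //; have [_ _ iK _] := fK; apply: (iK s z) => //;
      [exact: Js|rewrite rz ltW].
  - have f0 : fam `[s, t]%classic.
      split => //; last by exists a, b.
        by move=> r; rewrite /= !in_itv/= => /andP[sr rt]; apply/andP; split; lra.
      exact: interval_is_interval.
    by exists s, t; split => //; exists `[s, t]%classic => //; [exact: Js|exact: Jt].
  - by exists a, b => r [J fJ]; exact: gJ.
  - move=> K K01 iK aK UK; apply/seteqP; split=> [r Kr|]; last exact: UK.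
    exists K => //; split => // r' r'st; apply: UK.
    exists `[s, t]%classic => //; split => //; last by exists a, b.
      by move=> r''; rewrite /= !in_itv/= => /andP[sr rt]; apply/andP; split; lra.
    exact: interval_is_interval.
move=> r rst; exists `[s, t]%classic => //; split => //; last by exists a, b.
  by move=> r''; rewrite /= !in_itv/= => /andP[sr rt]; apply/andP; split; lra.
exact: interval_is_interval.
Qed.

Lemma le0_vanishing (K M s t : R) : s < t ->
  (forall r, s < r < t -> K <= (r - s) * M) -> K <= 0.
Proof.
move=> st h; rewrite leNgt; apply/negP => K0.
pose e := Num.min ((t - s) / 2) (K / (2 * (1 + `|M|))).
have M1 : 0 < 1 + `|M| by rewrite ltr_pwDl.
have e0 : 0 < e by rewrite lt_min !divr_gt0 ?subr_gt0// mulr_gt0.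
have e1 : e <= (t - s) / 2 by rewrite ge_min lexx.
have e2 : e * (2 * (1 + `|M|)) <= K.
  by rewrite -ler_pdivlMr ?mulr_gt0// ge_min lexx orbT.
have /h : s < s + e < t by apply/andP; split; lra.
rewrite addrC addKr => h1; have : e * M <= e * `|M| by rewrite ler_pM2l// ler_norm.
lra.
Qed.

Lemma le0_vanishing_left (K M s t : R) : s < t ->
  (forall r, s < r < t -> K <= (t - r) * M) -> K <= 0.
Proof.
move=> st h; apply: (le0_vanishing K M (- t) (- s)); first by rewrite ltrN2.
move=> r /andP[tr rs]; have := h (- r); have -> : r - - t = t - - r by ring.
apply.
by apply/andP; split; lra.
Qed.

(** Concavity at two inner points gives one inequality at an end. The other is a limit: at an end
    inside (0, 1) it comes from concavity with the point 0 or 1 beyond it, and at 0 or 1 from the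
    tent bounding the majorant. Linearity intervals are therefore closed. *)
Lemma lcm_affine_closure a b s t : 0 <= s -> s < t -> t <= 1 ->
  (forall r, s < r < t -> C r = a * r + b) -> C s = a * s + b /\ C t = a * t + b.
Proof.
move=> s0 st t1 h; have [m m0 hm] := lcm_linear_bound.
pose r1 := s + (t - s) / 3; pose r2 := s + 2 * (t - s) / 3.
have hr1 : s < r1 < t by rewrite /r1; apply/andP; split; lra.
have hr2 : s < r2 < t by rewrite /r2; apply/andP; split; lra.
have r12 : r1 < r2 by rewrite /r1 /r2; lra.
move: hr1 hr2 => /andP[sr1 r1t] /andP[sr2 r2t].
have hr1 : C r1 = a * r1 + b by apply: h; rewrite sr1.
have hr2 : C r2 = a * r2 + b by apply: h; rewrite sr2.
split; apply/eqP; rewrite eq_le; apply/andP; split.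
- have : (r2 - r1) * C s + (r1 - s) * C r2 <= (r2 - s) * C r1.
    by apply: lcm_concave; lra.
  rewrite hr1 hr2 => k; rewrite -(@ler_pM2l _ (r2 - r1)) ?subr_gt0//; lra.
- rewrite -subr_le0; move: s0; rewrite le_eqVlt => /predU1P[s0|s0].
    rewrite -s0 lcm0 mulr0 add0r subr0; apply: (le0_vanishing _ (m - a) s t st) => r rst.
    have r01 : 0 <= r <= 1 by move: rst => /andP[? ?]; apply/andP; split; lra.
    by have [+ _] := hm r r01; rewrite h// -s0 subr0; lra.
  have : s * (a * s + b - C s) <= 0.
    apply: (le0_vanishing _ (C s - s * a) s t st) => r rst.
    have : (r - s) * C 0 + (s - 0) * C r <= (r - 0) * C s.
      by move: rst => /andP[? ?]; apply: lcm_concave; lra.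
    by rewrite lcm0 h//; lra.
  by rewrite pmulr_rle0.
- have : (t - r2) * C r1 + (r2 - r1) * C t <= (t - r1) * C r2.
    by apply: lcm_concave; lra.
  rewrite hr1 hr2 => k; rewrite -(@ler_pM2l _ (r2 - r1)) ?subr_gt0//; lra.
- rewrite -subr_le0; move: t1; rewrite le_eqVlt => /predU1P[t1|t1].
    rewrite t1 lcm1 mulr1 subr0; apply: (le0_vanishing_left _ (m + a) s t st) => r rst.
    have r01 : 0 <= r <= 1 by move: rst => /andP[? ?]; apply/andP; split; lra.
    by have [_] := hm r r01; rewrite h// t1; lra.
  have : (1 - t) * (a * t + b - C t) <= 0.
    apply: (le0_vanishing_left _ (C t + (1 - t) * a) s t st) => r rst.
    have : (1 - t) * C r + (t - r) * C 1 <= (1 - r) * C t.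
      by move: rst => /andP[? ?]; apply: lcm_concave; lra.
    by rewrite lcm1 h//; lra.
  by rewrite pmulr_rle0// subr_gt0.
Qed.

Lemma linearity_interval_itv I : linearity_intervals C I ->
  exists s t, [/\ 0 <= s, s < t, t <= 1 & I = `[s, t]%classic].
Proof.
move=> [I01 iI [y [z [Iy Iz yz]]] [a [b hab]] mI].
have lbI : has_lbound I by exists 0 => r /I01; rewrite /= in_itv/= => /andP[].
have ubI : has_ubound I by exists 1 => r /I01; rewrite /= in_itv/= => /andP[].
have I0 : I !=set0 by exists y.
pose s := inf I; pose t := sup I.
have sy : s <= y by exact: ge_inf.
have zt : z <= t by exact: ub_le_sup.
have s0 : 0 <= s by apply: lb_le_inf => // r /I01; rewrite /= in_itv/= => /andP[].
have t1 : t <= 1 by apply: ge_sup => // r /I01; rewrite /= in_itv/= => /andP[].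
have st : s < t by lra.
have inI r : s < r < t -> I r.
  move=> /andP[sr rt].
  have [] := @inf_adherent _ I (r - s); rewrite ?subr_gt0//.
  move=> r' Ir'; rewrite -/s addrC subrK => r'r.
  have [] := @sup_adherent _ I (t - r); rewrite ?subr_gt0//.
  move=> r'' Ir''; rewrite -/t subKr => rr''.
  by apply: (iI r' r'') => //; rewrite !ltW.
exists s, t; split => //; apply/esym/mI.
- by move=> r; rewrite /= !in_itv/= => /andP[sr rt]; apply/andP; split; lra.
- exact: interval_is_interval.
- exists a, b; have [hs ht] := lcm_affine_closure a b s t s0 st t1
    (fun r rst => hab r (inI r rst)).
  move=> r; rewrite /= in_itv/= !le_eqVlt => /andP[/predU1P[<-//|sr] /predU1P[->//|rt]].
  by apply/hab/inI; rewrite sr.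
- by move=> r Ir; rewrite /= in_itv/= ge_inf//= ub_le_sup.
Qed.

(** Without an atom at [r], a supporting chord has [r] in its interior. Its maximal extension
    overlaps [s, t], hence equals it, yet reaches strictly beyond the end [r]. *)
Lemma linearity_interval_endpoint s t r : linearity_intervals C `[s, t]%classic ->
  s < t -> 0 < r < 1 -> r = s \/ r = t -> exists k, x k = (r, C r).
Proof.
move=> LI st r01 rst; have [//|[p [q [a [b [/andP[pr rq] hp hq hC _]]]]]] :=
  lcm_supporting_line r r01.
have [I01 _ _ _ mI] := LI.
have h01 z : hull_point z -> 0 <= z.1 <= 1.
  move=> [_ [->|->|[k <-]]]; rewrite ?lexx ?ler01//.
  by have /andP[k0 k1] := atom_abscissa k; rewrite !ltW.
have /andP[p0 _] := h01 _ hp; have /andP[_ q1] := h01 _ hq.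
have [J LJ pqJ] : exists2 J, linearity_intervals C J & `[p.1, q.1] `<=` J.
  apply: linearity_interval_extend => //; first lra.
  by exists a, b => z; rewrite /= in_itv/=; exact: hC.
have inJ z : p.1 <= z <= q.1 -> J z by move=> h; apply: pqJ; rewrite /= in_itv.
have inI z : s <= z <= t -> `[s, t]%classic z by rewrite /= in_itv.
case: rst => rE.
- have IJ : `[s, t]%classic = J.
    apply: (@linearity_interval_eq C _ _ s (Num.min t q.1)) => //.
    + by apply: inI; rewrite lexx ltW.
    + by apply: inI; rewrite ge_min lexx le_min (ltW st)/=; lra.
    + by apply: inJ; lra.
    + by apply: inJ; rewrite ge_min lexx orbT le_min andbT; lra.
    + by rewrite lt_min st/=; lra.
  have : J p.1 by apply: inJ; lra.
  by rewrite -IJ /= in_itv/= => /andP[]; lra.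
- have IJ : `[s, t]%classic = J.
    apply: (@linearity_interval_eq C _ _ (Num.max s p.1) t) => //.
    + by apply: inI; rewrite le_max lexx ge_max (ltW st)/=; lra.
    + by apply: inI; rewrite lexx ltW.
    + by apply: inJ; rewrite le_max lexx orbT ge_max; lra.
    + by apply: inJ; lra.
    + by rewrite gt_max st/=; lra.
  have : J q.1 by apply: inJ; lra.
  by rewrite -IJ /= in_itv/= => /andP[]; lra.
Qed.
End least_concave_majorant_geometry.

(** * Edges that touch neither 0 nor 1 *)

Section inner_edges.
Context {R : realType}.
Implicit Types (a b c s t r : R) (p q : R * R) (I J : set R).

Definition inner_edges (x : nat -> R * R) : set (R * R) :=
  [set st | [/\ 0 < st.1, st.1 < st.2, st.2 < 1 &
    linearity_intervals (least_concave_majorant x) `[st.1, st.2]%classic]].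

Definition line_at p q t : R := (p.2 * (q.1 - t) + q.2 * (t - p.1)) / (q.1 - p.1).

Lemma line_atE p q t : p.1 < q.1 -> line_at p q t =
  (line_at p q 1 - line_at p q 0) * t + line_at p q 0.
Proof. by move=> pq; rewrite /line_at; field; rewrite subr_eq0 gt_eqF. Qed.

Lemma line_at_left p q : p.1 < q.1 -> line_at p q p.1 = p.2.
Proof. by move=> pq; rewrite /line_at; field; rewrite subr_eq0 gt_eqF. Qed.

Lemma line_at_right p q : p.1 < q.1 -> line_at p q q.1 = q.2.
Proof. by move=> pq; rewrite /line_at; field; rewrite subr_eq0 gt_eqF. Qed.

Variable x : nat -> R * R.
Hypothesis xreg : regular_atoms x.
Local Notation C := (least_concave_majorant x).

Lemma itvcc_inj s t s' t' : s <= t -> `[s, t]%classic = `[s', t']%classic ->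
  s = s' /\ t = t'.
Proof.
move=> st E.
have hs : `[s', t']%classic s by rewrite -E /= in_itv/= lexx.
have ht : `[s', t']%classic t by rewrite -E /= in_itv/= lexx st.
move: hs ht; rewrite /= !in_itv/= => /andP[h1 h2] /andP[h3 h4].
have hs' : `[s, t]%classic s' by rewrite E /= in_itv/= lexx; lra.
have ht' : `[s, t]%classic t' by rewrite E /= in_itv/= lexx andbT; lra.
by move: hs' ht'; rewrite /= !in_itv/= => /andP[h5 h6] /andP[h7 h8]; split; lra.
Qed.

Let atom01 := atom_abscissa x xreg.

(** The steepest ray from the origin to a point of the finite hull dominates the hull, and the
    majorant follows it up to that point. *)
Lemma first_linearity_interval : exists t, [/\ 0 < t, t <= 1 &
  linearity_intervals C `[0, t]%classic].
Proof.
have [F [F0 F1 Fatom _ Fdom]] := finite_hull x xreg.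
pose G := [seq p <- F | 0 < p.1].
have G1 : (1, 0) \in G by rewrite mem_filter F1/= ltr01.
have /(seq_argmax _ (fun p : R * R => p.2 / p.1))[q] : G != [::] by case: (G) G1.
rewrite mem_filter => /andP[q0 qF] qmax.
pose a := q.2 / q.1.
have dom (p : R * R) : p \in F -> p.2 <= a * p.1 + 0.
  move=> pF; case: (Fatom p pF) => [->|pE|[k pE]]; rewrite addr0.
  - by rewrite /= mulr0.
  - have := qmax p; rewrite mem_filter pF pE/= ltr01 mul0r mulr1 => /(_ isT).
    by [].
  - have p0 : 0 < p.1 by rewrite -pE; have /andP[] := atom01 k.
    by have := qmax p; rewrite mem_filter pF p0 => /(_ isT); rewrite ler_pdivrMr.
have a0 : 0 <= a by have := dom _ F1; rewrite /= mulr1 addr0.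
have CF : q.2 <= C q.1.
  case: (Fatom q qF) => [->|->|[k <-]]/=; rewrite ?lcm0 ?lcm1//.
  exact: lcm_atom.
have q1 : q.1 <= 1.
  case: (Fatom q qF) => [->|->|[k <-]]//=.
  by have /andP[_ /ltW] := atom01 k.
have Cle : forall t, 0 <= t <= 1 -> C t <= a * t + 0.
  by apply: lcm_affine_le => //; rewrite ?addr0//; exact: Fdom.
have CE t : 0 <= t <= q.1 -> C t = a * t + 0.
  move=> t01; apply/eqP; rewrite eq_le Cle; last by move: t01 => /andP[? ?]; lra.
  apply: (lcm_chord_le x xreg a 0 0 q.1) => //.
    by rewrite lcm0// mulr0 addr0.
  by rewrite addr0 /a divfK// gt_eqF.
have [I LI sub] : exists2 I, linearity_intervals C I & `[0, q.1] `<=` I.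
  apply: linearity_interval_extend => //.
  by exists a, 0 => t; rewrite /= in_itv/=; exact: CE.
have [s [t [s0 st t1 IE]]] := linearity_interval_itv x xreg I LI.
have : I 0 by apply: sub; rewrite /= in_itv/= lexx ltW.
rewrite IE/= in_itv/= => /andP[s0' _].
have sE : s = 0 by lra.
by exists t; split => //; [lra|rewrite -sE -IE].
Qed.

Lemma last_linearity_interval : exists s, [/\ 0 <= s, s < 1 &
  linearity_intervals C `[s, 1]%classic].
Proof.
have [F [F0 F1 Fatom _ Fdom]] := finite_hull x xreg.
pose G := [seq p <- F | p.1 < 1].
have G0 : (0, 0) \in G by rewrite mem_filter F0/= ltr01.
have /(seq_argmax _ (fun p : R * R => p.2 / (1 - p.1)))[q] : G != [::] by case: (G) G0.
rewrite mem_filter => /andP[q1 qF] qmax.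
pose c := q.2 / (1 - q.1).
have d0 : 0 < 1 - q.1 by rewrite subr_gt0.
have dom (p : R * R) : p \in F -> p.2 <= - c * p.1 + c.
  move=> pF; have -> : - c * p.1 + c = c * (1 - p.1) by ring.
  case: (Fatom p pF) => [pE|->|[k pE]].
  - have := qmax p; rewrite mem_filter pF pE/= ltr01 mul0r subr0 mulr1 => /(_ isT).
    by [].
  - by rewrite /= subrr mulr0.
  - have p1 : p.1 < 1 by rewrite -pE; have /andP[] := atom01 k.
    have := qmax p; rewrite mem_filter pF p1 => /(_ isT).
    by rewrite ler_pdivrMr// subr_gt0.
have c0 : 0 <= c by have := dom _ F0; rewrite /= mulr0 add0r.
have CF : q.2 <= C q.1.
  case: (Fatom q qF) => [->|->|[k <-]]/=; rewrite ?lcm0 ?lcm1//.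
  exact: lcm_atom.
have q0 : 0 <= q.1.
  case: (Fatom q qF) => [->|->|[k <-]]//=.
  by have /andP[/ltW] := atom01 k.
have Cle : forall t, 0 <= t <= 1 -> C t <= - c * t + c.
  by apply: lcm_affine_le => //; [lra|exact: Fdom].
have CE t : q.1 <= t <= 1 -> C t = - c * t + c.
  move=> t01; apply/eqP; rewrite eq_le Cle; last by move: t01 => /andP[? ?]; lra.
  apply: (lcm_chord_le x xreg (- c) c q.1 1) => //.
    by rewrite (_ : - c * q.1 + c = q.2)// /c; field; rewrite gt_eqF.
  by rewrite lcm1//; lra.
have [I LI sub] : exists2 I, linearity_intervals C I & `[q.1, 1] `<=` I.
  apply: linearity_interval_extend => //.
  by exists (- c), c => t; rewrite /= in_itv/=; exact: CE.
have [s [t [s0 st t1 IE]]] := linearity_interval_itv x xreg I LI.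
have : I 1 by apply: sub; rewrite /= in_itv/= lexx ltW.
rewrite IE/= in_itv/= => /andP[_ t1'].
have tE : t = 1 by lra.
by exists s; split => //; [lra|move: LI; rewrite IE tE].
Qed.

Lemma linearity_interval_neq01 : ~ linearity_intervals C `[0, 1]%classic.
Proof.
move=> [_ _ _ [a [b h]] _].
have := h 0; have := h 1; rewrite /= !in_itv/= !lexx ler01 lcm0// lcm1//.
move=> /(_ isT) h1 /(_ isT) h0.
have /andP[u0 u1] := atom01 0.
have := h (x 0%N).1; rewrite /= in_itv/= !ltW// => /(_ isT).
have := lcm_atom x xreg 0; have [v0 _ _] := xreg; have := v0 0%N.
have -> : b = 0 by lra. have -> : a = 0 by lra.
by move=> ? ?; lra.
Qed.

Lemma finite_inner_edges : finite_set (inner_edges x).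
Proof.
have [F [_ _ _ Fhull _]] := finite_hull x xreg.
have fF : finite_set [set` F] by apply/finite_seqP; exists F.
apply: (@sub_finite_set _ _ ((@fst R R) @` [set` F] `*` (@fst R R) @` [set` F])).
  move=> [s t] [/= s0 st t1 LI].
  have inF r : 0 < r < 1 -> r = s \/ r = t -> ((@fst R R) @` [set` F]) r.
    move=> r01 rst.
    have [k kE] := linearity_interval_endpoint x xreg s t r LI st r01 rst.
    by exists (x k); rewrite ?kE// /=; rewrite -kE; apply: Fhull; rewrite kE.
  by split => /=; apply: inF; [apply/andP; split; lra|by left|
    apply/andP; split; lra|by right].
by apply: finite_setX; exact: finite_image.
Qed.

Lemma num_linearity_intervalsE :
  num_linearity_intervals x = (2 + #|` fset_set (inner_edges x) |)%N%:R%:E.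
Proof.
have [t0 [t00 t01 L0]] := first_linearity_interval.
have [s1 [s10 s11 L1]] := last_linearity_interval.
pose f (st : R * R) : set R := `[st.1, st.2]%classic.
have E : linearity_intervals C = [set `[0, t0]%classic] `|`
    ([set `[s1, 1]%classic] `|` (f @` inner_edges x)).
  apply/seteqP; split=> [I LI|I [->|[->|[[s t] [/= _ _ _ h] <-]]]]//.
  have [s [t [s0 st tle IE]]] := linearity_interval_itv x xreg I LI.
  have [sE|sN] := eqVneq s 0.
    left; apply: (linearity_interval_eq C _ _ 0 (Num.min t t0) LI L0).
    - by rewrite IE /= in_itv/= sE lexx -sE ltW.
    - by rewrite IE /= in_itv/= ge_min lexx le_min sE -{1}sE (ltW st) ltW.
    - by rewrite /= in_itv/= lexx ltW.
    - by rewrite /= in_itv/= ge_min lexx orbT le_min (ltW t00) -sE ltW.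
    - by rewrite lt_min t00 -sE st.
  right; have [tE|tN] := eqVneq t 1.
    left; apply: (linearity_interval_eq C _ _ (Num.max s s1) 1 LI L1).
    - by rewrite IE /= in_itv/= le_max lexx ge_max/=; apply/andP; split; lra.
    - by rewrite IE /= in_itv/=; apply/andP; split; lra.
    - by rewrite /= in_itv/= le_max lexx orbT ge_max/=; apply/andP; split; lra.
    - by rewrite /= in_itv/= lexx ltW.
    - by rewrite gt_max s11 -tE st.
  right; exists (s, t); last by rewrite IE.
  by split => //=; rewrite -?IE// lt_neqAle ?s0 ?tle ?tN ?andbT// eq_sym.
have fi := finite_inner_edges.
have ff : finite_set (f @` inner_edges x) by exact: finite_image.
rewrite /num_linearity_intervals /counting asboolT; last first.
  by rewrite E !finite_setU; split; [exact: finite_set1|split; [exact: finite_set1|]].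
rewrite E fset_setU//; last by rewrite finite_setU; split; [exact: finite_set1|].
rewrite fset_setU// !fset_set1 cardfsU1 cardfsU1 fset_set_image// card_in_imfset/=; last first.
  move=> [s t] [s' t']; rewrite !in_fset_set// !inE => -[/= _ st _ _] _ /itvcc_inj.
  by rewrite ltW// => /(_ isT)[/= -> ->].
have notf s t : s <= t -> s <= 0 \/ 1 <= t ->
    `[s, t]%classic \notin (f @` fset_set (inner_edges x))%fset.
  move=> st h; apply/imfsetP => -[[s' t']]; rewrite /= in_fset_set// inE => -[/= s'0 _ t'1 _].
  by move=> /(itvcc_inj _ _ _ _ st)[/= sE tE]; case: h; rewrite ?sE ?tE; lra.
have n0 : `[0, t0]%classic \notin
    (`[s1, 1]%classic |` f @` fset_set (inner_edges x))%fset.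
  rewrite in_fset1U negb_or; apply/andP; split.
    apply/eqP => /(itvcc_inj _ _ _ _ (ltW t00))[sE tE].
    by apply: linearity_interval_neq01; rewrite -tE.
  by apply: notf; [exact: ltW|left].
by rewrite n0 notf//; [exact: ltW|right].
Qed.

(** By concavity the line of the edge dominates the majorant. Its height over 0 cannot vanish: the
    majorant vanishes at 0 as well, so it would be affine from 0 on, against the maximality of the
    edge. The same holds at 1. *)
Lemma inner_edge_line s t : inner_edges x (s, t) ->
  let p := (s, C s) in let q := (t, C t) in
  [/\ exists i, x i = p, exists j, x j = q, 0 < line_at p q 0, 0 < line_at p q 1
    & forall k, (x k).2 <= line_at p q (x k).1].
Proof.
move=> hst p q; have [/= s0 st t1 LI] := hst; have pq : p.1 < q.1 by [].
have [I01 _ _ [a [b CE]] mI] := LI.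
have s01 : 0 < s < 1 by apply/andP; split; lra.
have t01 : 0 < t < 1 by apply/andP; split; lra.
have cs : C s = a * s + b by apply: CE; rewrite /= in_itv/= lexx ltW.
have ct : C t = a * t + b by apply: CE; rewrite /= in_itv/= lexx ltW.
have lE r : line_at p q r = a * r + b.
  by rewrite /line_at/= cs ct; field; rewrite subr_eq0 gt_eqF.
have Cle r : 0 <= r <= 1 -> C r <= a * r + b.
  move=> /andP[r0 r1]; have [rs|sr] := lerP r s.
    have := lcm_concave x xreg r s t r0 rs (ltW st) (ltW t1).
    by rewrite cs ct => h; rewrite -(@ler_pM2l _ (t - s)) ?subr_gt0//; lra.
  have [rt|tr] := lerP r t.
    by rewrite CE// /= in_itv/= (ltW sr).
  have := lcm_concave x xreg s t r (ltW s0) (ltW st) (ltW tr) r1.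
  by rewrite cs ct => h; rewrite -(@ler_pM2l _ (t - s)) ?subr_gt0//; lra.
have extend s' t' : 0 <= s' -> s' <= s -> t <= t' -> t' <= 1 -> s' < t' ->
    (forall r, s' <= r <= t' -> C r = a * r + b) -> s' = s /\ t' = t.
  move=> s'0 s's tt' t'1 st' h.
  have E : `[s', t']%classic = `[s, t]%classic.
    apply: mI.
    - by move=> r; rewrite /= !in_itv/= => /andP[? ?]; apply/andP; split; lra.
    - exact: interval_is_interval.
    - by exists a, b => r; rewrite /= in_itv/=; exact: h.
    - by move=> r; rewrite /= !in_itv/= => /andP[? ?]; apply/andP; split; lra.
  by have [] := itvcc_inj _ _ _ _ (ltW st') E.
split.
- exact: (linearity_interval_endpoint x xreg s t s LI st s01 (or_introl erefl)).
- exact: (linearity_interval_endpoint x xreg s t t LI st t01 (or_intror erefl)).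
- rewrite lE mulr0 add0r lt_neqAle; apply/andP; split; last first.
    by have := Cle 0; rewrite lexx ler01 lcm0// mulr0 add0r => /(_ isT).
  apply/eqP => b0; have [||||||] := extend 0 t; try lra.
  move=> r rt; have [rs|sr] := lerP r s; last first.
    by apply: CE; rewrite /= in_itv/=; move: rt => /andP[? ?]; apply/andP; split; lra.
  apply/eqP; rewrite eq_le Cle/=; last by move: rt => /andP[? ?]; apply/andP; split; lra.
  apply: (lcm_chord_le x xreg a b 0 s); rewrite ?lcm0 ?cs//; try lra.
- rewrite lE mulr1 lt_neqAle; apply/andP; split; last first.
    by have := Cle 1; rewrite lexx ler01 lcm1// mulr1 => /(_ isT).
  apply/eqP => b0; have [||||||] := extend s 1; try lra.
  move=> r rt; have [rs|sr] := lerP t r; last first.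
    by apply: CE; rewrite /= in_itv/=; move: rt => /andP[? ?]; apply/andP; split; lra.
  apply/eqP; rewrite eq_le Cle/=; last by move: rt => /andP[? ?]; apply/andP; split; lra.
  apply: (lcm_chord_le x xreg a b t 1); rewrite ?lcm1 ?ct//; try lra.
- move=> k; rewrite lE; apply: le_trans (lcm_atom x xreg k) _; apply: Cle.
  by have /andP[k0 k1] := atom01 k; rewrite !ltW.
Qed.

(* The majorant crosses the abscissa [c] along an edge joining [B1] to [B2]. *)
Lemma inner_edge_between (B1 B2 : set (R * R)) c :
  (forall p, B1 p -> p.1 < c) -> (forall q, B2 q -> c < q.1) ->
  (exists i, B1 (x i)) -> (exists j, B2 (x j)) ->
  (forall p q, B1 p -> B2 q -> 0 < line_at p q 0 /\ 0 < line_at p q 1) ->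
  (forall k p q, B1 p -> B2 q -> ~ B1 (x k) -> ~ B2 (x k) ->
    (x k).2 < line_at p q (x k).1) ->
  exists s t, [/\ inner_edges x (s, t), B1 (s, C s) & B2 (t, C t)].
Proof.
move=> B1c cB2 [i B1i] [j B2j] pos below.
have ic := B1c _ B1i; have cj := cB2 _ B2j.
have /andP[i0 i1] := atom01 i; have /andP[j0 j1] := atom01 j.
have c01 : 0 < c < 1 by apply/andP; split; lra.
have B12 p : p.1 < c -> ~ B2 p by move=> pc /cB2; lra.
have B21 p : c < p.1 -> ~ B1 p by move=> pc /B1c; lra.
pose m := line_at (x i) (x j).
pose am := m 1 - m 0; pose bm := m 0.
have ij : (x i).1 < (x j).1 by lra.
have mE t : m t = am * t + bm by exact: line_atE.
have mi : (x i).2 = am * (x i).1 + bm by rewrite -mE /m line_at_left.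
have mj : (x j).2 = am * (x j).1 + bm by rewrite -mE /m line_at_right.
(* An atom on the majorant at abscissa [c] lies in neither set, hence strictly below the chord from
   [x i] to [x j], which the majorant dominates. So the supporting chord alternative holds. *)
have [[k kE]|[p [q [a [b [/andP[pc cq] hp hq CE dom]]]]]] :=
    lcm_supporting_line x xreg c c01.
  have kc : (x k).1 = c by rewrite kE.
  have := below k _ _ B1i B2j; rewrite -/(m _) => h.
  have {}h : C c < m c.
    have -> : C c = (x k).2 by rewrite kE.
    by rewrite -kc; apply: h => [/B1c|/cB2]; lra.
  have ccond : (x i).1 <= c <= (x j).1 by rewrite (ltW ic) (ltW cj).
  have h' := lcm_chord_le x xreg am bm (x i).1 (x j).1 (ltW i0) (ltW j1).
  rewrite -mi -mj in h'; have {}h' := h' (lcm_atom x xreg i) (lcm_atom x xreg j) c ccond.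
  by rewrite -mE in h'; lra.
have p2 : p.2 = a * p.1 + b.
  by have [-> _] := hp; rewrite /= CE//; apply/andP; split; lra.
have q2 : q.2 = a * q.1 + b.
  by have [-> _] := hq; rewrite /= CE//; apply/andP; split; lra.
have domi := dom i; have domj := dom j.
have low (z : R * R) : hull_point x z -> ~ B1 z -> ~ B2 z -> z.1 != c ->
    forall p' q', B1 p' -> B2 q' -> z.2 < line_at p' q' z.1.
  move=> [zE hz] z1 z2 zc p' q' B1p' B2q'; have [l0 l1] := pos _ _ B1p' B2q'.
  case: hz => [z0|z0|[k kE]].
  - by rewrite zE/= z0 lcm0.
  - by rewrite zE/= z0 lcm1.
  - by rewrite -kE; apply: below => //; rewrite kE.
have pN2 : ~ B2 p by apply: B12.
have qN1 : ~ B1 q by apply: B21.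
have pnc : p.1 != c by rewrite lt_eqF.
have qnc : q.1 != c by rewrite gt_eqF.
(* An end outside both sets lies strictly below every line from [B1] to [B2]. If only [p] is
   outside, the line from [x i] to [q] descends more steeply than the edge and [x i] lies above the
   edge. If [q] is outside too, the edge passes below the chord from [x i] to [x j] over [c],
   although it dominates both atoms. *)
have pB1 : B1 p.
  apply: contrapT => pN1; have [qB2|qN2] := pselect (B2 q).
    have := low p hp pN1 pN2 pnc _ _ B1i qB2.
    have iq : (x i).1 < q.1 by lra.
    rewrite line_atE//; set a' := (X in X * _ + _); set b' := (X in _ + X).
    have e1 := line_at_left (x i) q iq; have e2 := line_at_right (x i) q iq.
    rewrite line_atE// -/a' -/b' in e1; rewrite line_atE// -/a' -/b' in e2.
    move=> h; have h1 : (a' - a) * (q.1 - p.1) < 0 by lra.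
    have h2 : 0 <= (a' - a) * (q.1 - (x i).1) by lra.
    have h3 : a' - a < 0 by rewrite -(@pmulr_llt0 _ (q.1 - p.1))//; lra.
    have : (a' - a) * (q.1 - (x i).1) < 0 by rewrite pmulr_llt0//; lra.
    lra.
  have h1 := low p hp pN1 pN2 pnc _ _ B1i B2j.
  have h2 := low q hq qN1 qN2 qnc _ _ B1i B2j.
  rewrite -/(m _) mE in h1; rewrite -/(m _) mE in h2.
  have k1 : (a * p.1 + b - (am * p.1 + bm)) * (q.1 - c) < 0.
    by rewrite pmulr_llt0 ?subr_gt0//; lra.
  have k2 : (a * q.1 + b - (am * q.1 + bm)) * (c - p.1) < 0.
    by rewrite pmulr_llt0 ?subr_gt0//; lra.
  have k3 : 0 <= (a * (x i).1 + b - (am * (x i).1 + bm)) * ((x j).1 - c).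
    by rewrite mulr_ge0//; lra.
  have k4 : 0 <= (a * (x j).1 + b - (am * (x j).1 + bm)) * (c - (x i).1).
    by rewrite mulr_ge0//; lra.
  have k5 : (a * c + b - (am * c + bm)) * (q.1 - p.1) < 0 by lra.
  have k6 : 0 <= (a * c + b - (am * c + bm)) * ((x j).1 - (x i).1) by lra.
  have k7 : a * c + b - (am * c + bm) < 0.
    by rewrite -(@pmulr_llt0 _ (q.1 - p.1))//; lra.
  have : (a * c + b - (am * c + bm)) * ((x j).1 - (x i).1) < 0.
    by rewrite pmulr_llt0//; lra.
  lra.
have qB2 : B2 q.
  apply: contrapT => qN2.
  have := low q hq qN1 qN2 qnc _ _ pB1 B2j.
  have pj : p.1 < (x j).1 by lra.
  rewrite line_atE//; set a' := (X in X * _ + _); set b' := (X in _ + X).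
  have e1 := line_at_left p (x j) pj; have e2 := line_at_right p (x j) pj.
  rewrite line_atE// -/a' -/b' in e1; rewrite line_atE// -/a' -/b' in e2.
  move=> h; have h1 : 0 < (a' - a) * (q.1 - p.1) by lra.
  have h2 : (a' - a) * ((x j).1 - p.1) <= 0 by lra.
  have h3 : 0 < a' - a by rewrite -(@pmulr_lgt0 _ (q.1 - p.1))//; lra.
  have : 0 < (a' - a) * ((x j).1 - p.1) by rewrite pmulr_lgt0//; lra.
  lra.
clear mi mj mE ij low domi domj i0 i1 j0 j1 ic cj.
have pq : p.1 < q.1 by lra.
have lE t : line_at p q t = a * t + b.
  by rewrite /line_at p2 q2; field; rewrite subr_eq0 gt_eqF.
have [b0 ab0] := pos _ _ pB1 qB2.
rewrite lE mulr0 add0r in b0; rewrite lE mulr1 in ab0.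
have h01 z : hull_point x z -> 0 <= z.1 <= 1.
  move=> [_ [->|->|[k <-]]]; rewrite ?lexx ?ler01//.
  by have /andP[k0 k1] := atom01 k; rewrite !ltW.
have /andP[p0 _] := h01 _ hp; have /andP[_ q1] := h01 _ hq.
have [I LI sub] : exists2 I, linearity_intervals C I & `[p.1, q.1] `<=` I.
  apply: linearity_interval_extend => //.
  by exists a, b => z; rewrite /= in_itv/=; exact: CE.
have [s [t [s0 st t1 IE]]] := linearity_interval_itv x xreg I LI.
have sp : s <= p.1.
  have : I p.1 by apply: sub; rewrite /= in_itv/= lexx ltW.
  by rewrite IE/= in_itv/= => /andP[].
have qt : q.1 <= t.
  have : I q.1 by apply: sub; rewrite /= in_itv/= lexx ltW.
  by rewrite IE/= in_itv/= => /andP[].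
have CI r : s <= r <= t -> C r = a * r + b.
  have [_ _ _ [a' [b' h]] _] := LI; move=> rst.
  have inI z : s <= z <= t -> I z by move=> zst; rewrite IE /= in_itv.
  have [ea eb] : a' = a /\ b' = b.
    have pI : p.1 <= p.1 <= q.1 by rewrite lexx ltW.
    have qI : p.1 <= q.1 <= q.1 by rewrite lexx ltW.
    apply: (affine_coef_unique a' b' a b p.1 q.1 pq).
      by rewrite -CE// -h//; apply: inI; rewrite sp (le_trans (ltW pq)).
    by rewrite -CE// -h//; apply: inI; rewrite qt (le_trans sp) ?ltW.
  by rewrite -ea -eb; apply/h/inI.
have sN0 : s != 0.
  apply/eqP => sE; have := CI s; rewrite lexx ltW// => /(_ isT).
  by rewrite sE lcm0// mulr0 add0r; lra.
have tN1 : t != 1.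
  apply/eqP => tE; have := CI t; rewrite lexx ltW// => /(_ isT).
  by rewrite tE lcm1// mulr1; lra.
have s00 : 0 < s by rewrite lt_neqAle eq_sym sN0.
have t11 : t < 1 by rewrite lt_neqAle tN1.
have LI' : linearity_intervals C `[s, t]%classic by rewrite -IE.
have s01 : 0 < s < 1 by apply/andP; split; lra.
have t01 : 0 < t < 1 by apply/andP; split; lra.
have [k kE] := linearity_interval_endpoint x xreg s t s LI' st s01 (or_introl erefl).
have [l lE'] := linearity_interval_endpoint x xreg s t t LI' st t01 (or_intror erefl).
(* The maximal interval may extend beyond the chord from [p] to [q]. Its end atoms lie on the line
   through [p] and [q], whereas atoms outside both sets lie strictly below it. *)
exists s, t; split => //.
- rewrite -kE; apply: contrapT => kN1.
  have kN2 : ~ B2 (x k) by apply: B12; rewrite kE/=; lra.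
  have := below k p q pB1 qB2 kN1 kN2.
  by rewrite kE lE/= CI ?lexx ?(ltW st)// ltxx.
- rewrite -lE'; apply: contrapT => lN2.
  have lN1 : ~ B1 (x l) by apply: B21; rewrite lE'/=; lra.
  have := below l p q pB1 qB2 lN1 lN2.
  by rewrite lE' lE/= CI ?lexx ?(ltW st)// ltxx.
Qed.

End inner_edges.

(** * Integration over pairs of atoms *)

Ltac measurable_real :=
  lazymatch goal with
  | |- measurable_fun _ (fun z => (@?f z)%:E) => apply/measurable_EFinP; measurable_real
  | |- measurable_fun _ (fun z => z) => exact: measurable_id
  | |- measurable_fun _ id => exact: measurable_id
  | |- measurable_fun _ fst => exact: measurable_fst
  | |- measurable_fun _ snd => exact: measurable_snd
  | |- measurable_fun _ (fun _ => ?c) => exact: measurable_cst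
  | |- measurable_fun _ (fun z => fst (@?f z)) =>
      apply: (measurableT_comp measurable_fst); measurable_real
  | |- measurable_fun _ (fun z => snd (@?f z)) =>
      apply: (measurableT_comp measurable_snd); measurable_real
  | |- measurable_fun _ (fun z => @?f z + @?g z) => apply: measurable_funD; measurable_real
  | |- measurable_fun _ (fun z => - @?f z) =>
      apply: (measurableT_comp (@oppr_measurable _ setT)); measurable_real
  | |- measurable_fun _ (fun z => @?f z * @?g z) => apply: measurable_funM; measurable_real
  | |- measurable_fun _ (fun z => @?f z ^+ ?n) => apply: measurable_funX; measurable_real
  | |- measurable_fun _ (fun z => (@?f z)^-1) => apply: measurable_funV; measurable_real
  | |- measurable_fun _ (fun z => (@?f z) `^ ?a) =>
      apply: (measurableT_comp (measurable_powR a)); measurable_real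
  | |- measurable_fun _ (fun z => expR (@?f z)) =>
      apply: (measurableT_comp (@measurable_expR _)); measurable_real
  | |- measurable_fun _ (fun z => ln (@?f z)) =>
      apply: (measurableT_comp (@measurable_ln _)); measurable_real
  | |- measurable_fun _ (fun z => (nat_of_bool (@?f z))%:R) =>
      apply: measurable_fun_bool_natr; measurable_real
  | |- measurable_fun _ (fun z => @?f z && @?g z) => apply: measurable_and; measurable_real
  | |- measurable_fun _ (fun z => @Order.lt _ _ (@?f z) (@?g z)) =>
      apply: measurable_fun_ltr; measurable_real
  | |- measurable_fun _ (fun z => @Order.le _ _ (@?f z) (@?g z)) =>
      apply: measurable_fun_ler; measurable_real
  | |- measurable_fun _ (fun z => @?f z == @?g z) =>
      apply: measurable_fun_eqr; measurable_real
  | |- measurable_fun _ (fun z => ~~ @?f z) =>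
      apply: measurable_neg; measurable_real
  | |- _ => idtac
  end.

Section tonelli.
Context d1 d2 (T1 : measurableType d1) (T2 : measurableType d2) (R : realType).
Variables (m1 : {sigma_finite_measure set T1 -> \bar R})
          (m2 : {sigma_finite_measure set T2 -> \bar R}).
Variable f : T1 -> T2 -> \bar R.
Hypothesis mf : measurable_fun setT (fun z : T1 * T2 => f z.1 z.2).
Hypothesis f0 : forall x y, (0 <= f x y)%E.

Lemma tonelli_swap :
  (\int[m1]_x \int[m2]_y f x y = \int[m2]_y \int[m1]_x f x y)%E.
Proof. exact: (fubini_tonelli (fun z => f z.1 z.2) mf (fun z => f0 z.1 z.2)). Qed.

Lemma measurable_integral_r : measurable_fun setT (fun x => \int[m2]_y f x y)%E.
Proof. exact: (measurable_fun_fubini_tonelli_F (fun z => f z.1 z.2) mf (fun z => f0 z.1 z.2)). Qed.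

Lemma measurable_integral_l : measurable_fun setT (fun y => \int[m1]_x f x y)%E.
Proof. exact: (measurable_fun_fubini_tonelli_G (fun z => f z.1 z.2) mf (fun z => f0 z.1 z.2)). Qed.

Lemma measurable_section_r x : measurable_fun setT (f x).
Proof. exact: (measurableT_comp mf (measurable_pair1 x)). Qed.

Lemma measurable_section_l y : measurable_fun setT (f ^~ y).
Proof. exact: (measurableT_comp mf (measurable_pair2 y)). Qed.
End tonelli.
Arguments tonelli_swap {d1 d2 T1 T2 R} m1 m2 f.
Arguments measurable_integral_r {d1 d2 T1 T2 R} m2 f.
Arguments measurable_integral_l {d1 d2 T1 T2 R} m1 f.
Arguments measurable_section_r {d1 d2 T1 T2 R} f.
Arguments measurable_section_l {d1 d2 T1 T2 R} f.

Section product_sigma_finite.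
Context d1 d2 (T1 : measurableType d1) (T2 : measurableType d2) (R : realType).
Variables (m1 : {sigma_finite_measure set T1 -> \bar R})
          (m2 : {sigma_finite_measure set T2 -> \bar R}).

Definition product_sigma_finite : set (T1 * T2) -> \bar R := (m1 \x m2)%E.

HB.instance Definition _ := Measure.on product_sigma_finite.

Let product_sigma_finite_setT : sigma_finite setT product_sigma_finite.
Proof.
have /sigma_finiteP[F [TF ndF Foo]] := sigma_finiteT m1.
have /sigma_finiteP[G [TG ndG Goo]] := sigma_finiteT m2.
exists (fun n => F n `*` G n).
  rewrite -setXTT TF TG predeqE => -[x y]; split.
    move=> [/= [n _ Fnx] [k _ Gky]]; exists (maxn n k) => //; split.
    - by move: x Fnx; exact/subsetPset/ndF/leq_maxl.
    - by move: y Gky; exact/subsetPset/ndG/leq_maxr.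
  by move=> [n _ []/= ? ?]; split; exists n.
move=> k; have [mF Fk] := Foo k; have [mG Gk] := Goo k.
split; first exact: measurableX.
by rewrite [ltLHS]product_measure1E// lte_mul_pinfty// ge0_fin_numE.
Qed.

HB.instance Definition _ := Measure_isSigmaFinite.Build _ _ _ product_sigma_finite
  product_sigma_finite_setT.

Lemma product_tonelli (f : T1 * T2 -> \bar R) : measurable_fun setT f ->
  (forall z, 0 <= f z)%E ->
  (\int[product_sigma_finite]_z f z = \int[m1]_x \int[m2]_y f (x, y))%E.
Proof. exact: fubini_tonelli1. Qed.
End product_sigma_finite.
(* [m1 \x m2] itself has no canonical structure of sigma-finite measure. *)
Arguments product_sigma_finite {d1 d2 T1 T2 R}.
Arguments product_tonelli {d1 d2 T1 T2 R} m1 m2 f.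

Lemma ge0_integralZl_setT d (T : measurableType d) (R : realType)
    (m : {measure set T -> \bar R}) (k : R) (f : T -> \bar R) :
  0 <= k -> measurable_fun setT f -> (forall x, 0 <= f x)%E ->
  (\int[m]_x (k%:E * f x) = k%:E * \int[m]_x f x)%E.
Proof. by move=> k0 mf f0; apply: ge0_integralZl. Qed.

Section chord_substitution.
Context {R : realType}.
Local Notation mu := (@lebesgue_measure R).

(* [a] and [b] are the heights over 0 and 1 of the line through
   [(u1, v1)] and [(u2, v2)]. *)
Lemma chord_substitution (u1 u2 : R) (F : R -> R -> \bar R) : u1 < u2 -> u2 < 1 ->
  measurable_fun setT (fun z : R * R => F z.1 z.2) -> (forall x y, 0 <= F x y)%E ->
  (\int[mu]_v1 \int[mu]_v2 F v1 v2 = (u2 - u1)%:E *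
   \int[mu]_a \int[mu]_b F (a * (1 - u1) + b * u1)%R (a * (1 - u2) + b * u2)%R)%E.
Proof.
move=> u12 u21 mF F0; have d1 : 0 < 1 - u1 by lra.
(* Two affine substitutions in one variable: first v2 is replaced by the height [b] over 1, at fixed
   v1, with factor [c]; then v1 by the height [a] over 0, at fixed [b], with factor 1 - u1. The
   product of the factors is u2 - u1. *)
pose c := (u2 - u1) / (1 - u1); have c0 : 0 < c by rewrite divr_gt0// subr_gt0.
have cE : (c%:E * (1 - u1)%:E = (u2 - u1)%:E)%E by rewrite -EFinM divfK// gt_eqF.
have mG (f g : R * R -> R) : measurable_fun setT f -> measurable_fun setT g ->
    measurable_fun setT (fun z => F (f z) (g z)).
  by move=> mf mg; exact: (measurableT_comp mF (measurable_fun_pair mf mg)).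
transitivity (\int[mu]_v1 (c%:E * \int[mu]_b F v1 (c * b + v1 * (1 - c))%R))%E.
  apply: eq_integral => v _; rewrite (@ge0_integral_affine _ c (v * (1 - c)))//.
  - by rewrite gtr0_norm.
  - by rewrite gt_eqF.
  - exact: (measurable_section_r F).
have m1 : measurable_fun setT (fun z : R * R => F z.1 (c * z.2 + z.1 * (1 - c))).
  by apply: mG; measurable_real.
have mI := measurable_integral_r mu (fun v b => F v (c * b + v * (1 - c))) m1
  (fun v b => F0 _ _).
transitivity (c%:E * \int[mu]_v \int[mu]_b F v (c * b + v * (1 - c))%R)%E.
  apply: (ge0_integralZl_setT _ _ _ mu c _ (ltW c0) mI) => v.
  by apply: integral_ge0 => b _.
transitivity (c%:E * \int[mu]_b \int[mu]_v F v (c * b + v * (1 - c))%R)%E.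
  congr (_ * _)%E.
  exact: (tonelli_swap mu mu (fun v b => F v (c * b + v * (1 - c))) m1).
transitivity (c%:E * \int[mu]_b ((1 - u1)%:E *
    \int[mu]_a F (a * (1 - u1) + b * u1)%R (a * (1 - u2) + b * u2)%R))%E.
  congr (_ * _)%E; apply: eq_integral => b _.
  rewrite [LHS](@ge0_integral_affine _ (1 - u1) (b * u1))//; last 2 first.
  - by rewrite gt_eqF.
  - exact: (measurable_section_l (fun v b => F v (c * b + v * (1 - c))) m1 b).
  rewrite gtr0_norm//; congr (_ * _)%E; apply: eq_integral => a _.
  congr F; first by ring.
  by rewrite /c; field; rewrite gt_eqF.
have m2 : measurable_fun setT (fun z : R * R =>
    F (z.1 * (1 - u1) + z.2 * u1) (z.1 * (1 - u2) + z.2 * u2)).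
  by apply: mG; measurable_real.
have mI2 := measurable_integral_l mu (fun a b : R =>
  F (a * (1 - u1) + b * u1) (a * (1 - u2) + b * u2)) m2 (fun a b => F0 _ _).
transitivity (c%:E * ((1 - u1)%:E * \int[mu]_b
    \int[mu]_a F (a * (1 - u1) + b * u1)%R (a * (1 - u2) + b * u2)%R))%E.
  congr (_ * _)%E; apply: (ge0_integralZl_setT _ _ _ mu _ _ (ltW d1) mI2) => b.
  by apply: integral_ge0 => a _.
rewrite [LHS]muleA cE; congr (_ * _)%E; apply: esym.
exact: (tonelli_swap mu mu
  (fun a b => F (a * (1 - u1) + b * u1) (a * (1 - u2) + b * u2)) m2).
Qed.
End chord_substitution.

Lemma integral_support d (T : measurableType d) (R : realType)
    (mu : {measure set T -> \bar R}) (D : set T) (f : T -> \bar R) :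
  (forall x, ~ D x -> f x = 0%E) -> (\int[mu]_x f x = \int[mu]_(x in D) f x)%E.
Proof.
move=> f0; rewrite [RHS]integral_mkcond; apply: eq_integral => x _.
by rewrite patchE; case: ifPn => // /negP; rewrite inE => /f0.
Qed.

(** * Integrals along a chord *)

Section chord_moment.
Context {R : realType}.
Local Notation mu := (@lebesgue_measure R).
Implicit Types (a b u x t c : R).

Lemma ge0_FTC_cc (g F : R -> R) a b : a < b ->
  (forall x, a < x < b -> 0 <= g x) ->
  (forall x, a <= x <= b -> has_derivative F x (g x)) ->
  (forall x, a < x < b -> {for x, continuous g}) ->
  (\int[mu]_(x in `]a, b[) (g x)%:E = (F b - F a)%:E)%E.
Proof.
move=> ab g0 dF gc.
have Fc x : a <= x <= b -> F y @[y --> x] --> F x.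
  by move=> /dF/has_derivative_continuous.
rewrite (@ge0_FTC_oo _ g (fun=> 0) F a b (F b) (F a))//.
- by rewrite integral0 adde0.
- by move=> x /andP[ax xb]; rewrite subr0; apply: dF; rewrite !ltW.
- by move=> x _; exact: cvg_cst.
- by apply: cvg_at_left_filter; apply: Fc; rewrite lexx ltW.
- by apply: cvg_at_right_filter; apply: Fc; rewrite lexx ltW.
Qed.

Lemma chord_gt0 a b u : 0 < a -> 0 < b -> 0 <= u <= 1 -> 0 < a * (1 - u) + b * u.
Proof.
move=> a0 b0 /andP[u0 u1]; have [->|un0] := eqVneq u 0.
  by rewrite subr0 mulr1 mulr0 addr0.
have up : 0 < u by rewrite lt_neqAle eq_sym un0.
by rewrite ltr_wpDl// ?mulr_gt0// mulr_ge0// ?subr_ge0// ltW.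
Qed.

Variable alpha : R.
Hypothesis alpha01 : 0 < alpha < 1.
Let alpha0 : 0 < alpha. Proof. by case/andP: alpha01. Qed.
Let beta0 : 0 < 1 - alpha. Proof. by case/andP: alpha01 => ? ?; rewrite subr_gt0. Qed.

Let powRN1 x z : 0 < x -> x `^ (z - 1) * x = x `^ z.
Proof.
by move=> x0; rewrite -{2}(powRr1 (ltW x0)) -powRD ?(gt_eqF x0) ?implybT// subrK.
Qed.

Let has_derivative_chord a b u : has_derivative (fun v => a * (1 - v) + b * v) u (b - a).
Proof. by apply: has_derivative_eq; [derive|rewrite /=; ring]. Qed.

Let has_derivative_chord_powR a b u z : 0 < a -> 0 < b -> 0 <= u <= 1 ->
  has_derivative (fun v => (a * (1 - v) + b * v) `^ z) u
    (z * (a * (1 - u) + b * u) `^ (z - 1) * (b - a)).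
Proof.
move=> a0 b0 u01; apply: (has_derivative_powR_comp (fun v => a * (1 - v) + b * v)).
  exact: chord_gt0.
exact: has_derivative_chord.
Qed.

Lemma integral_chord_inner a b u : 0 < a -> 0 < b -> a != b -> 0 < u < 1 ->
  (\int[mu]_(v in `]u, 1%R[) ((v - u) * (a * (1 - v) + b * v) `^ (- (alpha + 1)))%:E
   = ((alpha * b `^ (1 - alpha) + (1 - alpha) * (a * (1 - u) + b * u) * b `^ (- alpha)
       - (a * (1 - u) + b * u) `^ (1 - alpha))
      / (alpha * (1 - alpha) * (b - a) ^+ 2))%:E)%E.
Proof.
move=> a0 b0 ab /andP[u0 u1]; have m0 : b - a != 0 by rewrite subr_eq0 eq_sym.
pose L v := a * (1 - v) + b * v.
pose F v := - ((v - u) * L v `^ (- alpha)) / (alpha * (b - a))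
  + L v `^ (1 - alpha) / (alpha * (1 - alpha) * (b - a) ^+ 2).
have N1 : 1 - alpha - 1 = - alpha by ring.
have N2 : - alpha - 1 = - (alpha + 1) by ring.
rewrite (@ge0_FTC_cc (fun v => (v - u) * L v `^ (- (alpha + 1))) F)//.
- congr EFin; rewrite /F subrr mul0r oppr0 mul0r add0r.
  have -> : L 1 = b by rewrite /L; ring.
  have -> : L u = a * (1 - u) + b * u by [].
  have := powRN1 b (1 - alpha) b0; rewrite N1 => <-.
  by field; rewrite m0 !gt_eqF.
- by move=> v /andP[uv v1]; rewrite mulr_ge0 ?powR_ge0// subr_ge0 ltW.
- move=> v /andP[uv v1]; have v01 : 0 <= v <= 1 by apply/andP; split; lra.
  have Lv : 0 < L v by exact: chord_gt0.
  have h1 : has_derivative (fun v => L v `^ (- alpha)) v _ :=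
    has_derivative_chord_powR a b v (- alpha) a0 b0 v01.
  have h2 : has_derivative (fun v => L v `^ (1 - alpha)) v _ :=
    has_derivative_chord_powR a b v (1 - alpha) a0 b0 v01.
  have h0 : has_derivative (fun v => v - u) v (1 - 0).
    by apply: has_derivativeB; [exact: has_derivative_id|exact: has_derivative_cst].
  apply: has_derivative_eq.
    apply: has_derivativeD; apply: has_derivativeM.
    - by apply: has_derivativeN; apply: (has_derivativeM _ _ _ _ _ h0 h1).
    - exact: has_derivative_cst.
    - exact: h2.
    - exact: has_derivative_cst.
  rewrite -/(L v) N1 N2 -(powRN1 (L v) (- alpha) Lv) N2 /=.
  by field; rewrite m0 !gt_eqF.
- move=> v /andP[uv v1]; have v01 : 0 <= v <= 1 by apply/andP; split; lra.
  apply: (has_derivative_continuous _ _ _).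
  apply: has_derivativeM; last exact: (has_derivative_chord_powR a b v _ a0 b0 v01).
  by derive.
Qed.

(** For a and b distinct, the integral over 0 < u < v < 1 of (v - u) (L(u) L(v))^(- alpha - 1),
    where L is affine from a to b. The factor v - u is the Jacobian of [chord_substitution]. *)
Definition chord_moment a b : R :=
  (b `^ (1 - alpha) * a `^ (- alpha) - a `^ (1 - alpha) * b `^ (- alpha)
   - (powR_primitive (1 - alpha) b - powR_primitive (1 - alpha) a))
  / (alpha * (1 - alpha) * (b - a) ^+ 3).

Lemma integral_chord_outer a b : 0 < a -> 0 < b -> a != b ->
  (\int[mu]_(u in `]0%R, 1%R[) ((a * (1 - u) + b * u) `^ (- (alpha + 1)) *
     ((alpha * b `^ (1 - alpha) + (1 - alpha) * (a * (1 - u) + b * u) * b `^ (- alpha)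
       - (a * (1 - u) + b * u) `^ (1 - alpha))
      / (alpha * (1 - alpha) * (b - a) ^+ 2)))%:E
   = (chord_moment a b)%:E)%E.
Proof.
move=> a0 b0 ab; have m0 : b - a != 0 by rewrite subr_eq0 eq_sym.
pose L v := a * (1 - v) + b * v.
pose F v := (- (b `^ (1 - alpha) * L v `^ (- alpha)) + b `^ (- alpha) * L v `^ (1 - alpha)
  - powR_primitive (1 - alpha) (L v)) / (alpha * (1 - alpha) * (b - a) ^+ 3).
have N1 : 1 - alpha - 1 = - alpha by ring.
have N2 : - alpha - 1 = - (alpha + 1) by ring.
pose g u := L u `^ (- (alpha + 1)) * ((alpha * b `^ (1 - alpha)
  + (1 - alpha) * L u * b `^ (- alpha) - L u `^ (1 - alpha))
      / (alpha * (1 - alpha) * (b - a) ^+ 2)).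
rewrite (@ge0_FTC_cc g F 0 1)//.
- congr EFin; rewrite /F.
  have -> : L 1 = b by rewrite /L; ring.
  have -> : L 0 = a by rewrite /L; ring.
  by rewrite /chord_moment; field; rewrite m0 !gt_eqF.
- move=> u u01; rewrite mulr_ge0 ?powR_ge0// -lee_fin -integral_chord_inner//.
  apply: integral_ge0 => v; rewrite /= in_itv/= => /andP[uv _].
  by rewrite lee_fin mulr_ge0 ?powR_ge0// subr_ge0 ltW.
- move=> v v01; have Lv : 0 < L v by exact: chord_gt0.
  have h1 : has_derivative (fun v => L v `^ (- alpha)) v _ :=
    has_derivative_chord_powR a b v (- alpha) a0 b0 v01.
  have h2 : has_derivative (fun v => L v `^ (1 - alpha)) v _ :=
    has_derivative_chord_powR a b v (1 - alpha) a0 b0 v01.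
  have h3 : has_derivative (powR_primitive (1 - alpha) \o L) v _ :=
    is_derive1_comp (has_derivative_powR_primitive (1 - alpha) (L v) Lv)
      (has_derivative_chord a b v).
  apply: has_derivative_eq.
    apply: has_derivativeM; last exact: has_derivative_cst.
    apply: has_derivativeB; last exact: h3.
    apply: has_derivativeD.
      by apply: has_derivativeN; apply: has_derivativeM; [exact: has_derivative_cst|exact: h1].
    by apply: has_derivativeM; [exact: has_derivative_cst|exact: h2].
  rewrite -/(L v) N1 N2 /g.
  have -> : L v `^ (2 * (1 - alpha) - 2) = L v `^ (- (alpha + 1)) * L v `^ (1 - alpha).
    by rewrite -powRD ?(gt_eqF Lv) ?implybT//; congr powR; ring.
  have := powRN1 (L v) (- alpha) Lv; rewrite N2 => <-.
  by field; rewrite m0 !gt_eqF.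
- move=> v /andP[v0 v1]; have v01 : 0 <= v <= 1 by rewrite !ltW.
  apply: (has_derivative_continuous _ _ _); apply: has_derivativeM.
    exact: (has_derivative_chord_powR a b v _ a0 b0 v01).
  apply: has_derivativeM; last exact: has_derivative_cst.
  apply: has_derivativeB; last exact: (has_derivative_chord_powR a b v _ a0 b0 v01).
  by rewrite /L; derive.
Qed.

Lemma integral_chord_moment a b : 0 < a -> 0 < b -> a != b ->
  (\int[mu]_u \int[mu]_v ([&& 0%R < u, u < v & v < 1%R]%:R * ((v - u) *
     ((a * (1 - u) + b * u) * (a * (1 - v) + b * v)) `^ (- (alpha + 1))))%R%:E
   = (chord_moment a b)%:E)%E.
Proof.
move=> a0 b0 ab.
rewrite (@integral_support _ _ _ mu `]0, 1[%classic); last first.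
  move=> u /negP; rewrite /= in_itv/= negb_and => h.
  rewrite integral0_eq// => v _; apply/eqP; rewrite eqe mulf_eq0 pnatr_eq0 eqb0.
  apply/orP; left; apply/negP => /and3P[u0 uv v1].
  by move: h; rewrite u0 (lt_trans uv).
rewrite -integral_chord_outer//; apply: eq_integral => u; rewrite inE/= in_itv/= => u01.
have /andP[u0 u1] := u01.
have Lu : 0 < a * (1 - u) + b * u by apply: chord_gt0 => //; rewrite !ltW.
rewrite (@integral_support _ _ _ mu `]u, 1[%classic); last first.
  move=> v /negP; rewrite /= in_itv/= => h; rewrite u0/= (negbTE h) mul0r//.
transitivity (\int[mu]_(v in `]u, 1%R[) (((a * (1 - u) + b * u) `^ (- (alpha + 1)))%:E *
    ((v - u) * (a * (1 - v) + b * v) `^ (- (alpha + 1)))%:E))%E.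
  apply: eq_integral => v; rewrite inE/= in_itv/= => /andP[uv v1].
  rewrite u0 uv v1/= mul1r -EFinM; congr EFin; rewrite powRM; first ring.
    exact: ltW.
  by apply/ltW/chord_gt0 => //; apply/andP; split; lra.
rewrite ge0_integralZl//=.
- by rewrite integral_chord_inner// -EFinM.
- by apply: measurable_funTS; measurable_real.
- move=> v; rewrite in_itv/= => /andP[uv v1].
  by rewrite lee_fin mulr_ge0 ?powR_ge0// subr_ge0 ltW.
- by rewrite lee_fin powR_ge0.
Qed.

Definition line_mass a b : R :=
  if a == b then a `^ (- alpha)
  else (b `^ (1 - alpha) - a `^ (1 - alpha)) / ((1 - alpha) * (b - a)).

Lemma line_massC a b : line_mass a b = line_mass b a.
Proof.
rewrite /line_mass eq_sym; case: eqVneq => [->//|ab].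
by rewrite -(opprB b a) mulrN invrN mulrN -mulNr opprB.
Qed.

Lemma chord_momentC a b : chord_moment a b = chord_moment b a.
Proof.
have [->//|ab] := eqVneq a b; rewrite /chord_moment.
have -> : (a - b) ^+ 3 = - (b - a) ^+ 3 by ring.
by rewrite mulrN invrN mulrN -mulNr; congr (_ / _); ring.
Qed.

Lemma integral_line_mass a b : 0 < a -> 0 < b ->
  (\int[mu]_(u in `]0%R, 1%R[) ((a * (1 - u) + b * u) `^ (- alpha))%:E
   = (line_mass a b)%:E)%E.
Proof.
move=> a0 b0; rewrite /line_mass; case: eqVneq => [<-|ab].
  under eq_integral do rewrite -mulrDr subrK mulr1.
  rewrite integral_cst//= lebesgue_measure_itv/= lte_fin ltr01.
  by rewrite -EFinB subr0 mule1.
have m0 : b - a != 0 by rewrite subr_eq0 eq_sym.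
pose F u := (a * (1 - u) + b * u) `^ (1 - alpha) / ((1 - alpha) * (b - a)).
rewrite (@ge0_FTC_cc (fun u => (a * (1 - u) + b * u) `^ (- alpha)) F 0 1)//.
- congr EFin; rewrite /F subrr !mulr0 !addr0 subr0 !mulr1 add0r.
  by rewrite -mulrBl.
- by move=> *; exact: powR_ge0.
- move=> u u01; apply: has_derivative_eq.
    apply: has_derivativeM; last exact: has_derivative_cst.
    exact: (has_derivative_chord_powR a b u _ a0 b0 u01).
  have -> : 1 - alpha - 1 = - alpha by ring.
  by field; rewrite m0 gt_eqF.
- move=> u /andP[u0 u1]; have u01 : 0 <= u <= 1 by rewrite !ltW.
  exact: (has_derivative_continuous _ _ _ (has_derivative_chord_powR a b u _ a0 b0 u01)).
Qed.

Lemma line_massZ a x : 0 < a -> 1 < x -> line_mass a (a * x) =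
  a `^ (- alpha) * ((x `^ (1 - alpha) - 1) / ((1 - alpha) * (x - 1))).
Proof.
move=> a0 x1; have x0 : 0 < x by lra.
have -> : line_mass a (a * x) = ((a * x) `^ (1 - alpha) - a `^ (1 - alpha)) / ((1 - alpha) * (a * x - a)).
  by rewrite /line_mass lt_eqF// ltr_pMr.
rewrite powRM ?(ltW a0) ?(ltW x0)//.
have -> : a `^ (1 - alpha) = a * a `^ (- alpha).
  by rewrite -{2}(powRr1 (ltW a0)) -powRD ?(gt_eqF a0) ?implybT.
by field; rewrite subr_eq0 !gt_eqF// subr_gt0 ltr_pMr.
Qed.

(** Homogeneity of degree - 2 alpha - 2 separates the scale [a] from the ratio [x] of the heights;
    the factor depending on the ratio is where [edge_numerator] originates. *)
Lemma chord_momentZ a x : 0 < a -> 1 < x -> chord_moment a (a * x) =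
  a `^ (- 2 * alpha - 2) * (edge_numerator (1 - alpha) x
    / (alpha * (1 - alpha) * (x - 1) ^+ 3)).
Proof.
move=> a0 x1; have x0 : 0 < x by lra.
have a0' : a != 0 by rewrite gt_eqF.
rewrite /chord_moment !powRM ?(ltW a0) ?(ltW x0)//.
have -> : a `^ (- 2 * alpha - 2) = a `^ (1 - 2 * alpha) / a ^+ 3.
  by rewrite -powR_mulrn ?(ltW a0)// -powRN -powRD ?a0' ?implybT//; congr powR; lra.
have -> : powR_primitive (1 - alpha) (a * x) - powR_primitive (1 - alpha) a =
    a `^ (1 - 2 * alpha) * powR_primitive (1 - alpha) x.
  rewrite /powR_primitive; case: eqVneq => [ah|ah].
    have -> : 1 - 2 * alpha = 0 by lra.
    by rewrite powRr0 lnM ?posrE//; ring.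
  have -> : 2 * (1 - alpha) - 1 = 1 - 2 * alpha by ring.
  rewrite powRM ?(ltW a0) ?(ltW x0)//.
  have : 1 - 2 * alpha != 0 by apply: contra ah => /eqP h; apply/eqP; lra.
  by move=> h; field.
have E : a `^ (1 - alpha) * a `^ (- alpha) = a `^ (1 - 2 * alpha).
  by rewrite -powRD ?a0' ?implybT//; congr powR; lra.
rewrite /edge_numerator; have -> : 1 - alpha - 1 = - alpha by ring.
rewrite -E; have -> : a * x - a = a * (x - 1) by ring.
by field; rewrite a0' subr_eq0 !gt_eqF.
Qed.

Lemma cvg_powR0 (z : R) : 0 < z -> x `^ z @[x --> 0^'+] --> (0 : R).
Proof.
move=> z0; apply/cvgr0Pnorm_lt => e e0.
have e1 : 0 < e `^ z^-1 by rewrite powR_gt0.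
near=> x; have x0 : 0 < x by [].
rewrite ger0_norm ?powR_ge0//.
have -> : e = (e `^ z^-1) `^ z by rewrite -powRrM mulVf ?gt_eqF// powRr1// ltW.
rewrite gt0_ltr_powR ?nnegrE ?powR_ge0 ?(ltW x0)//.
Unshelve. all: by end_near. Qed.

Lemma integral_scale c : 0 < c ->
  (\int[mu]_(a in `]0%R, +oo[) (a `^ (- 2 * alpha - 1) * expR (- (c * a `^ (- alpha))))%:E
   = ((alpha * c ^+ 2)^-1)%:E)%E.
Proof.
move=> c0; pose g a := a `^ (- 2 * alpha - 1) * expR (- (c * a `^ (- alpha))).
(* In the variable y = c a^(- alpha) the integrand is a multiple of y exp(- y), with primitive - (1
   + y) exp(- y); [F] has the opposite sign because y decreases in [a]. *)
pose F a := (1 + c * a `^ (- alpha)) * expR (- (c * a `^ (- alpha))) / (alpha * c ^+ 2).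
have hp z x : 0 < x -> has_derivative (fun a => a `^ z) x (z * x `^ (z - 1) * 1).
  move=> x0; apply: (has_derivative_powR_comp (fun a => a)) => //.
  exact: has_derivative_id.
have he x (x0 : 0 < x) := has_derivative_expR_comp _ _ _ (has_derivativeN _ _ _
    (has_derivativeM _ _ _ _ _ (has_derivative_cst x c) (hp (- alpha) x x0))).
rewrite (@ge0_FTC_ray _ g (fun=> 0) F 0 ((alpha * c ^+ 2)^-1) 0)//.
- by rewrite integral0 adde0 subr0.
- by move=> x x0; rewrite mulr_ge0 ?powR_ge0 ?expR_ge0.
- move=> x x0; rewrite subr0; apply: has_derivative_eq.
    apply: has_derivativeM; last exact: has_derivative_cst.
    apply: has_derivativeM; last exact: (he x x0).
    apply: has_derivativeD; first exact: has_derivative_cst.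
    by apply: has_derivativeM; [exact: has_derivative_cst|exact: (hp (- alpha) x x0)].
  rewrite /g.
  have -> : x `^ (- 2 * alpha - 1) = x `^ (- alpha) * x `^ (- alpha - 1).
    by rewrite -powRD ?(gt_eqF x0) ?implybT//; congr powR; lra.
  by field; rewrite !gt_eqF.
- move=> x x0; apply: (has_derivative_continuous _ _ _).
  by apply: has_derivativeM; [exact: (hp _ x x0)|exact: (he x x0)].
- by move=> x _; exact: cvg_cst.
- rewrite -[X in _ --> X]mul1r; apply: cvgM; last exact: cvg_cst.
  have h : c * x `^ (- alpha) @[x --> +oo] --> (0 : R).
    rewrite -[X in _ --> X](mulr0 c); apply: cvgM; first exact: cvg_cst.
    exact: cvg_powRN.
  rewrite -[X in _ --> X]mul1r; apply: cvgM.
    by rewrite -[X in _ --> X]addr0; apply: cvgD => //; exact: cvg_cst.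
  rewrite -expR0 -oppr0.
  exact: (cvg_comp (fun x => - (c * x `^ (- alpha))) expR (cvgN h) (@continuous_expR _ _)).
- rewrite -[X in _ --> X](mul0r (alpha * c ^+ 2)^-1); apply: cvgM; last exact: cvg_cst.
  (* With y = c x^(- alpha) this is 4/y, an upper bound of (1 + y) exp(- y) that follows from exp(y)
     >= (1 + y/2)^2. *)
  have h : 4 / c * x `^ alpha @[x --> 0^'+] --> (0 : R).
    rewrite -[X in _ --> X](mulr0 (4 / c)); apply: cvgM; first exact: cvg_cst.
    exact: cvg_powR0.
  apply: (squeeze_cvgr _ (cvg_cst 0) h); near=> x.
  have x0 : 0 < x by [].
  have y0 : 0 < c * x `^ (- alpha) by rewrite mulr_gt0// powR_gt0.
  have -> : 4 / c * x `^ alpha = 4 / (c * x `^ (- alpha)).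
    by rewrite powRN; field; rewrite !gt_eqF// powR_gt0.
  move: y0; move: (c * x `^ (- alpha)) => y y0.
  rewrite mulr_ge0 ?expR_ge0 ?addr_ge0 ?ler01 ?(ltW y0)//=.
  rewrite ler_pdivlMr// expRN.
  have h2 : 1 + y / 2 <= expR (y / 2) by exact: expR_ge1Dx.
  have -> : expR y = expR (y / 2) ^+ 2.
    by rewrite expr2 -expRD; congr expR; field.
  rewrite mulrAC ler_pdivrMr ?exprn_gt0 ?expR_gt0//.
  have h3 : (1 + y / 2) ^+ 2 <= expR (y / 2) ^+ 2.
    by rewrite ler_sqr ?nnegrE ?expR_ge0//; lra.
  by nra.
Unshelve. all: by end_near. Qed.

End chord_moment.

(** * The mean number of edges as a double integral *)

Section edge_kernel.
Context {R : realType}.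
Local Notation mu := (@lebesgue_measure R).
Local Notation mu2 := (product_sigma_finite mu mu).
Implicit Types (a b u v t c x y : R) (p q : R * R).

Lemma tonelli4 (k : R * R -> R * R -> \bar R) :
  measurable_fun setT (fun z : (R * R) * (R * R) => k z.1 z.2) ->
  (forall p q, 0 <= k p q)%E ->
  (\int[mu2]_p \int[mu2]_q k p q
   = \int[mu]_u \int[mu]_u' \int[mu]_v \int[mu]_v' k (u, u') (v, v'))%E.
Proof.
move=> mk k0; pose G p := (\int[mu2]_q k p q)%E.
have mG : measurable_fun setT G by exact: (measurable_integral_r mu2 k mk k0).
have G0 p : (0 <= G p)%E by exact: integral_ge0.
rewrite (product_tonelli mu mu G mG G0).
apply: eq_integral => u _; apply: eq_integral => u' _.
have mk' := measurable_section_r k mk (u, u').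
exact: (product_tonelli mu mu (k (u, u')) mk' (k0 (u, u'))).
Qed.

Lemma measurable_line_mass alpha d (T : measurableType d) (f g : T -> R) :
  measurable_fun setT f -> measurable_fun setT g ->
  measurable_fun setT (fun z => line_mass alpha (f z) (g z)).
Proof.
move=> mf mg; apply: measurable_fun_ifT; measurable_real => //.
Qed.

(** At [t = 1] this is the density of pairs of atoms spanning an edge. The other values of [t]
    absorb the inaccuracy of the heights in the discretization. *)
Definition edge_kernel alpha t p q : R :=
  [&& 0 < p.1, p.1 < q.1, q.1 < 1, 0 < p.2, 0 < q.2,
      0 < line_at p q 0 & 0 < line_at p q 1]%:R *
  (alpha ^+ 2 * (p.2 * q.2) `^ (- (alpha + 1)) *
   expR (- (t * line_mass alpha (line_at p q 0) (line_at p q 1)))).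

Lemma edge_kernel_ge0 alpha t p q : 0 <= edge_kernel alpha t p q.
Proof.
rewrite /edge_kernel; have := sqr_ge0 alpha; move: (alpha ^+ 2) => c c0.
by rewrite !mulr_ge0 ?powR_ge0 ?expR_ge0.
Qed.

Lemma measurable_edge_kernel alpha t d (T : measurableType d) (f g : T -> R * R) :
  measurable_fun setT f -> measurable_fun setT g ->
  measurable_fun setT (fun z => edge_kernel alpha t (f z) (g z)).
Proof.
move=> mf mg; rewrite /edge_kernel /line_at; measurable_real => //.
apply: measurable_line_mass; measurable_real => //.
Qed.

Variable alpha : R.
Hypothesis alpha01 : 0 < alpha < 1.
Let alpha0 : 0 < alpha. Proof. by case/andP: alpha01. Qed.
Let beta0 : 0 < 1 - alpha. Proof. by case/andP: alpha01 => ? ?; rewrite subr_gt0. Qed.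
Let b01 : 0 < 1 - alpha < 1. Proof. by rewrite beta0/= ltrBlDr ltrDl. Qed.

Let kernel_uv t u v a b : R :=
  [&& 0 < u, u < v & v < 1]%:R * ((v - u) *
     ((a * (1 - u) + b * u) * (a * (1 - v) + b * v)) `^ (- (alpha + 1))) *
  ([&& 0 < a & 0 < b]%:R * (alpha ^+ 2 * expR (- (t * line_mass alpha a b)))).

Let kernel_uv_ge0 t u v a b : 0 <= kernel_uv t u v a b.
Proof.
rewrite /kernel_uv; case: and3P => [[_ uv _]|_]; last by rewrite !mul0r.
by rewrite !mulr_ge0 ?powR_ge0 ?expR_ge0 ?(ltW alpha0)// subr_ge0 ltW.
Qed.

Let measurable_kernel_uv t d (T : measurableType d) (f g h k : T -> R) :
  measurable_fun setT f -> measurable_fun setT g ->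
  measurable_fun setT h -> measurable_fun setT k ->
  measurable_fun setT (fun z => kernel_uv t (f z) (g z) (h z) (k z)).
Proof.
move=> mf mg mh mk; rewrite /kernel_uv; measurable_real => //.
exact: measurable_line_mass.
Qed.

Let line_at_chord u v a b c : u < v ->
  line_at (u, a * (1 - u) + b * u) (v, a * (1 - v) + b * v) c = a * (1 - c) + b * c.
Proof. by move=> uv; rewrite /line_at/=; field; rewrite subr_eq0 gt_eqF. Qed.

Let integral_edge_kernel_chord t u v :
  (\int[mu]_x \int[mu]_y (edge_kernel alpha t (u, x) (v, y))%:E
   = \int[mu]_a \int[mu]_b (kernel_uv t u v a b)%:E)%E.
Proof.
have [/and3P[u0 uv v1]|h] := boolP [&& 0 < u, u < v & v < 1]; last first.
  rewrite !integral0_eq// => a _; rewrite integral0_eq// => b _.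
    by rewrite /kernel_uv (negbTE h) !mul0r.
  rewrite /edge_kernel/=; case: and3P h => //= h.
  by case: andP => [[h1 /and3P[h2 h3 _]]|]; [case: h|rewrite mul0r].
have mk : measurable_fun setT (fun z : R * R => (edge_kernel alpha t (u, z.1) (v, z.2))%:E).
  by apply/measurable_EFinP; apply: measurable_edge_kernel;
    apply: measurable_fun_pair; measurable_real.
rewrite (chord_substitution u v (fun x y => (edge_kernel alpha t (u, x) (v, y))%:E))//;
  last by move=> x y; rewrite lee_fin edge_kernel_ge0.
have d0 : 0 <= v - u by rewrite subr_ge0 ltW.
have mk2 : measurable_fun setT (fun z : R * R =>
    (edge_kernel alpha t (u, z.1 * (1 - u) + z.2 * u) (v, z.1 * (1 - v) + z.2 * v))%:E).
  by apply/measurable_EFinP; apply: measurable_edge_kernel;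
    apply: measurable_fun_pair; measurable_real.
rewrite -ge0_integralZl//; last 2 first.
- apply: (measurable_integral_r mu (fun a b : R =>
    (edge_kernel alpha t (u, a * (1 - u) + b * u) (v, a * (1 - v) + b * v))%:E) mk2).
  by move=> a b; rewrite lee_fin edge_kernel_ge0.
- by move=> a _; apply: integral_ge0 => b _; rewrite lee_fin edge_kernel_ge0.
apply: eq_integral => a _.
have ma := measurable_section_r (fun a b : R => (edge_kernel alpha t
  (u, a * (1 - u) + b * u) (v, a * (1 - v) + b * v))%:E) mk2 a.
apply: etrans (esym (ge0_integralZl_setT _ _ _ mu (v - u) _ d0 ma _)) _.
  by move=> b; rewrite lee_fin edge_kernel_ge0.
apply: eq_integral => b _; rewrite -EFinM; congr EFin.
rewrite /edge_kernel /kernel_uv/= u0 uv v1/= !line_at_chord// !subr0 subrr !mulr1 !mulr0 addr0 add0r.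
have [/andP[a0 b0]|h] := boolP ((0 < a) && (0 < b)); last first.
  by rewrite !andbF !mul0r !mulr0.
rewrite !chord_gt0//=; [ring|by rewrite !ltW// (lt_trans u0)|].
by rewrite !ltW// (lt_trans uv).
Qed.

(** The diagonal, where [chord_moment] is not the integral it stands for, is removed; it is a null
    set. *)
Let kernel_ab t a b : R := [&& 0 < a, 0 < b & a != b]%:R *
  (alpha ^+ 2 * chord_moment alpha a b * expR (- (t * line_mass alpha a b))).

Let measurable_kernel_ab t d (T : measurableType d) (f g : T -> R) :
  measurable_fun setT f -> measurable_fun setT g ->
  measurable_fun setT (fun z => kernel_ab t (f z) (g z)).
Proof.
move=> mf mg; rewrite /kernel_ab /chord_moment /powR_primitive.
by case: (1 - alpha == 2^-1); measurable_real => //;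
  apply: measurable_line_mass; measurable_real.
Qed.

Let kernel_ab_ge0 t a b : 0 <= kernel_ab t a b.
Proof.
rewrite /kernel_ab; case: and3P => [[a0 b0 ab]|_]; last by rewrite mul0r.
suff h : 0 <= chord_moment alpha a b.
  apply: mulr_ge0 => //; apply: mulr_ge0; last exact: expR_ge0.
  by apply: mulr_ge0 => //; exact: sqr_ge0.
rewrite -lee_fin -(integral_chord_moment alpha)//.
apply: integral_ge0 => u _; apply: integral_ge0 => v _; rewrite lee_fin.
case: and3P => [[_ uv _]|_]; last by rewrite mul0r.
by rewrite !mulr_ge0 ?powR_ge0// subr_ge0 ltW.
Qed.

Let integral_kernel_uv t a b : a != b ->
  (\int[mu]_u \int[mu]_v (kernel_uv t u v a b)%:E = (kernel_ab t a b)%:E)%E.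
Proof.
move=> ab; have [/andP[a0 b0]|h] := boolP ((0 < a) && (0 < b)); last first.
  rewrite integral0_eq => [|u _].
    by rewrite /kernel_ab andbA (negbTE h) mul0r.
  by rewrite integral0_eq// => v _; rewrite /kernel_uv (negbTE h) mul0r mulr0.
pose w := alpha ^+ 2 * expR (- (t * line_mass alpha a b)).
have w0 : 0 <= w by rewrite !mulr_ge0 ?expR_ge0 ?(ltW alpha0).
pose g u v := [&& 0 < u, u < v & v < 1]%:R * ((v - u) *
     ((a * (1 - u) + b * u) * (a * (1 - v) + b * v)) `^ (- (alpha + 1))).
have g0 u v : 0 <= g u v.
  rewrite /g; case: and3P => [[_ uv _]|_]; last by rewrite mul0r.
  by rewrite !mulr_ge0 ?powR_ge0// subr_ge0 ltW.
have mg : measurable_fun setT (fun z : R * R => (g z.1 z.2)%:E).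
  by rewrite /g; measurable_real.
transitivity (w%:E * \int[mu]_u \int[mu]_v (g u v)%:E)%E; last first.
  by rewrite integral_chord_moment// -EFinM /kernel_ab a0 b0 ab/=; congr EFin; rewrite /w; ring.
rewrite -ge0_integralZl//; last 2 first.
- by apply: (measurable_integral_r mu (fun u v : R => (g u v)%:E) mg) => u v; rewrite lee_fin.
- by move=> u _; apply: integral_ge0 => v _; rewrite lee_fin.
apply: eq_integral => u _; rewrite -ge0_integralZl//; last 2 first.
- exact: (measurable_section_r (fun u v : R => (g u v)%:E) mg u).
- by move=> v _; rewrite lee_fin.
apply: eq_integral => v _; rewrite -EFinM; congr EFin.
by rewrite /kernel_uv a0 b0 /w /g/=; ring.
Qed.

(** The half a < b of [kernel_ab] after the substitution b = a x, with the factor [a] of the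
    substitution included. *)
Let kernel_ax t a x : R := [&& 0 < a & 1 < x]%:R *
  (alpha / (1 - alpha) * (edge_numerator (1 - alpha) x / (x - 1) ^+ 3) *
   (a `^ (- 2 * alpha - 1) *
    expR (- (t * ((x `^ (1 - alpha) - 1) / ((1 - alpha) * (x - 1))) * a `^ (- alpha))))).

Let integral_kernel_ab_half t a :
  (\int[mu]_b ((a < b)%R%:R * kernel_ab t a b)%R%:E = \int[mu]_x (kernel_ax t a x)%:E)%E.
Proof.
have [a0|a0] := ltrP 0 a; last first.
  rewrite !integral0_eq// => b _; first by rewrite /kernel_ax ltNge a0 mul0r.
  by rewrite /kernel_ab [0 < a]ltNge a0 mul0r mulr0.
have mlt : measurable_fun setT (fun b : R => ((a < b)%R%:R * kernel_ab t a b)%R%:E).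
  apply/measurable_EFinP; apply: measurable_funM.
    by apply: measurable_fun_bool_natr; apply: measurable_fun_ltr.
  have h := measurable_kernel_ab t _ (measurableTypeR R) (fun=> a) id.
  by apply: h; [exact: measurable_cst|exact: measurable_id].
have anz : a != 0 by rewrite gt_eqF.
rewrite (@ge0_integral_affine _ a 0 _ anz mlt); last by move=> b; rewrite lee_fin mulr_ge0.
rewrite gtr0_norm// -ge0_integralZl//; last 3 first.
- exact: (measurableT_comp mlt (measurable_affine a 0)).
- by move=> b _; rewrite lee_fin mulr_ge0.
- by rewrite lee_fin ltW.
apply: eq_integral => x _; rewrite -EFinM addr0; congr EFin.
rewrite -{2}(mulr1 a) ltr_pM2l//; rewrite /kernel_ab /kernel_ax.
have [x1|x1] := ltrP 1 x; last by rewrite andbF !mul0r mulr0.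
have x0 : 0 < x by lra.
rewrite a0 mulr_gt0//= lt_eqF ?ltr_pMr// !mul1r line_massZ// chord_momentZ//.
rewrite [t * (_ * _)]mulrCA [a `^ (- alpha) * _]mulrC.
have -> : a `^ (- 2 * alpha - 1) = a `^ (- 2 * alpha - 2) * a.
  rewrite -{3}(powRr1 (ltW a0)) -powRD ?(gt_eqF a0) ?implybT//; congr powR; lra.
move: (expR _) => E; have h1 : x - 1 != 0 by rewrite subr_eq0 gt_eqF.
by field; rewrite h1 !gt_eqF.
Qed.

Let measurable_kernel_ax t : measurable_fun setT (fun z : R * R => kernel_ax t z.1 z.2).
Proof.
rewrite /kernel_ax /edge_numerator /powR_primitive.
by case: (1 - alpha == 2^-1); measurable_real.
Qed.

Let kernel_ax_ge0 t a x : 0 <= kernel_ax t a x.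
Proof.
rewrite /kernel_ax; case: andP => [[a0 x1]|_]; last by rewrite mul0r.
rewrite mul1r mulr_ge0//; last by rewrite mulr_ge0 ?powR_ge0 ?expR_ge0.
apply: mulr_ge0; first by rewrite divr_ge0// ltW.
rewrite divr_ge0//; last by rewrite exprn_ge0// subr_ge0 ltW.
by apply: edge_numerator_ge0; [exact: b01|exact: ltW].
Qed.

Let integral_kernel_ax t x : 0 < t -> 1 < x -> (\int[mu]_a (kernel_ax t a x)%:E
  = ((1 - alpha) / t ^+ 2)%:E * (edge_density (1 - alpha) x)%:E)%E.
Proof.
move=> t0 x1; have x0 : 0 < x by lra.
have X1 : 1 < x `^ (1 - alpha) by exact: powR_gt1.
set c := t * ((x `^ (1 - alpha) - 1) / ((1 - alpha) * (x - 1))).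
have c0 : 0 < c.
  by rewrite mulr_gt0// divr_gt0 ?subr_gt0// mulr_gt0// subr_gt0.
pose w := alpha / (1 - alpha) * (edge_numerator (1 - alpha) x / (x - 1) ^+ 3).
have w0 : 0 <= w.
  apply: mulr_ge0; first by rewrite divr_ge0// ltW.
  rewrite divr_ge0//; last by rewrite exprn_ge0// subr_ge0 ltW.
  by apply: edge_numerator_ge0; [exact: b01|exact: ltW].
rewrite (@integral_support _ _ _ mu `]0, +oo[%classic); last first.
  by move=> a /negP; rewrite /= in_itv/= andbT => /negbTE h; rewrite /kernel_ax h mul0r.
transitivity (w%:E * \int[mu]_(a in `]0%R, +oo[)
    (a `^ (- 2 * alpha - 1) * expR (- (c * a `^ (- alpha))))%:E)%E.
  rewrite -ge0_integralZl//=; last 2 first.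
  - by apply: measurable_funTS; measurable_real.
  - by move=> a _; rewrite lee_fin mulr_ge0 ?powR_ge0 ?expR_ge0.
  apply: eq_integral => a; rewrite inE/= in_itv/= andbT => a0.
  by rewrite -EFinM /kernel_ax a0 x1/= mul1r.
rewrite integral_scale// -!EFinM; congr EFin; rewrite /w /c /edge_density.
have h1 : x - 1 != 0 by rewrite subr_eq0 gt_eqF.
have h2 : x `^ (1 - alpha) - 1 != 0 by rewrite subr_eq0 gt_eqF.
have h3 : alpha != 0 by rewrite gt_eqF.
have h4 : 1 - alpha != 0 by rewrite gt_eqF.
have h5 : t != 0 by rewrite gt_eqF.
by move: h2; move: (x `^ _) => X h2; field; rewrite ?h1 ?h2 ?h3 ?h4 ?h5.
Qed.

(** The parameter [t] multiplies the constant [c] of [integral_scale], whose integral is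
    proportional to c^(-2); hence the exact dependence on t^(-2). *)
Theorem integral_edge_kernel t : 0 < t ->
  (\int[mu2]_p \int[mu2]_q (edge_kernel alpha t p q)%:E
   = (2 * (1 - alpha) * edge_integral (1 - alpha) / t ^+ 2)%:E)%E.
Proof.
move=> t0.
have mk : measurable_fun setT (fun z : (R * R) * (R * R) =>
    (edge_kernel alpha t z.1 z.2)%:E).
  by apply/measurable_EFinP; exact: measurable_edge_kernel.
rewrite tonelli4//; last by move=> p q; rewrite lee_fin edge_kernel_ge0.
transitivity (\int[mu]_u \int[mu]_v \int[mu]_a \int[mu]_b (kernel_uv t u v a b)%:E)%E.
  apply: eq_integral => u _.
  rewrite (tonelli_swap mu mu (fun x v =>
    \int[mu]_y (edge_kernel alpha t (u, x) (v, y))%:E)%E).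
  - by apply: eq_integral => v _; exact: integral_edge_kernel_chord.
  - apply: (measurable_integral_r mu (fun (z : R * R) (y : R) =>
      (edge_kernel alpha t (u, z.1) (z.2, y))%:E)).
      by apply/measurable_EFinP; apply: measurable_edge_kernel;
        apply: measurable_fun_pair; measurable_real.
    by move=> z y; rewrite lee_fin edge_kernel_ge0.
  - by move=> x v; apply: integral_ge0 => y _; rewrite lee_fin edge_kernel_ge0.
have mH : measurable_fun setT (fun z : (R * R) * (R * R) =>
    (kernel_uv t z.1.1 z.1.2 z.2.1 z.2.2)%:E).
  by measurable_real; apply: measurable_kernel_uv; measurable_real.
have mH' : measurable_fun setT (fun z : (R * R) * (R * R) =>
    (kernel_uv t z.2.1 z.2.2 z.1.1 z.1.2)%:E).
  by measurable_real; apply: measurable_kernel_uv; measurable_real.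
rewrite -(tonelli4 (fun p q => (kernel_uv t p.1 p.2 q.1 q.2)%:E))//;
  last by move=> p q; rewrite lee_fin.
(* The exponential depends on the heights only, so the abscissas are moved inside and integrated
   away at fixed heights. *)
rewrite (tonelli_swap mu2 mu2 (fun p q => (kernel_uv t p.1 p.2 q.1 q.2)%:E))//;
  last by move=> p q; rewrite lee_fin.
rewrite (tonelli4 (fun q p => (kernel_uv t p.1 p.2 q.1 q.2)%:E))//;
  last by move=> p q; rewrite lee_fin.
rewrite /=.
have mab : measurable_fun setT (fun z : R * R => kernel_ab t z.1 z.2).
  by apply: measurable_kernel_ab; measurable_real.
transitivity (\int[mu]_a \int[mu]_b (kernel_ab t a b)%:E)%E.
  apply: eq_integral => a _; apply: ge0_ae_eq_integral => //.
  - apply: (measurable_integral_r mu (fun b u =>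
      \int[mu]_v (kernel_uv t u v a b)%:E)%E).
      apply: (measurable_integral_r mu (fun (z : R * R) v =>
        (kernel_uv t z.2 v a z.1)%:E)) => [|z v]; last by rewrite lee_fin.
      by measurable_real; apply: measurable_kernel_uv; measurable_real.
    by move=> b u; apply: integral_ge0 => v _; rewrite lee_fin.
  - by measurable_real; apply: measurable_kernel_ab; measurable_real.
  - by move=> b _; apply: integral_ge0 => u _; apply: integral_ge0 => v _; rewrite lee_fin.
  - by move=> b _; rewrite lee_fin; exact: kernel_ab_ge0.
  - exists [set a]; split => //; first exact: lebesgue_measure_set1.
    move=> b; rewrite /=; apply: contra_notP => ba _; apply: integral_kernel_uv.
    by apply/eqP => ab; apply: ba.
(* The kernel is symmetric in the two heights, which reduces the integral to the half a < b. *)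
transitivity (2%:E * \int[mu]_a \int[mu]_b ((a < b)%R%:R * kernel_ab t a b)%R%:E)%E.
  have mlt : measurable_fun setT (fun z : R * R => ((z.1 < z.2)%R%:R * kernel_ab t z.1 z.2)%R%:E).
    by measurable_real; apply: measurable_kernel_ab; measurable_real.
  have mgt : measurable_fun setT (fun z : R * R => ((z.2 < z.1)%R%:R * kernel_ab t z.1 z.2)%R%:E).
    by measurable_real; apply: measurable_kernel_ab; measurable_real.
  have l0 a b : (0 <= ((a < b)%R%:R * kernel_ab t a b)%R%:E)%E by rewrite lee_fin mulr_ge0.
  have g0 a b : (0 <= ((b < a)%R%:R * kernel_ab t a b)%R%:E)%E by rewrite lee_fin mulr_ge0.
  transitivity (\int[mu]_a (\int[mu]_b ((a < b)%R%:R * kernel_ab t a b)%R%:E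
      + \int[mu]_b ((b < a)%R%:R * kernel_ab t a b)%R%:E))%E.
    apply: eq_integral => a _; rewrite -ge0_integralD//; last 2 first.
    - exact: (measurable_section_r (fun a b => ((a < b)%R%:R * kernel_ab t a b)%R%:E) mlt a).
    - exact: (measurable_section_r (fun a b => ((b < a)%R%:R * kernel_ab t a b)%R%:E) mgt a).
    apply: eq_integral => b _; rewrite -EFinD; congr EFin.
    case: ltgtP => [||ab]; rewrite ?mul1r ?mul0r ?addr0 ?add0r//.
    by rewrite /kernel_ab ab eqxx !andbF mul0r.
  rewrite ge0_integralD//=; last 4 first.
  - by move=> a _; exact: integral_ge0.
  - exact: (measurable_integral_r mu (fun a b => ((a < b)%R%:R * kernel_ab t a b)%R%:E) mlt).
  - by move=> a _; exact: integral_ge0.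
  - exact: (measurable_integral_r mu (fun a b => ((b < a)%R%:R * kernel_ab t a b)%R%:E) mgt).
  rewrite [X in (_ + X)%E](tonelli_swap mu mu (fun a b => ((b < a)%R%:R * kernel_ab t a b)%R%:E))//.
  rewrite [X in (_ + X)%E](_ : _ = \int[mu]_a \int[mu]_b ((a < b)%R%:R * kernel_ab t a b)%R%:E)%E.
    by rewrite -mule2n mule_natl.
  apply: eq_integral => a _; apply: eq_integral => b _; congr (_ * _)%:E.
  rewrite /kernel_ab chord_momentC line_massC; congr (_%:R * _).
  by rewrite andbCA eq_sym.
under eq_integral do rewrite integral_kernel_ab_half.
rewrite (tonelli_swap mu mu (fun a x => (kernel_ax t a x)%:E)); last 2 first.
- by apply/measurable_EFinP; exact: measurable_kernel_ax.
- by move=> a x; rewrite lee_fin.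
rewrite (@integral_support _ _ _ mu `]1, +oo[%classic); last first.
  move=> x /negP; rewrite /= in_itv/= andbT => /negbTE h.
  by rewrite integral0_eq// => a _; rewrite /kernel_ax h andbF mul0r.
have [_ _ vE] := has_integral_edge_density (1 - alpha) b01.
transitivity (2%:E * \int[mu]_(x in `]1%R, +oo[)
    (((1 - alpha) / t ^+ 2)%:E * (edge_density (1 - alpha) x)%:E))%E.
  congr (_ * _)%E; apply: eq_integral => x; rewrite inE/= in_itv/= andbT => x1.
  exact: integral_kernel_ax.
rewrite ge0_integralZl//=; last 3 first.
- by apply/measurable_EFinP; exact: measurable_edge_density.
- by move=> x; rewrite in_itv/= andbT => x1; rewrite lee_fin edge_density_ge0.
- by rewrite lee_fin divr_ge0 ?sqr_ge0// ltW.
by rewrite vE -!EFinM; congr EFin; ring.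
Qed.

End edge_kernel.

(** * Poisson point processes *)

Section poisson_atoms.
Context {d d' : measure_display} {T : measurableType d} {E : measurableType d'}
  {R : realType}.
Variables (X : nat -> T -> E).
Local Notation N w B := (@point_measure _ _ T E R X w B).

(** Void events are phrased through the atoms rather than through the point measure, so that they
    connect directly to the geometry; [point_measure_eq0] links the two. *)
Definition avoid (B : set E) : set T := [set w | forall k, ~ B (X k w)].

Definition finitely_often (B : set E) : set T :=
  [set w | exists n, forall k, B (X k w) -> (k < n)%N].

Lemma point_measureE w B :
  N w B = (\sum_(0 <= k <oo) (\1_B (X k w))%:E)%E.
Proof. exact: eq_eseriesr. Qed.

Lemma point_measure_eq0 w B : N w B = 0%E <-> avoid B w.
Proof.
rewrite point_measureE; split=> [h k BX|h].
  pose s n := (\sum_(0 <= i < n) (\1_B (X i w) : R)%:E)%E.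
  have : (s k.+1 <= 0)%E.
    by rewrite -h; apply: nneseries_lim_ge => i _ _; rewrite lee_fin.
  rewrite /s big_nat_recr//= indicE mem_set// -/(s k) => h1.
  have h0 : (0 <= s k)%E by apply: sume_ge0 => i _; rewrite lee_fin.
  have : (1%:E <= 0%:E :> \bar R)%E by apply: le_trans h1; rewrite leeDr.
  by rewrite lee_fin ler10.
by apply: eseries0 => k _ _; rewrite indicE memNset//; exact: h.
Qed.

Lemma finitely_often_lty w B : (N w B < +oo)%E -> finitely_often B w.
Proof.
rewrite point_measureE => h; apply: contrapT => /forallNP hN.
pose s n : \bar R := (\sum_(0 <= k < n) (\1_B (X k w))%:E)%E.
have big m : exists n, (m%:R%:E <= s n)%E.
  elim: m => [|m [n hn]]; first by exists 0%N; rewrite /s big_geq.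
  have /existsNP[k /not_implyP[BX /negP]] := hN n; rewrite -leqNgt => nk.
  exists k.+1; rewrite /s big_nat_recr//= indicE mem_set// -natr1 EFinD leeD2r//.
  by apply: le_trans hn _; apply: lee_sum_nneg_natr => // i _ _; exact: lee01.
set M := (X in (X < _)%E) in h.
have M0 : (0 <= M)%E by apply: nneseries_ge0 => k _ _; rewrite lee_fin.
have fM : M \is a fin_num by rewrite ge0_fin_numE.
have [n h2] := big (Num.truncn (fine M)).+1.
have h1 : (s n <= M)%E by apply: nneseries_lim_ge => k _ _; rewrite lee_fin.
have := le_trans h2 h1; rewrite -(fineK fM) lee_fin.
by rewrite leNgt truncnS_gt.
Qed.

Hypothesis mX : forall k, measurable_fun setT (X k).

Lemma measurable_avoid B : measurable B -> measurable (avoid B).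
Proof.
move=> mB; rewrite (_ : avoid B = \bigcap_k (X k @^-1` (~` B))); last first.
  by apply/seteqP; split=> w h k; [move=> _; exact: h|exact: (h k I)].
apply: bigcap_measurable => // k _; rewrite -[X in measurable X]setTI.
by apply: mX => //; exact: measurableC.
Qed.

Lemma measurable_finitely_often B : measurable B -> measurable (finitely_often B).
Proof.
move=> mB; rewrite (_ : finitely_often B =
    \bigcup_n \bigcap_k (if (k < n)%N then setT else X k @^-1` (~` B))); last first.
  apply/seteqP; split=> [w [n h]|w [n _ h]]; exists n => //.
    by move=> k _; case: ifPn => // kn BX; move: kn; rewrite h.
  by move=> k BX; have := h k I; case: ifPn.
apply: bigcup_measurable => n _; apply: bigcap_measurable => // k _.
case: ifPn => // _; rewrite -[X in measurable X]setTI.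
by apply: mX => //; exact: measurableC.
Qed.

Lemma measurable_point_measure B : measurable B ->
  measurable_fun setT (fun w => N w B).
Proof.
move=> mB; under eq_fun do rewrite point_measureE.
apply: ge0_emeasurable_sum => [k w _ _|k _]; first by rewrite lee_fin.
apply/measurable_EFinP; apply: (measurableT_comp _ (mX k)).
exact: measurable_indic.
Qed.
End poisson_atoms.

Section poisson_probabilities.
Context {d d' : measure_display} {T : measurableType d} {E : measurableType d'}
  {R : realType}.
Variables (P : probability T R) (S : set E) (mu : set E -> \bar R).
Variable X : nat -> T -> E.
Hypothesis XP : poisson_point_process P S mu X.
Hypothesis mu0 : forall B, (0 <= mu B)%E.

Local Notation N w B := (@point_measure _ _ T E R X w B).
Let mX k : measurable_fun setT (X k). Proof. by case: XP. Qed.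

Lemma poisson_prob_set0 (m : R) : 0 <= m ->
  poisson_prob m 0 [set 0%N] = (expR (- m))%:E.
Proof.
rewrite le_eqVlt => /predU1P[<-|m0]; rewrite /poisson_prob.
  by rewrite ltxx oppr0 expR0 diracE mem_set.
rewrite m0 esum_set1 ?lee_fin ?poisson_pmf_ge0//.
by rewrite /poisson_pmf m0 expr0 fact0 invr1 !mul1r.
Qed.

Lemma probability_avoid B : measurable B -> B `<=` S -> (mu B < +oo)%E ->
  P (avoid X B) = (expR (- fine (mu B)))%:E.
Proof.
move=> mB BS Boo; have [_ _ + _] := XP => /(_ B mB BS); rewrite /poisson_count.
rewrite lt_eqF// => /(_ 0%N); rewrite poisson_prob_set0 ?fine_ge0// => <-.
by congr (P _); apply/seteqP; split=> w /=; rewrite point_measure_eq0.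
Qed.

(** Independence over three disjoint sets, tested on the counts being nonzero, nonzero and zero.
    This is the form in which independence enters the discretization. *)
Lemma probability_hits_avoid B1 B2 B3 :
  measurable B1 -> measurable B2 -> measurable B3 ->
  B1 `<=` S -> B2 `<=` S -> B3 `<=` S ->
  (mu B1 < +oo)%E -> (mu B2 < +oo)%E -> (mu B3 < +oo)%E ->
  B1 `&` B2 = set0 -> B1 `&` B3 = set0 -> B2 `&` B3 = set0 ->
  P (~` avoid X B1 `&` ~` avoid X B2 `&` avoid X B3) =
  ((1 - expR (- fine (mu B1))) * (1 - expR (- fine (mu B2)))
    * expR (- fine (mu B3)))%:E.
Proof.
move=> m1 m2 m3 S1 S2 S3 f1 f2 f3 d12 d13 d23.
pose B (i : 'I_3) := nth set0 [:: B1; B2; B3] i.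
pose A (i : 'I_3) : set (\bar R) := nth setT [:: ~` [set 0%E]; ~` [set 0%E]; [set 0%E]] i.
have mB i : measurable (B i) /\ B i `<=` S by case: i => -[|[|[|]]].
have tB : trivIset setT B.
  apply/trivIsetP => -[[|[|[|//]]] ? ] [[|[|[|//]]] ?] _ _ //= _; rewrite /B//=;
    by rewrite ?d12 ?d13 ?d23// setIC ?d12 ?d13 ?d23.
have mA i : measurable (A i).
  by case: i => -[|[|[|//]]] ?; rewrite /A//=; try apply: measurableC; exact: emeasurable_set1.
have [_ _ _ /(_ _ B mB tB A mA)] := XP.
rewrite !big_ord_recl big_ord0 mule1.
rewrite (_ : [set w | forall i, A i _] = ~` avoid X B1 `&` ~` avoid X B2 `&` avoid X B3); last first.
  apply/seteqP; split=> [w h|w [[h1 h2] h3]].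
    have := h ord0; have := h (lift ord0 ord0); have := h (lift ord0 (lift ord0 ord0)).
    by rewrite /A /B/= !point_measure_eq0 => h3 h2 h1; split.
  by case=> -[|[|[|//]]] ?; rewrite /A /B/= point_measure_eq0.
move=> ->.
have E1 B' : [set w | (~` [set 0%E]) (N w B')] = ~` avoid X B'.
  by apply/seteqP; split=> w /=; rewrite point_measure_eq0.
have E2 B' : [set w | [set 0%E] (N w B')] = avoid X B'.
  by apply/seteqP; split=> w /=; rewrite point_measure_eq0.
rewrite /A /B/= E1 E1 E2 !probability_setC; try exact: measurable_avoid.
by rewrite !probability_avoid// -!EFinB -!EFinM mulrA.
Qed.

(** The events that the count equals k are disjoint and their Poisson probabilities add up to 1; a
    finite count leaves finitely many indices. *)
Lemma probability_finitely_often B : measurable B -> B `<=` S -> (mu B < +oo)%E ->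
  P (finitely_often X B) = 1%E.
Proof.
move=> mB BS Boo; have [_ _ + _] := XP => /(_ B mB BS); rewrite /poisson_count.
rewrite lt_eqF// => hk; pose m := fine (mu B).
pose F k := (fun w => N w B) @^-1` [set k%:R%:E].
have mF k : measurable (F k).
  rewrite -[X in measurable X]setTI.
  exact: (measurable_point_measure X mX B mB measurableT _ (emeasurable_set1 _)).
have tF : trivIset setT F.
  apply/trivIsetP => i j _ _ ij; rewrite -subset0 => w [].
  by rewrite /F /= => -> [] /eqP; rewrite eqr_nat (negbTE ij).
apply/eqP; rewrite eq_le probability_le1 ?andTb; last exact: measurable_finitely_often.
have -> : 1%E = P (\bigcup_k F k) :> \bar R.
  rewrite measure_bigcup// (eq_eseriesr (fun k _ => hk k)).
  rewrite -(@probability_setT _ _ _ (poisson_prob m 0)).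
  rewrite [in LHS](_ : setT = \bigcup_k [set k]); last first.
    by apply/seteqP; split=> k // _; exists k.
  rewrite measure_bigcup//.
  by apply/trivIsetP => i j _ _ /eqP ij; rewrite -subset0 => k [/= -> /ij].
apply: le_measure; rewrite ?inE.
- exact: bigcup_measurable.
- exact: measurable_finitely_often.
- by move=> w [k _ /= wk]; apply: (@finitely_often_lty _ _ _ _ R); rewrite wk ltry.
Qed.

End poisson_probabilities.

Lemma measurable_set_bool d (T : measurableType d) (b : T -> bool) :
  measurable_fun setT b -> measurable [set x | b x].
Proof.
move=> mb; rewrite (_ : [set x | b x] = setT `&` b @^-1` [set true]).
  exact: mb.
by rewrite setTI.
Qed.

(** * Intensity of the region above a graph *)

Section stable_mass.
Context {R : realType}.
Local Notation mu := (@lebesgue_measure R).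
Local Notation mu2 := (product_sigma_finite mu mu).
Implicit Types (a b c u t v : R) (z : R * R) (h : R -> R) (A B : set (R * R)).
Variable alpha : R.
Hypothesis alpha01 : 0 < alpha < 1.
Let alpha0 : 0 < alpha. Proof. by case/andP: alpha01. Qed.
Let beta0 : 0 < 1 - alpha. Proof. by case/andP: alpha01 => ? ?; rewrite subr_gt0. Qed.
Local Notation nu := (stable_intensity alpha).

Definition stable_density z : R := alpha * z.2 `^ (- (alpha + 1)).

Lemma stable_density_ge0 z : 0 <= stable_density z.
Proof. by rewrite mulr_ge0 ?powR_ge0// ltW. Qed.

Lemma measurable_stable_density d (T : measurableType d) (f : T -> R * R) :
  measurable_fun setT f -> measurable_fun setT (fun x => stable_density (f x)).
Proof. by move=> mf; rewrite /stable_density; measurable_real => //. Qed.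

Lemma stable_intensityE B : nu B = (\int[mu2]_z (\1_B z * stable_density z)%:E)%E.
Proof.
rewrite /stable_intensity integral_mkcond; apply: eq_integral => z _.
by rewrite patchE indicE; case: ifPn => _; rewrite ?mul1r ?mul0r.
Qed.

Lemma stable_intensity_ge0 B : (0 <= nu B)%E.
Proof. by apply: integral_ge0 => z _; rewrite lee_fin stable_density_ge0. Qed.

Let mdens D : measurable_fun D (fun z : R * R => (stable_density z)%:E).
Proof. by apply: measurable_funTS; measurable_real; apply: measurable_stable_density. Qed.

Lemma stable_intensity_le A B : measurable A -> measurable B -> A `<=` B ->
  (nu A <= nu B)%E.
Proof.
move=> mA mB AB.
apply: (@ge0_subset_integral _ _ _ mu2 A B mA mB (fun z => (stable_density z)%:E)) => //; first exact: mdens.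
by move=> z _; rewrite lee_fin stable_density_ge0.
Qed.

Lemma stable_intensityU_le A B : measurable A -> measurable B ->
  (nu (A `|` B) <= nu A + nu B)%E.
Proof.
move=> mA mB; rewrite !stable_intensityE -ge0_integralD//.
- apply: ge0_le_integral => //.
  + by move=> z _; rewrite lee_fin mulr_ge0 ?stable_density_ge0.
  + by measurable_real; [exact/measurable_indic/measurableU|exact: measurable_stable_density].
  + by apply: emeasurable_funD; measurable_real; try exact: measurable_stable_density;
      exact: measurable_indic.
  + move=> z _; rewrite -EFinD lee_fin -mulrDl ler_wpM2r ?stable_density_ge0//.
    by rewrite !indicE in_setU; case: (z \in A) => //=; rewrite ?add0r// lerDl.
- by move=> z _; rewrite lee_fin mulr_ge0 ?stable_density_ge0.
- by measurable_real; [exact: measurable_indic|exact: measurable_stable_density].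
- by move=> z _; rewrite lee_fin mulr_ge0 ?stable_density_ge0.
- by measurable_real; [exact: measurable_indic|exact: measurable_stable_density].
Qed.

Lemma integral_stable_tail c : 0 < c ->
  (\int[mu]_(v in `]c, +oo[) (alpha * v `^ (- (alpha + 1)))%:E = (c `^ (- alpha))%:E)%E.
Proof.
move=> c0; pose F v := - v `^ (- alpha).
have hF v : c < v -> has_derivative F v (alpha * v `^ (- (alpha + 1))).
  move=> cv; have v0 : 0 < v by rewrite (lt_trans c0).
  apply: has_derivative_eq.
    by apply: has_derivativeN; apply: (has_derivative_powR_comp (fun v => v));
      [|exact: has_derivative_id].
  have -> : - alpha - 1 = - (alpha + 1) by ring.
  by ring.
rewrite (@ge0_FTC_ray _ (fun v => alpha * v `^ (- (alpha + 1))) (fun=> 0) F c 0 (F c))//.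
- by rewrite integral0 adde0 /F sub0r opprK.
- by move=> v _; rewrite mulr_ge0 ?powR_ge0// ltW.
- by move=> v cv; rewrite subr0; exact: hF.
- move=> v cv; apply: cvgM; first exact: cvg_cst.
  by apply: continuous_powRl; rewrite (lt_trans c0).
- by move=> v _; exact: cvg_cst.
- by rewrite -[X in _ --> X]oppr0; apply: cvgN; exact: cvg_powRN.
- by apply: cvgN; apply: cvg_at_right_filter; exact: continuous_powRl.
Qed.

Definition supgraph h : set (R * R) :=
  [set z | [&& 0 <= z.1, z.1 <= 1, 0 < z.2 & h z.1 < z.2]].

Lemma supgraph_strip h : supgraph h `<=` strip R.
Proof. by move=> z /and4P[? ? ? _]; split; rewrite /= in_itv/= ?andbT//; apply/andP. Qed.

Lemma measurable_supgraph h : measurable_fun setT h -> measurable (supgraph h).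
Proof.
move=> mh; apply: measurable_set_bool; measurable_real.
exact: (measurableT_comp mh).
Qed.

Lemma stable_intensity_supgraph h : measurable_fun setT h ->
  (forall u, 0 < u < 1 -> 0 < h u) ->
  nu (supgraph h) = (\int[mu]_(u in `]0%R, 1%R[) (h u `^ (- alpha))%:E)%E.
Proof.
move=> mh h0; have mS := measurable_supgraph h mh.
rewrite stable_intensityE product_tonelli; last 2 first.
- by measurable_real; [exact: measurable_indic|exact: measurable_stable_density].
- by move=> z; rewrite lee_fin mulr_ge0 ?stable_density_ge0.
rewrite (@integral_support _ _ _ mu `[0, 1]%classic); last first.
  move=> u /negP; rewrite /= in_itv/= => hu; apply: integral0_eq => v _.
  rewrite indicE memNset ?mul0r// => /and4P[u0 u1 _ _].
  by move: hu; rewrite u0 u1.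
(* [h] is positive in the open interval only: the lines bounding the cones vanish at an end. *)
rewrite integral_itv_bndoo; last first.
  apply: measurable_funTS; apply: (measurable_integral_r mu
    (fun u v => (\1_(supgraph h) (u, v) * stable_density (u, v))%:E)).
    have mp : measurable_fun setT (fun z : R * R => (z.1, z.2)).
      by apply: measurable_fun_pair; measurable_real.
    measurable_real; last exact: measurable_stable_density.
    by apply: (measurableT_comp _ mp); exact: measurable_indic.
  by move=> u v; rewrite lee_fin mulr_ge0 ?stable_density_ge0.
apply: eq_integral => u; rewrite inE/= in_itv/= => u01; have /andP[u0 u1] := u01.
have hu := h0 u u01.
rewrite -integral_stable_tail// (@integral_support _ _ _ mu `]h u, +oo[%classic).
  apply: eq_integral => v; rewrite inE/= in_itv/= andbT => hv.
  rewrite indicE mem_set ?mul1r//; apply/and4P; split => //=; rewrite ?ltW//.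
  exact: lt_trans hv.
move=> v /negP; rewrite /= in_itv/= andbT => /negP hv.
by rewrite indicE memNset ?mul0r// => /and4P[_ _ _] /=.
Qed.

Definition above a b : set (R * R) := supgraph (fun u => a * (1 - u) + b * u).

Lemma measurable_above a b : measurable (above a b).
Proof. by apply: measurable_supgraph; measurable_real. Qed.

Lemma stable_intensity_above a b : 0 < a -> 0 < b ->
  nu (above a b) = (line_mass alpha a b)%:E.
Proof.
move=> a0 b0; rewrite stable_intensity_supgraph.
- exact: integral_line_mass.
- by measurable_real.
- by move=> u /andP[u0 u1]; apply: chord_gt0 => //; rewrite !ltW.
Qed.

(** Read off from the inclusion of the regions above the two lines, which avoids differentiating the
    quotient. *)
Lemma line_mass_le a b a' b' : 0 < a -> 0 < b -> a <= a' -> b <= b' ->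
  line_mass alpha a' b' <= line_mass alpha a b.
Proof.
move=> a0 b0 aa bb; have a'0 := lt_le_trans a0 aa; have b'0 := lt_le_trans b0 bb.
rewrite -lee_fin -!stable_intensity_above//; apply: stable_intensity_le.
- exact: measurable_above.
- exact: measurable_above.
move=> z /and4P[z0 z1 z2 hz]; apply/and4P; split => //.
apply: le_lt_trans hz; apply: lerD; apply: ler_wpM2r => //.
by rewrite subr_ge0.
Qed.

Lemma line_mass_scale c a b : 0 < c -> 0 <= a -> 0 <= b ->
  line_mass alpha (c * a) (c * b) = c `^ (- alpha) * line_mass alpha a b.
Proof.
move=> c0 a0 b0; have cn : c != 0 by rewrite gt_eqF.
rewrite /line_mass (inj_eq (mulfI cn)); case: eqVneq => ab.
  by rewrite powRM// ltW.
rewrite !powRM ?(ltW c0)//.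
have -> : c `^ (1 - alpha) = c * c `^ (- alpha).
  by rewrite -{2}(powRr1 (ltW c0)) -powRD ?cn ?implybT.
have h1 : b - a != 0 by rewrite subr_eq0 eq_sym.
have h2 : 1 - alpha != 0 by rewrite gt_eqF.
have -> : c * b - c * a = c * (b - a) by ring.
by field; rewrite cn h1 h2.
Qed.

(** The part of the strip above the tent min(c u, c (1 - u)), that is, the set in the third
    condition of [regular_atoms]. *)
Definition cone c : set (R * R) :=
  supgraph (fun u => c * u) `|` supgraph (fun u => c * (1 - u)).

Lemma measurable_cone c : measurable (cone c).
Proof. by apply: measurableU; apply: measurable_supgraph; measurable_real. Qed.

Lemma cone_strip c : cone c `<=` strip R.
Proof. by move=> z [|]; exact: supgraph_strip. Qed.

(** u^(- alpha) is integrable at 0 because alpha < 1. The bound is finite for each [c], so that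
    finitely many atoms lie above each tent, and tends to 0 as [c] grows, so that some tent lies
    above all atoms. *)
Lemma stable_intensity_cone c : 0 < c ->
  (nu (cone c) <= (2 / (1 - alpha) * c `^ (- alpha))%:E)%E.
Proof.
move=> c0; pose I := (c `^ (- alpha) / (1 - alpha))%:E : \bar R.
have N1 : 1 - alpha - 1 = - alpha by ring.
have h1 : nu (supgraph (fun u => c * u)) = I.
  rewrite stable_intensity_supgraph.
  - pose F u := c `^ (- alpha) / (1 - alpha) * u `^ (1 - alpha).
    rewrite (@ge0_FTC_oo _ (fun u => (c * u) `^ (- alpha)) (fun=> 0) F 0 1 (F 1) 0)//.
    + by rewrite integral0 adde0 /F one_powR mulr1 subr0.
    + by move=> *; exact: powR_ge0.
    + move=> u /andP[u0 u1]; rewrite subr0; apply: has_derivative_eq.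
        apply: has_derivativeM; first exact: has_derivative_cst.
        by apply: (has_derivative_powR_comp (fun v => v)); [|exact: has_derivative_id].
      rewrite N1 powRM ?(ltW c0) ?(ltW u0)//.
      by field; rewrite gt_eqF.
    + move=> u /andP[u0 u1]; apply: (@cvg_powR _ _ _ _ (fun u => c * u)).
        exact: mulr_gt0.
      by apply: cvgM; [exact: cvg_cst|exact: cvg_id].
    + by move=> *; exact: cvg_cst.
    + apply: cvg_at_left_filter; apply: cvgM; first exact: cvg_cst.
      exact: continuous_powRl.
    + rewrite -[X in _ --> X](mulr0 (c `^ (- alpha) / (1 - alpha))).
      apply: cvgM; first exact: cvg_cst.
      exact: cvg_powR0.
  - by measurable_real.
  - by move=> u /andP[u0 _]; exact: mulr_gt0.
have h2 : nu (supgraph (fun u => c * (1 - u))) = I.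
  rewrite stable_intensity_supgraph.
  - pose F u := - (c `^ (- alpha) / (1 - alpha)) * (1 - u) `^ (1 - alpha).
    have d u : has_derivative (fun v => 1 - v) u (-1).
      by apply: has_derivative_eq; [derive|rewrite sub0r].
    rewrite (@ge0_FTC_oo _ (fun u => (c * (1 - u)) `^ (- alpha)) (fun=> 0) F 0 1 0 (F 0))//.
    + by rewrite integral0 adde0 /F subr0 one_powR mulr1 sub0r opprK.
    + by move=> *; exact: powR_ge0.
    + move=> u /andP[u0 u1]; have u1' : 0 < 1 - u by rewrite subr_gt0.
      rewrite subr0; apply: has_derivative_eq.
        apply: has_derivativeM; first exact: has_derivative_cst.
        by apply: (has_derivative_powR_comp (fun v => 1 - v)); [|exact: d].
      rewrite N1 powRM ?(ltW c0) ?(ltW u1')//.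
      by field; rewrite gt_eqF.
    + move=> u /andP[u0 u1]; apply: (@cvg_powR _ _ _ _ (fun u => c * (1 - u))).
        by rewrite mulr_gt0// subr_gt0.
      apply: cvgM; first exact: cvg_cst.
      exact: (has_derivative_continuous _ _ _ (d u)).
    + by move=> *; exact: cvg_cst.
    + rewrite -[X in _ --> X](mulr0 (- (c `^ (- alpha) / (1 - alpha)))).
      apply: cvgM; first exact: cvg_cst.
      apply: (@cvg_comp _ _ _ (fun u => 1 - u) (fun v => v `^ (1 - alpha)) _ (0^'+)).
        move=> A [e /= e0 hA]; exists e => //= u /= hu u1.
        by apply: hA => /=; rewrite ?subr_gt0// sub0r normrN.
      exact: cvg_powR0.
    + apply: cvg_at_right_filter; apply: cvgM; first exact: cvg_cst.
      apply: (@cvg_powR _ _ _ _ (fun u => 1 - u)); first by rewrite subr0.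
      exact: (has_derivative_continuous _ _ _ (d 0)).
  - by measurable_real.
  - by move=> u /andP[_ u1]; rewrite mulr_gt0// subr_gt0.
apply: le_trans (stable_intensityU_le _ _ _ _) _.
- by apply: measurable_supgraph; measurable_real.
- by apply: measurable_supgraph; measurable_real.
rewrite h1 h2 -EFinD lee_fin; rewrite le_eqVlt; apply/orP; left; apply/eqP.
by field; rewrite gt_eqF.
Qed.

End stable_mass.

Lemma negligible_setC1 {R : realType} {d : measure_display} {T : measurableType d}
    (P : probability T R) (A : set T) :
  measurable A -> P A = 1%E -> P.-negligible (~` A).
Proof.
move=> mA PA; apply/negligibleP; first exact: measurableC.
by rewrite -[LHS]/(P (~` A)) probability_setC// PA subee.
Qed.

(** * Almost sure regularity of the atoms *)

Section regular_event.
Context {R : realType} {d : measure_display} {T : measurableType d}.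
Variables (alpha : R) (P : probability T R) (X : nat -> T -> R * R).
Hypothesis alpha01 : 0 < alpha < 1.
Hypothesis XP : poisson_point_process P (strip R) (stable_intensity alpha) X.
Let alpha0 : 0 < alpha. Proof. by case/andP: alpha01. Qed.
Let mX k : measurable_fun setT (X k). Proof. by case: XP. Qed.

Definition regular_event : set T :=
  (\bigcup_m avoid X (cone m.+1%:R)) `&`
  \bigcap_n finitely_often X (cone n.+1%:R^-1).

Lemma measurable_regular_event : measurable regular_event.
Proof.
apply: measurableI.
  by apply: bigcup_measurable => m _; apply: measurable_avoid => //; exact: measurable_cone.
by apply: bigcap_measurable => // m _; apply: measurable_finitely_often => //;
  exact: measurable_cone.
Qed.

Lemma atom_strip k w : [/\ 0 <= (X k w).1, (X k w).1 <= 1 & 0 < (X k w).2].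
Proof.
have [_ /(_ k w) + _ _] := XP.
by rewrite /strip /= !in_itv/= andbT => -[/andP[? ?] ?].
Qed.

Lemma regular_event_atoms w : regular_event w -> regular_atoms (fun k => X k w).
Proof.
move=> [[m _ hm] hfin]; split.
- by move=> k; have [] := atom_strip k w.
- exists m.+1%:R => k; have [u0 u1 v0] := atom_strip k w.
  by split; rewrite leNgt; apply/negP => h; apply: (hm k); [left|right]; apply/and4P.
- move=> c c0; pose n := Num.truncn c^-1.
  have nc : n.+1%:R^-1 <= c.
    rewrite invf_ple ?posrE//; apply: ltW; exact: truncnS_gt.
  have [N hN] := hfin n I.
  apply: (@sub_finite_set _ _ ((fun k => X k w) @` `I_N)); last exact/finite_image/finite_II.
  move=> p [[k _ <-] hp]; exists k => //; apply: hN.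
  have [u0 u1 v0] := atom_strip k w.
  case: hp => hp; [left|right]; apply/and4P; split => //; apply: le_lt_trans hp.
    by apply: ler_wpM2r.
  by apply: ler_wpM2r => //; rewrite subr_ge0.
Qed.

(** A cone of slope m + 1 is avoided with probability at least 1 - K (m+1)^(- alpha), which tends to
    1. The finiteness conditions form a countable intersection of almost sure events. *)
Lemma probability_regular_event : P (~` regular_event) = 0%E.
Proof.
apply/measure_negligible; first exact/measurableC/measurable_regular_event.
have beta0 : 0 < 1 - alpha by case/andP: alpha01 => _; rewrite subr_gt0.
have cfin c : 0 < c -> (stable_intensity alpha (cone c) < +oo)%E.
  by move=> c0; apply: le_lt_trans (stable_intensity_cone alpha alpha01 c c0) _; rewrite ltry.
have mC c : measurable (cone c : set (R * R)) by exact: measurable_cone.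
rewrite setCI; apply: negligibleU.
  have mG : measurable (\bigcup_m avoid X (cone m.+1%:R)).
    by apply: bigcup_measurable => m _; exact: measurable_avoid.
  apply: negligible_setC1 => //; set p := P _.
  have p1 : (p <= 1)%E by exact: probability_le1.
  have pf : p \is a fin_num by exact: fin_num_measure.
  pose K := 2 / (1 - alpha).
  have K0 : 0 < K by rewrite divr_gt0.
  have lb m : 1 - K * m.+1%:R `^ (- alpha) <= fine p.
    rewrite -lee_fin fineK//; apply: (@le_trans _ _ (P (avoid X (cone m.+1%:R)))); last first.
      apply: le_measure; rewrite ?inE//; first exact: measurable_avoid.
      by move=> w hw; exists m.
    rewrite (probability_avoid _ _ _ _ XP (stable_intensity_ge0 alpha alpha01))//;
      [|exact: cone_strip|exact: cfin].
    rewrite lee_fin; apply: le_trans (expR_ge1Dx _).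
    rewrite lerD2l lerN2 -lee_fin fineK; first exact: stable_intensity_cone.
    by rewrite ge0_fin_numE ?stable_intensity_ge0// cfin.
  apply/eqP; rewrite -(fineK pf) eqe eq_le; apply/andP; split.
    by rewrite -lee_fin fineK.
  rewrite leNgt; apply/negP => pl1.
  have cv : K * m.+1%:R `^ (- alpha) @[m --> \oo] --> (0 : R).
    rewrite -[X in _ --> X](mulr0 K); apply: cvgM; first exact: cvg_cst.
    apply: (@cvg_comp _ _ _ (fun m : nat => m.+1%:R : R) (fun t => t `^ (- alpha)) _ +oo).
      apply/cvgryPge => A; exists (Num.truncn A) => // m /= Nm.
      by apply: le_trans (ltW (truncnS_gt A)) _; rewrite ler_nat.
    exact: cvg_powRN.
  move/cvgr0Pnorm_lt : cv => /(_ (1 - fine p)); rewrite subr_gt0 => /(_ pl1)[N _ /(_ N)].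
  rewrite /= leqnn => /(_ isT).
  rewrite ger0_norm; last exact: (mulr_ge0 (ltW K0) (powR_ge0 _ _)).
  move=> h.
  by have := lb N; lra.
rewrite setC_bigcap; apply: negligible_bigcup => n.
apply: negligible_setC1; first exact: measurable_finitely_often.
apply: (probability_finitely_often P _ _ X XP) => //; first exact: cone_strip.
by apply: cfin; rewrite invr_gt0.
Qed.

End regular_event.

(** * Discretization *)

Section box_pairs.
Context {R : realType} {d : measure_display} {Om : measurableType d}.
Local Notation mu := (@lebesgue_measure R).
Local Notation mu2 := (product_sigma_finite mu mu).
Local Notation mu4 := (product_sigma_finite mu2 mu2).
Implicit Types (a b c t : R) (p q : R * R) (w : Om) (B : set (R * R)).
Variables (alpha : R) (P : probability Om R) (X : nat -> Om -> R * R).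
Hypothesis alpha01 : 0 < alpha < 1.
Hypothesis XP : poisson_point_process P (strip R) (stable_intensity alpha) X.
Let alpha0 : 0 < alpha. Proof. by case/andP: alpha01. Qed.
Local Notation nu := (stable_intensity alpha).
Let mX k : measurable_fun setT (X k). Proof. by case: XP. Qed.

(* The lines through a point of [B1] and a point of [B2] all have heights over
   0 and 1 within a factor [t] of [a] and [b]. *)
Definition admissible t B1 B2 a b : Prop := [/\ 0 < a, 0 < b,
  exists c, (forall p, B1 p -> [/\ 0 < p.1, p.1 < c & 0 < p.2]) /\
            (forall q, B2 q -> [/\ c < q.1, q.1 < 1 & 0 < q.2]),
  forall p q, B1 p -> B2 q ->
    a <= line_at p q 0 <= t * a /\ b <= line_at p q 1 <= t * b
  & (nu B1 <= (t - 1)%:E)%E /\ (nu B2 <= (t - 1)%:E)%E].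

Lemma line_at_le p q a b t : p.1 < q.1 -> 0 <= t <= 1 ->
  line_at p q 0 <= a -> line_at p q 1 <= b -> line_at p q t <= a * (1 - t) + b * t.
Proof.
move=> pq /andP[t0 t1] h0 h1; rewrite line_atE//.
have := ler_wpM2l t0 h1; have t1' : 0 <= 1 - t by rewrite subr_ge0.
by have := ler_wpM2l t1' h0; lra.
Qed.

Lemma line_at_ge p q a b t : p.1 < q.1 -> 0 <= t <= 1 ->
  a <= line_at p q 0 -> b <= line_at p q 1 -> a * (1 - t) + b * t <= line_at p q t.
Proof.
move=> pq /andP[t0 t1] h0 h1; rewrite (line_atE p q t)//.
have := ler_wpM2l t0 h1; have t1' : 0 <= 1 - t by rewrite subr_ge0.
by have := ler_wpM2l t1' h0; lra.
Qed.

Section admissible_pair.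
Variables (t : R) (B1 B2 : set (R * R)) (a b : R).
Hypothesis t1 : 1 < t.
Hypotheses (mB1 : measurable B1) (mB2 : measurable B2).
Hypothesis adm : admissible t B1 B2 a b.
Let t0 : 0 < t. Proof. by rewrite (lt_trans _ t1). Qed.

Lemma admissible_separated p q : B1 p -> B2 q ->
  [/\ 0 < p.1, p.1 < q.1, q.1 < 1, 0 < p.2 & 0 < q.2].
Proof.
by have [_ _ [c [h1 h2]] _ _] := adm => /h1[? ? ?] /h2[? ? ?]; split => //;
  apply: (@lt_trans _ _ c).
Qed.

Let strip1 : B1 !=set0 -> B2 !=set0 -> B1 `<=` strip R.
Proof.
move=> _ [q qB] p pB; have [? ? ? ? ?] := admissible_separated p q pB qB.
by split; rewrite /= in_itv/= ?andbT//; apply/andP; split; apply: ltW => //;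
  apply: (@lt_trans _ _ q.1).
Qed.

Let strip2 : B1 !=set0 -> B2 !=set0 -> B2 `<=` strip R.
Proof.
move=> [p pB] _ q qB; have [? ? ? ? ?] := admissible_separated p q pB qB.
by split; rewrite /= in_itv/= ?andbT//; apply/andP; split; apply: ltW => //;
  apply: (@lt_trans _ _ p.1).
Qed.

Let m1 : R := fine (nu B1).
Let m2 : R := fine (nu B2).

Lemma admissible_mass : [/\ nu B1 = m1%:E, nu B2 = m2%:E, 0 <= m1 <= t - 1 & 0 <= m2 <= t - 1].
Proof.
have [_ _ _ _ [h1 h2]] := adm.
have f1 : nu B1 \is a fin_num.
  by rewrite ge0_fin_numE ?stable_intensity_ge0// (le_lt_trans h1) ?ltry.
have f2 : nu B2 \is a fin_num.
  by rewrite ge0_fin_numE ?stable_intensity_ge0// (le_lt_trans h2) ?ltry.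
by split; rewrite /m1 /m2 ?fineK// fine_ge0 ?stable_intensity_ge0//= -lee_fin fineK.
Qed.

(** Necessary for an edge from [B1] to [B2]. The region lies above every line between the boxes,
    hence is disjoint from both. *)
Definition upper_event : set Om :=
  ~` avoid X B1 `&` ~` avoid X B2 `&` avoid X (above (t * a) (t * b)).

(** Sufficient for an edge from [B1] to [B2]. The lowered line passes below the boxes, which are
    therefore cut out so that independence applies. *)
Definition lower_event : set Om :=
  ~` avoid X B1 `&` ~` avoid X B2 `&`
  avoid X (above (a / t) (b / t) `\` (B1 `|` B2)).

Lemma measurable_upper_event : measurable upper_event.
Proof.
apply: measurableI; last by apply: measurable_avoid => //; exact: measurable_above.
by apply: measurableI; apply: measurableC; exact: measurable_avoid.
Qed.

Lemma measurable_lower_event : measurable lower_event.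
Proof.
apply: measurableI; last first.
  apply: measurable_avoid => //; apply: measurableD; first exact: measurable_above.
  exact: measurableU.
by apply: measurableI; apply: measurableC; exact: measurable_avoid.
Qed.

Let hit_nonempty B w : (~` avoid X B) w -> B !=set0.
Proof. by move=> /existsNP[k /contrapT Bk]; exists (X k w). Qed.

Let empty_case (A : set Om) : ~ (B1 !=set0 /\ B2 !=set0) ->
  ~` avoid X B1 `&` ~` avoid X B2 `&` A = set0 /\ m1 * m2 = 0.
Proof.
move=> h; split.
  by rewrite -subset0 => w [[/hit_nonempty h1 /hit_nonempty h2] _]; apply: h.
have z B : ~ (B !=set0) -> fine (nu B) = 0.
  by move=> /set0P/negP; rewrite negbK => /eqP ->; rewrite /stable_intensity integral_set0.
have [n1|n1] := pselect (B1 !=set0); last by rewrite /m1 z// mul0r.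
have [n2|n2] := pselect (B2 !=set0); last by rewrite /m2 z// mulr0.
by case: h.
Qed.

Let disj12 : B1 `&` B2 = set0.
Proof.
rewrite -subset0 => p [p1 p2]; have [_ + _ _ _] := admissible_separated p p p1 p2.
by rewrite ltxx.
Qed.

Let above_fin a' b' : 0 < a' -> 0 < b' -> (nu (above a' b') < +oo)%E.
Proof. by move=> *; rewrite stable_intensity_above// ltry. Qed.

Lemma probability_upper_event : (P upper_event <=
  (m1 * m2 * expR (- line_mass alpha (t * a) (t * b)))%:E)%E.
Proof.
have [a0 b0 _ hl _] := adm; have [e1 e2 /andP[h1 _] /andP[h2 _]] := admissible_mass.
have ta := mulr_gt0 t0 a0; have tb := mulr_gt0 t0 b0.
(* Each box is known to lie in the strip only if both are nonempty, because the abscissas of one are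
   bounded through those of the other. If one is empty, both sides vanish. *)
have [[n1 n2]|/empty_case h] := pselect (B1 !=set0 /\ B2 !=set0); last first.
  by rewrite /upper_event; have [-> ->] := h (avoid X (above (t * a) (t * b)));
    rewrite measure0 mul0r.
have dis z : above (t * a) (t * b) z -> ~ B1 z /\ ~ B2 z.
  move=> /and4P[z0 z1 z2 hz]; split=> Bz.
    have [q qB] := n2; have [p0 pq q1 _ _] := admissible_separated z q Bz qB.
    have [/andP[_ l0] /andP[_ l1]] := hl _ _ Bz qB.
    have z01 : 0 <= z.1 <= 1 by rewrite z0.
    have := line_at_le z q _ _ z.1 pq z01 l0 l1.
    by rewrite line_at_left// leNgt => /negP.
  have [p pB] := n1; have [p0 pq q1 _ _] := admissible_separated p z pB Bz.
  have [/andP[_ l0] /andP[_ l1]] := hl _ _ pB Bz.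
  have z01 : 0 <= z.1 <= 1 by rewrite z0.
  have := line_at_le p z _ _ z.1 pq z01 l0 l1.
  by rewrite line_at_right// leNgt => /negP.
rewrite /upper_event (probability_hits_avoid _ _ _ _ XP (stable_intensity_ge0 alpha alpha01))//.
- rewrite stable_intensity_above//= lee_fin -/m1 -/m2; apply: ler_wpM2r; first exact: expR_ge0.
  have le1 x : 1 - expR (- x) <= x by have := expR_ge1Dx (- x); lra.
  have ge0 x : 0 <= x -> 0 <= 1 - expR (- x).
    by move=> x0; rewrite subr_ge0 -expR0 ler_expR oppr_le0.
  by apply: ler_pM; [exact: ge0 h1|exact: ge0 h2|exact: le1|exact: le1].
- exact: measurable_above.
- exact: strip1.
- exact: strip2.
- exact: supgraph_strip.
- by rewrite e1 ltry.
- by rewrite e2 ltry.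
- exact: above_fin.
- by rewrite -subset0 => z [z1 /dis[]].
- by rewrite -subset0 => z [z1 /dis[]].
Qed.

Lemma probability_lower_event :
  ((t ^- 2 * (m1 * m2 * expR (- line_mass alpha (a / t) (b / t))))%:E
   <= P lower_event)%E.
Proof.
have [a0 b0 _ hl _] := adm; have [e1 e2 /andP[h1 g1] /andP[h2 g2]] := admissible_mass.
have at0 := divr_gt0 a0 t0; have bt0 := divr_gt0 b0 t0.
have [[n1 n2]|/empty_case h] := pselect (B1 !=set0 /\ B2 !=set0); last first.
  have [_ ->] := h setT; by rewrite mul0r mulr0 measure_ge0.
set D := above (a / t) (b / t) `\` (B1 `|` B2).
have mD : measurable D.
  by apply: measurableD; [exact: measurable_above|exact: measurableU].
have Dle : (nu D <= nu (above (a / t) (b / t)))%E.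
  by apply: stable_intensity_le => //; [exact: measurable_above|exact: subDsetl].
have Dfin : (nu D < +oo)%E by apply: le_lt_trans Dle _; exact: above_fin.
rewrite /lower_event (probability_hits_avoid _ _ _ _ XP (stable_intensity_ge0 alpha alpha01))//.
- rewrite lee_fin -/m1 -/m2.
  (* 1 - exp(- x) is at least x/(1 + x), and 1 + x <= t: this is the purpose of the bound t - 1 on
     the masses in [admissible]. *)
  have hx x : 0 <= x -> x <= t - 1 -> x / t <= 1 - expR (- x).
    move=> x0 xt; rewrite expRN.
    have hE : 1 + x <= expR x by exact: expR_ge1Dx.
    have E0 : 0 < expR x by exact: expR_gt0.
    have : (expR x)^-1 <= (1 + x)^-1 by rewrite lef_pV2 ?posrE//; lra.
    have : x / t <= 1 - (1 + x)^-1.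
      have -> : 1 - (1 + x)^-1 = x / (1 + x) by field; rewrite gt_eqF//; lra.
      by apply: ler_wpM2l => //; rewrite lef_pV2 ?posrE//; lra.
    by lra.
  have -> : t ^- 2 * (m1 * m2 * expR (- line_mass alpha (a / t) (b / t))) =
      (m1 / t) * (m2 / t) * expR (- line_mass alpha (a / t) (b / t)).
    by field; rewrite gt_eqF.
  have d0 x : 0 <= x -> 0 <= x / t by move=> x0; rewrite divr_ge0// ltW.
  apply: ler_pM.
  + by apply: mulr_ge0; exact: d0.
  + exact: expR_ge0.
  + by apply: ler_pM; rewrite ?d0// hx.
  + rewrite ler_expR lerN2 -lee_fin fineK ?ge0_fin_numE ?stable_intensity_ge0//.
    by rewrite -(stable_intensity_above alpha)//.
- exact: strip1.
- exact: strip2.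
- by move=> z [+ _]; exact: supgraph_strip.
- by rewrite e1 ltry.
- by rewrite e2 ltry.
- by rewrite -subset0 => z [z1 [_]]; apply; left.
- by rewrite -subset0 => z [z1 [_]]; apply; right.
Qed.

Let line_gt0 p q : B1 p -> B2 q -> 0 < line_at p q 0 /\ 0 < line_at p q 1.
Proof.
move=> pB qB; have [a0 b0 _ /(_ p q pB qB)[/andP[l0 _] /andP[l1 _]] _] := adm.
by split; [exact: lt_le_trans l0|exact: lt_le_trans l1].
Qed.

Lemma edge_kernel_admissible s p q : B1 p -> B2 q -> edge_kernel alpha s p q =
  stable_density alpha p * stable_density alpha q *
  expR (- (s * line_mass alpha (line_at p q 0) (line_at p q 1))).
Proof.
move=> pB qB; have [p0 pq q1 p2 q2] := admissible_separated p q pB qB.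
have [l0 l1] := line_gt0 p q pB qB.
rewrite /edge_kernel p0 pq q1 p2 q2 l0 l1/= mul1r /stable_density.
by rewrite powRM ?(ltW p2) ?(ltW q2)//; ring.
Qed.

Lemma upper_mass_le p q : B1 p -> B2 q ->
  expR (- line_mass alpha (t * a) (t * b)) <=
  expR (- (t `^ (- alpha) * line_mass alpha (line_at p q 0) (line_at p q 1))).
Proof.
move=> pB qB; have [a0 b0 _ /(_ p q pB qB)[/andP[l0 _] /andP[l1 _]] _] := adm.
rewrite ler_expR lerN2 line_mass_scale ?(ltW a0) ?(ltW b0)//.
by apply: ler_wpM2l; [exact: powR_ge0|exact: line_mass_le].
Qed.

Lemma lower_mass_ge p q : B1 p -> B2 q ->
  expR (- (t `^ (2 * alpha) * line_mass alpha (line_at p q 0) (line_at p q 1))) <=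
  expR (- line_mass alpha (a / t) (b / t)).
Proof.
move=> pB qB; have [a0 b0 _ /(_ p q pB qB)[/andP[_ l0] /andP[_ l1]] _] := adm.
have [p0 p1] := line_gt0 p q pB qB.
rewrite ler_expR lerN2.
(* Monotonicity compares the actual heights with their upper bounds t a and t b; lowering these to
   a/t and b/t costs a factor t^2, hence the exponent 2 alpha. *)
have -> : a / t = t ^- 2 * (t * a) by field; rewrite gt_eqF.
have -> : b / t = t ^- 2 * (t * b) by field; rewrite gt_eqF.
have ta := mulr_gt0 t0 a0; have tb := mulr_gt0 t0 b0.
rewrite line_mass_scale ?(ltW ta) ?(ltW tb)// ?invr_gt0 ?exprn_gt0//.
have -> : (t ^- 2) `^ (- alpha) = t `^ (2 * alpha).
  rewrite powRN_inv powRN invrK -powR_mulrn ?(ltW t0)// -powRrM.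
  by [].
by apply: ler_wpM2l; [exact: powR_ge0|exact: line_mass_le].
Qed.

(** An atom on or above a line from [B1] to [B2] lies strictly above the line of heights a/t and
    b/t; dividing by t > 1 supplies the strict inequality that [inner_edge_between] asks for. *)
Lemma lower_event_edge w : regular_atoms (fun k => X k w) -> lower_event w ->
  exists s r, let C := least_concave_majorant (fun k => X k w) in
  [/\ inner_edges (fun k => X k w) (s, r), B1 (s, C s) & B2 (r, C r)].
Proof.
move=> xreg [[/existsNP[i /contrapT Bi] /existsNP[j /contrapT Bj]] av].
have [a0 b0 [c [hc1 hc2]] hl _] := adm.
apply: (inner_edge_between _ xreg B1 B2 c) => //.
- by move=> p /hc1[].
- by move=> p /hc2[].
- by exists i.
- by exists j.
move=> k p q pB qB kN1 kN2; rewrite ltNge; apply/negP => hk; apply: (av k).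
have [u0 u1 v0] := atom_strip alpha P X XP k w.
split; last by case.
apply/and4P; split => //; apply: lt_le_trans hk.
have [_ pq _ _ _] := admissible_separated p q pB qB.
have [/andP[l0 _] /andP[l1 _]] := hl p q pB qB.
have u01 : 0 <= (X k w).1 <= 1 by rewrite u0.
apply: lt_le_trans (line_at_ge p q a b _ pq u01 l0 l1).
have -> : a / t * (1 - (X k w).1) + b / t * (X k w).1 =
  (a * (1 - (X k w).1) + b * (X k w).1) / t by ring.
by rewrite ltr_pdivrMr// ltr_pMr// chord_gt0.
Qed.

Lemma edge_upper_event w s r : regular_atoms (fun k => X k w) ->
  let C := least_concave_majorant (fun k => X k w) in
  inner_edges (fun k => X k w) (s, r) -> B1 (s, C s) -> B2 (r, C r) -> upper_event w.
Proof.
move=> xreg C hE h1 h2.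
have [[i iE] [j jE] _ _ dom] := inner_edge_line _ xreg s r hE.
have [_ _ _ hl _] := adm.
split; first split.
- by move=> /(_ i); apply; rewrite iE.
- by move=> /(_ j); apply; rewrite jE.
move=> k /and4P[u0 u1 v0]; apply/negP; rewrite -leNgt; apply: le_trans (dom k) _.
have [_ pq _ _ _] := admissible_separated _ _ h1 h2.
have [/andP[_ l0] /andP[_ l1]] := hl _ _ h1 h2.
by apply: line_at_le => //; rewrite u0.
Qed.

End admissible_pair.
End box_pairs.

(** * Counting over a finite family of disjoint boxes *)

Section box_family.
Context {R : realType} {d : measure_display} {Om : measurableType d}.
Local Notation mu := (@lebesgue_measure R).
Local Notation mu2 := (product_sigma_finite mu mu).
Local Notation mu4 := (product_sigma_finite mu2 mu2).
Implicit Types (a b c : R) (p q : R * R) (w : Om) (B : set (R * R)) (z : (R * R) * (R * R)).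
Variables (alpha : R) (P : probability Om R) (X : nat -> Om -> R * R).
Hypothesis alpha01 : 0 < alpha < 1.
Hypothesis XP : poisson_point_process P (strip R) (stable_intensity alpha) X.
Local Notation nu := (stable_intensity alpha).
Local Notation dens := (stable_density alpha).
Let mX k : measurable_fun setT (X k). Proof. by case: XP. Qed.
Variables (t : R) (I : finType) (Bx : I -> set (R * R)).
Hypothesis t1 : 1 < t.
Hypothesis mBx : forall i, measurable (Bx i).
Hypothesis tBx : trivIset setT Bx.
Let t0 : 0 < t. Proof. by rewrite (lt_trans _ t1). Qed.

Definition admissible_pairs : {set I * I} :=
  [set s | `[< exists ab, admissible alpha t (Bx s.1) (Bx s.2) ab.1 ab.2 >]].

Definition heights (s : I * I) : R * R :=
  xget (0, 0) [set ab | admissible alpha t (Bx s.1) (Bx s.2) ab.1 ab.2].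

Lemma admissible_heights s : s \in admissible_pairs ->
  admissible alpha t (Bx s.1) (Bx s.2) (heights s).1 (heights s).2.
Proof. by rewrite inE => /asboolP[ab h]; rewrite /heights; case: xgetP => [y _//|/(_ ab)]. Qed.

Definition upper_ev s := upper_event X t (Bx s.1) (Bx s.2) (heights s).1 (heights s).2.
Definition lower_ev s := lower_event X t (Bx s.1) (Bx s.2) (heights s).1 (heights s).2.

Definition upper_count w : R := \sum_(s in admissible_pairs) \1_(upper_ev s) w.
Definition lower_count w : R := \sum_(s in admissible_pairs) \1_(lower_ev s) w.
(** As the boxes are disjoint, this is the indicator of the pairs of points that lie in an
    admissible pair of boxes. *)
Definition cover z : R :=
  \sum_(s in admissible_pairs) (\1_(Bx s.1) z.1 * \1_(Bx s.2) z.2).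

Lemma box_inj i j p : Bx i p -> Bx j p -> i = j.
Proof. by move=> ip jp; apply: (tBx i j) => //; exists p. Qed.

Let measurable_upper_ev s : measurable (upper_ev s).
Proof. exact: (measurable_upper_event alpha P X XP). Qed.
Let measurable_lower_ev s : measurable (lower_ev s).
Proof. exact: (measurable_lower_event alpha P X XP). Qed.

Let term_ge0 c (B1 B2 : set (R * R)) z : 0 <= c ->
  0 <= c * (\1_B1 z.1 * \1_B2 z.2 * (dens z.1 * dens z.2)).
Proof.
move=> c0; apply: mulr_ge0 => //; apply: mulr_ge0; first exact: mulr_ge0.
by apply: mulr_ge0; exact: stable_density_ge0.
Qed.

Let measurable_term c (B1 B2 : set (R * R)) : measurable B1 -> measurable B2 ->
  measurable_fun setT (fun z => (c * (\1_B1 z.1 * \1_B2 z.2 * (dens z.1 * dens z.2)))%:E).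
Proof.
move=> m1 m2; measurable_real; try (apply: measurable_stable_density; measurable_real).
- by apply: (measurableT_comp _ measurable_fst); exact: measurable_indic.
- by apply: (measurableT_comp _ measurable_snd); exact: measurable_indic.
Qed.

Lemma integral_box_pair c (B1 B2 : set (R * R)) : 0 <= c ->
  measurable B1 -> measurable B2 ->
  (\int[mu4]_z (c * (\1_B1 z.1 * \1_B2 z.2 * (dens z.1 * dens z.2)))%:E
   = c%:E * (nu B1 * nu B2))%E.
Proof.
move=> c0 m1 m2; rewrite product_tonelli//=; last 2 first.
- exact: measurable_term.
- by move=> z; rewrite lee_fin; exact: term_ge0.
have md B : measurable B -> measurable_fun setT (fun q => (\1_B q * dens q)%:E).
  by move=> mB; measurable_real; [exact: measurable_indic|exact: measurable_stable_density].
have d0 B q : 0 <= \1_B q * dens q by apply: mulr_ge0 => //; exact: stable_density_ge0.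
transitivity (\int[mu2]_p ((c%:E * nu B2) * (\1_B1 p * dens p)%:E))%E.
  apply: eq_integral => p _.
  transitivity (\int[mu2]_q ((c * (\1_B1 p * dens p))%:E * (\1_B2 q * dens q)%:E))%E.
    by apply: eq_integral => q _; rewrite -EFinM; congr EFin; ring.
  rewrite ge0_integralZl//=; last 3 first.
  - exact: md.
  - by move=> q _; rewrite lee_fin.
  - by rewrite lee_fin; exact: mulr_ge0.
  by rewrite -stable_intensityE EFinM -!muleA; congr (_ * _)%E; rewrite muleC.
rewrite ge0_integralZl//=; last 3 first.
- exact: md.
- by move=> q _; rewrite lee_fin.
- by rewrite mule_ge0// stable_intensity_ge0.
by rewrite -stable_intensityE -muleA; congr (_ * _)%E; rewrite muleC.
Qed.

Let integral_indicator_sum (ev : I * I -> set Om) : (forall s, measurable (ev s)) ->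
  (\int[P]_w (\sum_(s in admissible_pairs) \1_(ev s) w)%:E
   = \sum_(s in admissible_pairs) P (ev s))%E.
Proof.
move=> mev; under eq_integral do rewrite -sumEFin -big_enum.
rewrite ge0_integral_sum//.
  rewrite big_enum/=; apply: eq_bigr => s _.
  by rewrite integral_indic// setIT.
by move=> s; measurable_real; exact: measurable_indic.
Qed.

Let sum_box_pairs (c : I * I -> R) : (forall s, 0 <= c s) ->
  (\sum_(s in admissible_pairs)
     (c s * (fine (nu (Bx s.1)) * fine (nu (Bx s.2))))%:E
   = \int[mu4]_z (\sum_(s in admissible_pairs)
       c s * (\1_(Bx s.1) z.1 * \1_(Bx s.2) z.2 * (dens z.1 * dens z.2)))%:E)%E.
Proof.
move=> c0; under [RHS]eq_integral do rewrite -sumEFin -big_enum.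
rewrite ge0_integral_sum//; last 2 first.
- by move=> s; exact: measurable_term.
- by move=> s z _; rewrite lee_fin; exact: term_ge0.
rewrite big_enum/=; apply: eq_bigr => s /admissible_heights adm.
by have [-> -> _ _] := admissible_mass alpha alpha01 _ _ _ _ _ adm; rewrite integral_box_pair//;
  have [-> -> _ _] := admissible_mass alpha alpha01 _ _ _ _ _ adm; rewrite -!EFinM.
Qed.

Let measurable_sum_box_pairs (c : I * I -> R) :
  measurable_fun setT (fun z => (\sum_(s in admissible_pairs)
       c s * (\1_(Bx s.1) z.1 * \1_(Bx s.2) z.2 * (dens z.1 * dens z.2)))%:E).
Proof.
under eq_fun do rewrite -sumEFin -big_enum.
by apply: emeasurable_sum => s; exact: measurable_term.
Qed.

Let measurable_kernel c :
  measurable_fun setT (fun z => (edge_kernel alpha c z.1 z.2)%:E).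
Proof. by apply/measurable_EFinP; apply: measurable_edge_kernel; measurable_real. Qed.

Lemma measurable_cover : measurable_fun setT cover.
Proof.
rewrite /cover; under eq_fun do rewrite -big_enum.
apply: measurable_sum => s; apply: measurable_funM.
  by apply: (measurableT_comp _ measurable_fst); exact: measurable_indic.
by apply: (measurableT_comp _ measurable_snd); exact: measurable_indic.
Qed.

(** Each product of masses is the integral of the two densities over the pair of boxes, where the
    constant exponential is at most that of the kernel with parameter t^(- alpha). Disjointness
    leaves at most one nonzero term at each pair of points. *)
Lemma upper_count_mean : (\int[P]_w (upper_count w)%:E <=
  \int[mu4]_z (edge_kernel alpha (t `^ (- alpha)) z.1 z.2)%:E)%E.
Proof.
rewrite /upper_count integral_indicator_sum//.
pose c s := expR (- line_mass alpha (t * (heights s).1) (t * (heights s).2)).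
apply: (@le_trans _ _ (\sum_(s in admissible_pairs)
     (c s * (fine (nu (Bx s.1)) * fine (nu (Bx s.2))))%:E)%E).
  apply: lee_sum => s /admissible_heights adm; rewrite [c s * _]mulrC.
  exact: (probability_upper_event alpha P X alpha01 XP t _ _ _ _ t1).
rewrite sum_box_pairs => [|s]; last exact: expR_ge0.
apply: ge0_le_integral => //.
- move=> z _; rewrite lee_fin sumr_ge0// => s _.
  by apply: term_ge0; exact: expR_ge0.
- exact: measurable_sum_box_pairs.
- exact: measurable_kernel.
move=> z _; rewrite lee_fin.
have [[s0 [adm0 z1 z2]]|h] := pselect (exists s, [/\ s \in admissible_pairs,
    Bx s.1 z.1 & Bx s.2 z.2]); last first.
  rewrite big1 ?edge_kernel_ge0// => s adm; rewrite !indicE.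
  case: (boolP (z.1 \in _)) => [/set_mem h1|_]; last by rewrite !mul0r mulr0.
  case: (boolP (z.2 \in _)) => [/set_mem h2|_]; last by rewrite mulr0 mul0r mulr0.
  by case: h; exists s.
rewrite (bigD1 s0)//= big1 ?addr0; last first.
  move=> s /andP[_ ss0]; rewrite !indicE.
  case: (boolP (z.1 \in _)) => [/set_mem h1|_]; last by rewrite !mul0r mulr0.
  case: (boolP (z.2 \in _)) => [/set_mem h2|_]; last by rewrite mulr0 mul0r mulr0.
  move: ss0; rewrite [s]surjective_pairing [s0]surjective_pairing.
  by rewrite (box_inj _ _ _ h1 z1) (box_inj _ _ _ h2 z2) eqxx.
have adm := admissible_heights s0 adm0.
rewrite !indicE !mem_set// !mul1r (edge_kernel_admissible alpha _ _ _ _ _ adm)//.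
rewrite mulrC; apply: ler_wpM2l; first by apply: mulr_ge0; exact: stable_density_ge0.
exact: (upper_mass_le alpha alpha01 _ _ _ _ _ t1 adm).
Qed.

(** The same comparison from below, restricted to the pairs of points that are covered; the loss
    t^(-2) comes from the hitting probabilities of the two boxes. *)
Lemma lower_count_mean : (\int[mu4]_z
    (cover z * (t ^- 2 * edge_kernel alpha (t `^ (2 * alpha)) z.1 z.2))%:E
  <= \int[P]_w (lower_count w)%:E)%E.
Proof.
rewrite /lower_count integral_indicator_sum//.
pose c s := t ^- 2 * expR (- line_mass alpha ((heights s).1 / t) ((heights s).2 / t)).
have c0 s : 0 <= c s by rewrite mulr_ge0 ?expR_ge0// invr_ge0 exprn_ge0// ltW.
apply: (@le_trans _ _ (\sum_(s in admissible_pairs)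
     (c s * (fine (nu (Bx s.1)) * fine (nu (Bx s.2))))%:E)%E); last first.
  apply: lee_sum => s /admissible_heights adm.
  apply: le_trans (probability_lower_event alpha P X alpha01 XP t _ _ _ _ t1 _ _ adm) => //.
  by rewrite lee_fin le_eqVlt; apply/orP; left; apply/eqP; rewrite /c; ring.
rewrite sum_box_pairs//; apply: ge0_le_integral => //.
- move=> z _; rewrite lee_fin mulr_ge0//.
    by rewrite sumr_ge0// => s _; rewrite mulr_ge0.
  by rewrite mulr_ge0 ?edge_kernel_ge0// invr_ge0 exprn_ge0// ltW.
- have mc := measurable_cover.
  by measurable_real => //; apply: measurable_edge_kernel; measurable_real.
- exact: measurable_sum_box_pairs.
move=> z _; rewrite lee_fin /cover mulr_suml; apply: ler_sum => s /admissible_heights adm.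
rewrite !indicE.
case: (boolP (z.1 \in _)) => [/set_mem h1|_]; last by rewrite !mul0r mulr0.
case: (boolP (z.2 \in _)) => [/set_mem h2|_]; last by rewrite mulr0 !mul0r mulr0.
rewrite !mul1r (edge_kernel_admissible alpha _ _ _ _ _ adm)// /c -[X in _ <= X]mulrA.
apply: ler_wpM2l; first by rewrite invr_ge0 exprn_ge0// ltW.
rewrite [X in _ <= X]mulrC; apply: ler_wpM2l; first by apply: mulr_ge0; exact: stable_density_ge0.
exact: (lower_mass_ge alpha alpha01 _ _ _ _ _ t1 adm).
Qed.

Lemma cover_ge1 z s : s \in admissible_pairs -> Bx s.1 z.1 -> Bx s.2 z.2 -> 1 <= cover z.
Proof.
move=> adm h1 h2; rewrite /cover (bigD1 s)//= !indicE !mem_set// mul1r lerDl.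
by apply: sumr_ge0 => s' _; rewrite mulr_ge0.
Qed.

Lemma cover_ge0 z : 0 <= cover z.
Proof. by apply: sumr_ge0 => s' _; rewrite mulr_ge0. Qed.

Section counting.
Variable w : Om.
Hypothesis xreg : regular_atoms (fun k => X k w).
Local Notation x := (fun k => X k w).
Local Notation C := (least_concave_majorant x).

Let countE (ev : I * I -> set Om) :
  \sum_(s in admissible_pairs) \1_(ev s) w
  = (size [seq s <- enum admissible_pairs | w \in ev s])%:R :> R.
Proof.
rewrite -big_enum size_filter -sum1_count natr_sum [RHS]big_mkcond/=.
by apply: eq_bigr => s _; rewrite indicE; case: (w \in ev s).
Qed.

(** Choosing an edge for each pair of boxes whose lower event occurs is injective, because an end
    point lies in at most one box. *)
Lemma lower_count_le : lower_count w <= #|` fset_set (inner_edges x)|%:R.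
Proof.
rewrite /lower_count countE ler_nat; set D := [seq _ <- _ | _].
have hD s : s \in D -> exists e, [/\ inner_edges x e, Bx s.1 (e.1, C e.1)
    & Bx s.2 (e.2, C e.2)].
  rewrite mem_filter mem_enum => /andP[/set_mem hs /admissible_heights adm].
  have [u [v h]] := lower_event_edge alpha P X XP t _ _ _ _ t1 adm w xreg hs.
  by exists (u, v).
pose g s := xget (0, 0) [set e | [/\ inner_edges x e, Bx s.1 (e.1, C e.1)
    & Bx s.2 (e.2, C e.2)]].
have gP s : s \in D -> [/\ inner_edges x (g s), Bx s.1 ((g s).1, C (g s).1)
    & Bx s.2 ((g s).2, C (g s).2)].
  by move=> /hD[e he]; rewrite /g; case: xgetP => [y _//|/(_ e)].
have uD : uniq D by apply: filter_uniq; exact: enum_uniq.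
rewrite -(size_map g); apply: uniq_leq_size.
  rewrite map_inj_in_uniq// => s s' /gP[_ h1 h2] /gP[_ h1' h2'] gE.
  rewrite gE in h1 h2; rewrite [s]surjective_pairing [s']surjective_pairing.
  by rewrite (box_inj _ _ _ h1 h1') (box_inj _ _ _ h2 h2').
move=> _ /mapP[s /gP[gs _ _] ->].
have : g s \in fset_set (inner_edges x) by rewrite in_fset_set ?mem_set//; exact: finite_inner_edges.
by [].
Qed.

(** Edges are mapped to pairs of boxes. Two edges in the same admissible pair coincide: all left
    ends precede all right ends, so their linearity intervals overlap. *)
Lemma upper_count_ge : (forall e, inner_edges x e -> exists s,
    [/\ s \in admissible_pairs, Bx s.1 (e.1, C e.1) & Bx s.2 (e.2, C e.2)]) ->
  #|` fset_set (inner_edges x)|%:R <= upper_count w.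
Proof.
move=> cov; rewrite /upper_count countE ler_nat; set D := [seq _ <- _ | _].
have finE := finite_inner_edges x xreg.
have [[e0 /cov[s0 _]]|noE] := pselect (exists e, inner_edges x e); last first.
  rewrite (_ : inner_edges x = set0) ?fset_set0 ?cardfs0//.
  by rewrite -subset0 => e he; apply: noE; exists e.
pose h e := xget s0 [set s | [/\ s \in admissible_pairs, Bx s.1 (e.1, C e.1)
  & Bx s.2 (e.2, C e.2)]].
have hP e : inner_edges x e ->
    [/\ h e \in admissible_pairs, Bx (h e).1 (e.1, C e.1) & Bx (h e).2 (e.2, C e.2)].
  by move=> /cov[s hs]; rewrite /h; case: xgetP => [y _//|/(_ s)].
have inE e : e \in fset_set (inner_edges x) -> inner_edges x e.
  by rewrite in_fset_set// => /set_mem.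
rewrite -(size_map h); apply: uniq_leq_size.
  rewrite map_inj_in_uniq ?fset_uniq// => -[s r] [s' r'] /inE he /inE he' hh.
  have [adm h1 h2] := hP _ he; have [_ h1' h2'] := hP _ he'.
  rewrite -hh in h1' h2'; rewrite /= in h1 h2 h1' h2'.
  have adm' := admissible_heights _ adm.
  have [_ sr' _ _ _] := admissible_separated alpha t _ _ _ _ adm' _ _ h1 h2'.
  have [_ s'r _ _ _] := admissible_separated alpha t _ _ _ _ adm' _ _ h1' h2.
  have [/= s_0 sr r1 L] := he; have [/= s'0 s'r' r'1 L'] := he'.
  have E : `[s, r]%classic = `[s', r']%classic.
    apply: (linearity_interval_eq C _ _ (Num.max s s') (Num.min r r') L L');
      rewrite ?gt_max ?lt_min ?sr ?s'r ?sr' ?s'r'//= in_itv/= ?le_max ?ge_max ?le_min ?ge_min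
        ?lexx ?orbT ?(ltW sr) ?(ltW s'r) ?(ltW sr') ?(ltW s'r')//.
  by have [-> ->] := itvcc_inj _ _ _ _ (ltW sr) E.
move=> _ /mapP[e /inE he ->]; have [adm h1 h2] := hP _ he.
rewrite mem_filter mem_enum adm andbT; apply/mem_set.
exact: (edge_upper_event alpha X t _ _ _ _ (admissible_heights _ adm) w _ _ xreg he h1 h2).
Qed.
End counting.
End box_family.

(** * The grid of square cells *)

Section grid.
Context {R : realType}.
Local Notation mu := (@lebesgue_measure R).
Local Notation mu2 := (product_sigma_finite mu mu).
Implicit Types (a b c t : R) (p q z : R * R).

(** The cells have side 1/(n+1), so that (n+1)^2 of them per axis fill [0, n+1): the mesh shrinks
    while the grid eventually contains any given ordinate. *)
Definition grid_index n : finType := ('I_(n.+1 ^ 2) * 'I_(n.+1 ^ 2))%type.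

Definition grid_box n (i : grid_index n) : set (R * R) :=
  [set z | [&& i.1%:R <= n.+1%:R * z.1, n.+1%:R * z.1 < i.1.+1%:R,
               i.2%:R <= n.+1%:R * z.2 & n.+1%:R * z.2 < i.2.+1%:R]].

Lemma measurable_grid_box n i : measurable (grid_box n i).
Proof. by apply: measurable_set_bool; measurable_real. Qed.

Let nat_cell (i j : nat) (y : R) : i%:R <= y -> y < j.+1%:R -> (i <= j)%N.
Proof. by move=> iy yj; rewrite -ltnS -(ltr_nat R) (le_lt_trans iy). Qed.

Lemma trivIset_grid_box n : trivIset setT (grid_box n).
Proof.
move=> [i1 i2] [j1 j2] _ _ [z [/and4P[/= h1 h2 h3 h4] /and4P[/= k1 k2 k3 k4]]].
congr pair; apply/val_inj/eqP; rewrite eqn_leq /=.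
  by rewrite (nat_cell _ _ _ h1 k2) (nat_cell _ _ _ k1 h2).
by rewrite (nat_cell _ _ _ h3 k4) (nat_cell _ _ _ k3 h4).
Qed.

Lemma grid_box_cover n z : 0 <= z.1 < n.+1%:R -> 0 <= z.2 < n.+1%:R ->
  exists i, grid_box n i z.
Proof.
have cell (y : R) : 0 <= y < n.+1%:R ->
    exists i : 'I_(n.+1 ^ 2), i%:R <= n.+1%:R * y /\ n.+1%:R * y < i.+1%:R.
  move=> /andP[y0 yn]; have h0 : 0 <= n.+1%:R * y by rewrite mulr_ge0.
  have /andP[h1 h2] := truncn_itv h0.
  have lt : (Num.truncn (n.+1%:R * y) < n.+1 ^ 2)%N.
    rewrite -(ltr_nat R); apply: le_lt_trans h1 _.
    by rewrite natrX expr2 ltr_pM2l.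
  by exists (Ordinal lt).
move=> /cell[i [h1 h2]] /cell[j [h3 h4]]; exists (i, j).
by apply/and4P.
Qed.

Lemma grid_box_diameter n i z z' : grid_box n i z -> grid_box n i z' ->
  `|z.1 - z'.1| < n.+1%:R^-1 /\ `|z.2 - z'.2| < n.+1%:R^-1.
Proof.
have n0 : 0 < n.+1%:R :> R by [].
have cell (k : nat) (y y' : R) : k%:R <= n.+1%:R * y -> n.+1%:R * y < k.+1%:R ->
    k%:R <= n.+1%:R * y' -> n.+1%:R * y' < k.+1%:R -> `|y - y'| < n.+1%:R^-1.
  rewrite -(natr1 k) => h1 h2 h3 h4; rewrite -(@ltr_pM2l _ n.+1%:R)// divff ?gt_eqF//.
  by rewrite -{1}(gtr0_norm n0) -normrM ltr_norml; apply/andP; split; lra.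
move=> /and4P[h1 h2 h3 h4] /and4P[k1 k2 k3 k4].
by split; [exact: (cell i.1)|exact: (cell i.2)].
Qed.

Lemma grid_box_area n i : mu2 (grid_box n i) = (n.+1%:R^-1 ^+ 2)%:E.
Proof.
have n0 : 0 < n.+1%:R :> R by [].
have len (k : nat) : mu `[k%:R / n.+1%:R, k.+1%:R / n.+1%:R[%classic = (n.+1%:R^-1)%:E.
  rewrite lebesgue_measure_itv/= lte_fin ltr_pM2r ?invr_gt0// ltr_nat ltnSn.
  by rewrite -EFinB -mulrBl -natr1 addrC addKr mul1r.
rewrite (_ : grid_box n i = `[i.1%:R / n.+1%:R, i.1.+1%:R / n.+1%:R[%classic `*`
    `[i.2%:R / n.+1%:R, i.2.+1%:R / n.+1%:R[%classic); last first.
  apply/seteqP; split=> z.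
    move=> /and4P[h1 h2 h3 h4]; split; rewrite /= in_itv/= ler_pdivrMr// ltr_pdivlMr//
      mulrC; by apply/andP.
  move=> [/=]; rewrite !in_itv/= !ler_pdivrMr// !ltr_pdivlMr// ![_ * n.+1%:R]mulrC.
  by move=> /andP[? ?] /andP[? ?]; apply/and4P.
transitivity ((n.+1%:R^-1)%:E * (n.+1%:R^-1)%:E : \bar R)%E; last by rewrite -EFinM expr2.
by rewrite [LHS]product_measure1E//; congr (_ * _)%E; exact: len.
Qed.

Variable alpha : R.
Hypothesis alpha01 : 0 < alpha < 1.
Let alpha0 : 0 < alpha. Proof. by case/andP: alpha01. Qed.

Lemma grid_box_mass n i v : 0 < v -> (forall z, grid_box n i z -> v <= z.2) ->
  (stable_intensity alpha (grid_box n i)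
   <= (alpha * v `^ (- (alpha + 1)) * n.+1%:R^-1 ^+ 2)%:E)%E.
Proof.
move=> v0 hv; have mB := measurable_grid_box n i.
have M0 : 0 <= alpha * v `^ (- (alpha + 1)) by rewrite mulr_ge0 ?powR_ge0// ltW.
rewrite EFinM -(grid_box_area n i) -integral_cst//; apply: ge0_le_integral => //.
- by move=> z _; rewrite lee_fin; exact: (stable_density_ge0 alpha alpha01).
- by apply: measurable_funTS; measurable_real; apply: (measurable_stable_density alpha).
- move=> z /hv hz; rewrite lee_fin; apply: ler_wpM2l; first exact: ltW.
  rewrite !powRN lef_pV2 ?posrE ?powR_gt0//; last exact: lt_le_trans hz.
  by apply: ge0_ler_powR; rewrite ?nnegrE ?(ltW v0)// ?addr_ge0 ?(ltW alpha0)// (le_trans (ltW v0)).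
Qed.

Lemma near_admissible t p q : 1 < t -> 0 < p.1 -> p.1 < q.1 -> q.1 < 1 ->
  0 < p.2 -> 0 < q.2 -> 0 < line_at p q 0 -> 0 < line_at p q 1 ->
  exists a b c, [/\ 0 < a, 0 < b &
    \forall z \near (p, q), [/\ [/\ 0 < z.1.1, z.1.1 < c & 0 < z.1.2],
      [/\ c < z.2.1, z.2.1 < 1 & 0 < z.2.2],
      a <= line_at z.1 z.2 0 <= t * a & b <= line_at z.1 z.2 1 <= t * b]].
Proof.
move=> t1 p1 pq q1 p2 q2 l0 l1; have t0 : 0 < 1 + t by lra.
(* 2/(1 + t) lies strictly between 1/t and 1, so the height [l] is strictly inside the interval from
   the lower bound to [t] times it, and nearby lines satisfy the same bounds. *)
have mid l : 0 < l -> [/\ 0 < 2 * l / (1 + t), 2 * l / (1 + t) < l & l < t * (2 * l / (1 + t))].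
  move=> hl; split; first by rewrite divr_gt0// mulr_gt0.
    by rewrite ltr_pdivrMr//; nra.
  by rewrite mulrA ltr_pdivlMr//; nra.
have [a0 al la] := mid _ l0; have [b0 bl lb] := mid _ l1.
set a := 2 * _ / _ in a0 al la; set b := 2 * _ / _ in b0 bl lb.
exists a, b, ((p.1 + q.1) / 2); split => //; set c := _ / 2.
have pc : p.1 < c by rewrite /c; lra.
have cq : c < q.1 by rewrite /c; lra.
have cf : z.1 @[z --> (p, q)] --> p by exact: cvg_fst.
have cs : z.2 @[z --> (p, q)] --> q by exact: cvg_snd.
have fst_cont (y : R * R) : z.1 @[z --> y] --> y.1 by case: y => y1 y2; exact: cvg_fst.
have snd_cont (y : R * R) : z.2 @[z --> y] --> y.2 by case: y => y1 y2; exact: cvg_snd.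
have c11 : z.1.1 @[z --> (p, q)] --> p.1 := cvg_comp _ _ cf (fst_cont p).
have c12 : z.1.2 @[z --> (p, q)] --> p.2 := cvg_comp _ _ cf (snd_cont p).
have c21 : z.2.1 @[z --> (p, q)] --> q.1 := cvg_comp _ _ cs (fst_cont q).
have c22 : z.2.2 @[z --> (p, q)] --> q.2 := cvg_comp _ _ cs (snd_cont q).
have cl r : line_at z.1 z.2 r @[z --> (p, q)] --> line_at p q r.
  apply: cvgM; last by apply: cvgV; [rewrite subr_eq0 gt_eqF|exact: cvgB].
  by apply: cvgD; apply: cvgM => //; apply: cvgB => //; exact: cvg_cst.
near=> z; split.
- by split; near: z; [exact: cvgr_gt c11 _ _|exact: cvgr_lt c11 _ _|exact: cvgr_gt c12 _ _].
- by split; near: z; [exact: cvgr_gt c21 _ _|exact: cvgr_lt c21 _ _|exact: cvgr_gt c22 _ _].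
- by apply/andP; split; near: z; [exact: cvgr_ge (cl 0) _ _|exact: cvgr_le (cl 0) _ _].
- by apply/andP; split; near: z; [exact: cvgr_ge (cl 1) _ _|exact: cvgr_le (cl 1) _ _].
Unshelve. all: by end_near. Qed.

Lemma eventually_admissible t p q : 1 < t -> 0 < p.1 -> p.1 < q.1 -> q.1 < 1 ->
  0 < p.2 -> 0 < q.2 -> 0 < line_at p q 0 -> 0 < line_at p q 1 ->
  \forall n \near \oo, exists s : grid_index n * grid_index n,
    [/\ s \in admissible_pairs alpha t (grid_index n) (grid_box n),
        grid_box n s.1 p & grid_box n s.2 q].
Proof.
move=> t1 p1 pq q1 p2 q2 l0 l1.
have [a [b [c [a0 b0 /nbhs_ballP[e /= e0 he]]]]] := near_admissible t p q t1 p1 pq q1 p2 q2 l0 l1.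
(* Once the mesh is below half the ordinate [v] of a point, its cell stays above v/2, where the
   density is at most [M v]. *)
pose M v := alpha * (v / 2) `^ (- (alpha + 1)).
have M0 v : 0 < v -> 0 < M v by move=> v0; rewrite mulr_gt0// powR_gt0// divr_gt0.
have inv_lt (r : R) : 0 < r -> \forall n \near \oo, n.+1%:R^-1 < r.
  move=> r0; exists (Num.truncn r^-1) => // m /= hm; rewrite invf_plt ?posrE//.
  by apply: lt_le_trans (truncnS_gt _) _; rewrite ler_nat.
near=> n.
have n0 : 0 < n.+1%:R :> R by [].
have h1 : n.+1%:R^-1 < e by near: n; exact: inv_lt.
have small (v : R) : 0 < v -> n.+1%:R^-1 < v^-1 -> v < n.+1%:R.
  by move=> v0; rewrite ltf_pV2 ?posrE.
have p2n : p.2 < n.+1%:R.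
  by apply: small => //; near: n; apply: inv_lt; rewrite invr_gt0.
have q2n : q.2 < n.+1%:R.
  by apply: small => //; near: n; apply: inv_lt; rewrite invr_gt0.
have n1 : 1 <= n.+1%:R :> R by rewrite (ler_nat R 1).
have [i ip] : exists i, grid_box n i p.
  by apply: grid_box_cover; rewrite ?p2n ?(ltW p1) ?(ltW p2)//=; lra.
have [j jq] : exists j, grid_box n j q.
  by apply: grid_box_cover; rewrite ?q2n ?(ltW q2)//=; apply/andP; split; lra.
have mass y k : grid_box n k y -> 0 < y.2 -> n.+1%:R^-1 < y.2 / 2 ->
    n.+1%:R^-1 < (t - 1) / M y.2 ->
    (stable_intensity alpha (grid_box n k) <= (t - 1)%:E)%E.
  move=> ky y0 ny nM; apply: le_trans (grid_box_mass n k (y.2 / 2) _ _) _.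
  - by rewrite divr_gt0.
  - move=> z kz; have [_] := grid_box_diameter n k y z ky kz.
    rewrite ltr_norml => /andP[_ hz]; have := lt_trans hz ny.
    by rewrite ltrBlDr -ltrBlDl => /ltW; apply: le_trans; rewrite le_eqVlt; apply/orP; left; apply/eqP; field.
  rewrite lee_fin -/(M y.2) mulrC -ler_pdivlMr ?M0//; apply: le_trans (ltW nM).
  by rewrite expr2 ger_pMl ?invr_gt0// invf_le1.
exists (i, j); split => //; rewrite inE; apply/asboolP; exists (a, b); split => //=.
- exists c; split=> y yB.
    have [d1 d2] := grid_box_diameter n i p y ip yB.
    have [] := he (y, q); first by
      split; [split; apply: lt_trans h1|exact: ballxx].
    by [].
  have [d1 d2] := grid_box_diameter n j q y jq yB.
  have [] := he (p, y); first by
    split; [exact: ballxx|split; apply: lt_trans h1].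
  by [].
- move=> y y' yB y'B.
  have [d1 d2] := grid_box_diameter n i p y ip yB.
  have [d3 d4] := grid_box_diameter n j q y' jq y'B.
  have [] := he (y, y'); first by
    split; split; apply: lt_trans h1.
  by [].
- split; [apply: (mass p)|apply: (mass q)] => //; near: n; apply: inv_lt;
    by rewrite divr_gt0// ?subr_gt0// M0.
Unshelve. all: by end_near. Qed.
End grid.

(** * The mean number of linearity intervals *)

Section limn_einf_bounds.
Context {R : realType}.
Implicit Types (u : (\bar R)^nat) (c : \bar R).

Lemma limn_einf_ge u c : (\forall n \near \oo, (c <= u n)%E) -> (c <= limn_einf u)%E.
Proof.
move=> [N _ h]; rewrite limn_einf_lim; apply: lime_ge; first exact: is_cvg_einfs.
exists N => // n /= Nn; apply: le_ereal_inf_tmp => _ [m /= nm <-].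
by apply: h; exact: leq_trans nm.
Qed.

Lemma limn_einf_le u c : (forall n, (u n <= c)%E) -> (limn_einf u <= c)%E.
Proof.
move=> h; rewrite limn_einf_lim; apply: lime_le; first exact: is_cvg_einfs.
apply: nearW => n; apply: le_trans (h n); apply: ereal_inf_lbound.
by exists n => /=.
Qed.

Lemma measurable_limn_einf d (T : measurableType d) (f : (T -> \bar R)^nat) :
  (forall n, measurable_fun setT (f n)) ->
  measurable_fun setT (fun x => limn_einf (f ^~ x)).
Proof.
move=> mf; rewrite /limn_einf.
apply: (measurableT_comp (@oppe_measurable _ setT)).
apply: (@measurable_fun_limn_esup _ _ _ _ (fun n x => - f n x)%E) => n.
exact: (measurableT_comp (@oppe_measurable _ setT)).
Qed.
End limn_einf_bounds.

Lemma near_forall_finite (T : choiceType) (A : set T) (Q : T -> nat -> Prop) :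
  finite_set A -> (forall e, A e -> \forall n \near \oo, Q e n) ->
  \forall n \near \oo, forall e, A e -> Q e n.
Proof.
move=> /finite_seqP[s ->]; elim: s => [|e s IH] h; first by apply: nearW => n e.
have h1 : \forall n \near \oo, Q e n by apply: h; rewrite /= mem_head.
have h2 : \forall n \near \oo, forall e, [set` s] e -> Q e n.
  by apply: IH => e' /= e's; apply: h; rewrite /= inE e's orbT.
near=> n; have g1 : Q e n by near: n.
have g2 : forall e, [set` s] e -> Q e n by near: n.
by move=> e'; rewrite /= inE => /predU1P[->//|e's]; exact: g2.
Unshelve. all: by end_near. Qed.

Section mean_number_of_intervals.
Context {R : realType} {d : measure_display} {Om : measurableType d}.
Local Notation mu := (@lebesgue_measure R).
Local Notation mu2 := (product_sigma_finite mu mu).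
Local Notation mu4 := (product_sigma_finite mu2 mu2).
Implicit Types (p q : R * R) (w : Om) (t : R).
Variables (alpha : R) (P : probability Om R) (X : nat -> Om -> R * R).
Hypothesis alpha01 : 0 < alpha < 1.
Hypothesis XP : poisson_point_process P (strip R) (stable_intensity alpha) X.
Let mX k : measurable_fun setT (X k). Proof. by case: XP. Qed.
Local Notation EL := (\int[P]_w num_linearity_intervals (fun k => X k w))%E.
Local Notation reg := (regular_event X).

Definition edge_constant : R := 2 * (1 - alpha) * edge_integral (1 - alpha).

Let ucount t n w := upper_count alpha X t (grid_index n) (grid_box n) w.
Let lcount t n w := lower_count alpha X t (grid_index n) (grid_box n) w.

Let integral_kernel4 c : 0 < c ->
  (\int[mu4]_z (edge_kernel alpha c z.1 z.2)%:E = (edge_constant / c ^+ 2)%:E)%E.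
Proof.
move=> c0; rewrite product_tonelli/=; last 2 first.
- by apply/measurable_EFinP; apply: measurable_edge_kernel; measurable_real.
- by move=> z; rewrite lee_fin edge_kernel_ge0.
exact: integral_edge_kernel.
Qed.

Lemma edge_constant_ge0 : 0 <= edge_constant.
Proof.
have := integral_kernel4 1 ltr01; rewrite expr1n divr1 => h.
by rewrite -lee_fin -h; apply: integral_ge0 => z _; rewrite lee_fin edge_kernel_ge0.
Qed.

Let measurable_reg : measurable reg.
Proof. exact: (measurable_regular_event alpha P X XP). Qed.

Let null_reg : P (~` reg) = 0%E.
Proof. exact: (probability_regular_event alpha P X alpha01 XP). Qed.

Let regP w : reg w -> regular_atoms (fun k => X k w).
Proof. exact: (regular_event_atoms alpha P X XP). Qed.

Let measurable_ucount t n : measurable_fun setT (fun w => (ucount t n w)%:E).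
Proof.
apply/measurable_EFinP; rewrite /ucount /upper_count.
under eq_fun do rewrite -big_enum.
apply: measurable_sum => s; apply: measurable_indic.
by apply: (measurable_upper_event alpha P X XP); exact: measurable_grid_box.
Qed.

Let measurable_lcount t n : measurable_fun setT (fun w => (lcount t n w)%:E).
Proof.
apply/measurable_EFinP; rewrite /lcount /lower_count.
under eq_fun do rewrite -big_enum.
apply: measurable_sum => s; apply: measurable_indic.
by apply: (measurable_lower_event alpha P X XP); exact: measurable_grid_box.
Qed.

Let ucount_ge0 t n w : (0 <= (ucount t n w)%:E)%E.
Proof. by rewrite lee_fin sumr_ge0. Qed.

Let lcount_ge0 t n w : (0 <= (lcount t n w)%:E)%E.
Proof. by rewrite lee_fin sumr_ge0. Qed.

Let numE w : reg w -> num_linearity_intervals (fun k => X k w) =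
  (2%:E + (#|` fset_set (inner_edges (fun k => X k w))|%:R)%:E)%E.
Proof. by move=> /regP h; rewrite num_linearity_intervalsE// natrD EFinD. Qed.

Let num_ge0 w : (0 <= num_linearity_intervals (fun k => X k w))%E.
Proof.
rewrite /num_linearity_intervals /counting; case: ifPn => _; last exact: leey.
by rewrite lee_fin.
Qed.

(** At a regular outcome there are finitely many edges, so a fine enough grid places all of them in
    admissible pairs and the upper counts eventually dominate. How fine depends on the outcome,
    hence the lower limit and Fatou's lemma. *)
Lemma mean_intervals_le t : 1 < t -> (EL <= (2 + edge_constant * t `^ (2 * alpha))%:E)%E.
Proof.
move=> t1; have t0 : 0 < t by rewrite (lt_trans _ t1).
pose F w := (2%:E + limn_einf (fun n => (ucount t n w)%:E))%E.
(* The value at infinity off the regular event makes [g] a majorant everywhere; that event has full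
   probability, so the integral is unchanged. *)
pose g w := if w \in reg then F w else +oo%E.
have F0 w : (0 <= F w)%E.
  by rewrite adde_ge0// limn_einf_ge//; apply: nearW.
have mF : measurable_fun setT F.
  apply: emeasurable_funD; first exact: measurable_cst.
  by apply: measurable_limn_einf => n; exact: measurable_ucount.
have mg : measurable_fun setT g.
  apply: (measurable_fun_ifT _ mF (measurable_cst _)).
  apply: (measurable_fun_bool true); rewrite setTI (_ : _ @^-1` _ = reg)//.
  by apply/seteqP; split=> [w /set_mem|w /mem_set].
apply: (@le_trans _ _ (\int[P]_w g w)%E).
  apply: le_integral_nonmeasurable => // w; rewrite /g; case: ifPn => [|_]; last exact: leey.
  move=> /set_mem hw; rewrite numE// leeD2l//; apply: limn_einf_ge.
  have xreg := regP w hw; have fin := finite_inner_edges _ xreg.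
  have : \forall n \near \oo, forall e, inner_edges (fun k => X k w) e -> exists s,
      [/\ s \in admissible_pairs alpha t (grid_index n) (grid_box n),
          grid_box n s.1 (e.1, least_concave_majorant (fun k => X k w) e.1)
        & grid_box n s.2 (e.2, least_concave_majorant (fun k => X k w) e.2)].
    apply: near_forall_finite => // -[u v] he.
    have [[i iE] [j jE] l0 l1 _] := inner_edge_line _ xreg u v he.
    have [/= u0 uv v1 _] := he; have [xpos _ _] := xreg.
    apply: eventually_admissible => //=.
      by have := xpos i; rewrite iE.
    by have := xpos j; rewrite jE.
  apply: filterS => n hn; rewrite lee_fin.
  exact: (upper_count_ge alpha X t _ _ w xreg hn).
rewrite (@ge0_negligible_integral _ _ _ P setT (~` reg))//; last 2 first.
- exact: measurableC.
- by move=> w _; rewrite /g; case: ifPn => // _; exact: leey.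
rewrite setTD setCK; apply: (@le_trans _ _ (\int[P]_w F w)%E).
  rewrite [leLHS](_ : _ = \int[P]_(w in reg) F w)%E; last first.
    by apply: eq_integral => w wr; rewrite /g wr.
  exact: ge0_subset_integral.
rewrite ge0_integralD//; last 2 first.
- by move=> w _; apply: limn_einf_ge; apply: nearW => n.
- by apply: measurable_limn_einf => n; exact: measurable_ucount.
rewrite integral_cst// [X in (_ * X)%E](_ : _ = 1%E) ?mule1; last exact: probability_setT.
rewrite [leRHS]EFinD leeD2l//.
apply: le_trans (fatou _ _ _ _) _ => //; apply: limn_einf_le => n.
apply: le_trans (upper_count_mean alpha P X alpha01 XP t _ _ t1 _ _) _.
- exact: measurable_grid_box.
- exact: trivIset_grid_box.
rewrite integral_kernel4 ?powR_gt0// lee_fin le_eqVlt; apply/orP; left; apply/eqP.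
have -> : (t `^ (- alpha)) ^+ 2 = (t `^ (2 * alpha))^-1.
  by rewrite -powR_mulrn ?powR_ge0// -powRrM -powRN; congr powR; ring.
by rewrite invrK.
Qed.

(** Here the comparison of counts holds for every grid, and the limit concerns the pairs of points:
    each pair charged by the kernel is eventually covered, so Fatou's lemma recovers the whole
    double integral. *)
Lemma mean_intervals_ge t : 1 < t ->
  ((2 + edge_constant / (t ^+ 2 * t `^ (4 * alpha)))%:E <= EL)%E.
Proof.
move=> t1; have t0 : 0 < t by rewrite (lt_trans _ t1).
pose c := t `^ (2 * alpha); have c0 : 0 < c by exact: powR_gt0.
pose K n (z : (R * R) * (R * R)) := (cover alpha t (grid_index n) (grid_box n) z *
    (t ^- 2 * edge_kernel alpha c z.1 z.2))%:E.
have K0 n z : (0 <= K n z)%E.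
  rewrite lee_fin mulr_ge0 ?cover_ge0// mulr_ge0 ?edge_kernel_ge0//.
  by rewrite invr_ge0 exprn_ge0// ltW.
have mk : measurable_fun setT (fun z : (R * R) * (R * R) => edge_kernel alpha c z.1 z.2).
  by apply: measurable_edge_kernel; measurable_real.
have mK n : measurable_fun setT (K n).
  have mc := measurable_cover alpha t _ _ (measurable_grid_box n).
  by rewrite /K; measurable_real.
have hm := measurable_limn_einf _ _ K mK.
have lower n : (2%:E + \int[mu4]_z K n z <= EL)%E.
  apply: (@le_trans _ _ (\int[P]_w (2%:E + (lcount t n w)%:E))%E).
    rewrite ge0_integralD// integral_cst// [X in (_ * X)%E](_ : _ = 1%E) ?mule1; last exact: probability_setT.
    rewrite leeD2l//.
    apply: (lower_count_mean alpha P X alpha01 XP t _ _ t1).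
      exact: measurable_grid_box.
  rewrite (@ge0_negligible_integral _ _ _ P setT (~` reg))//; last 3 first.
  - exact: measurableC.
  - by apply: emeasurable_funD => //; exact: measurable_cst.
  - by move=> w _; rewrite adde_ge0.
  rewrite setTD setCK integral_mkcond; apply: le_integral_nonmeasurable => w.
    by rewrite patchE; case: ifPn => // _; rewrite adde_ge0.
  rewrite patchE; case: ifPn => [/set_mem hw|_]; last exact: num_ge0.
  rewrite numE// leeD2l// lee_fin.
  apply: (lower_count_le alpha P X XP t _ _ t1).
  - exact: trivIset_grid_box.
  - exact: regP.
(* Finiteness, from the upper bound, allows the summand 2 to be moved to the other side in the
   extended reals. *)
have ELfin : EL \is a fin_num.
  rewrite ge0_fin_numE; last exact: integral_ge0.
  by apply: le_lt_trans (mean_intervals_le t t1) _; rewrite ltry.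
have bound n : (\int[mu4]_z K n z <= EL - 2%:E)%E.
  by rewrite leeBrDl//; exact: lower.
have : (\int[mu4]_z (t ^- 2 * edge_kernel alpha c z.1 z.2)%:E <= EL - 2%:E)%E.
  apply: (@le_trans _ _ (\int[mu4]_z limn_einf (fun n => K n z))%E); last first.
    apply: le_trans (fatou _ _ _ _) _ => //; exact: limn_einf_le.
  apply: ge0_le_integral => //.
  - by move=> z _; rewrite lee_fin mulr_ge0 ?edge_kernel_ge0// invr_ge0 exprn_ge0// ltW.
  - by measurable_real.
  move=> z _; have [/and5P[z1 z2 z3 z4 /and3P[z5 z6 z7]]|h] := boolP
    [&& 0 < z.1.1, z.1.1 < z.2.1, z.2.1 < 1, 0 < z.1.2, 0 < z.2.2,
      0 < line_at z.1 z.2 0 & 0 < line_at z.1 z.2 1]; last first.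
    rewrite /edge_kernel (negbTE h) mul0r mulr0; apply: limn_einf_ge.
    by apply: nearW => n.
  apply: limn_einf_ge.
  have := eventually_admissible alpha alpha01 t z.1 z.2 t1 z1 z2 z3 z4 z5 z6 z7.
  apply: filterS => n [s [adm h1 h2]]; rewrite lee_fin ler_peMl//.
    by rewrite mulr_ge0 ?edge_kernel_ge0// invr_ge0 exprn_ge0// ltW.
  exact: cover_ge1 adm h1 h2.
under eq_integral do rewrite EFinM.
rewrite ge0_integralZl//; last 3 first.
- by measurable_real.
- by move=> z _; rewrite lee_fin edge_kernel_ge0.
- by rewrite lee_fin invr_ge0 exprn_ge0// ltW.
rewrite integral_kernel4// leeBrDl// -EFinM -EFinD.
rewrite (_ : t ^- 2 * _ = edge_constant / (t ^+ 2 * t `^ (4 * alpha)))//.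
have -> : c ^+ 2 = t `^ (4 * alpha).
  by rewrite /c -powR_mulrn ?powR_ge0// -powRrM; congr powR; ring.
by field; rewrite !gt_eqF// powR_gt0.
Qed.

(** The two bounds are applied at t = 1 + 1/(n+1); both powers of t tend to 1. *)
Lemma mean_intervals : EL = (2 + edge_constant)%:E.
Proof.
have J0 := edge_constant_ge0.
have ELfin : EL \is a fin_num.
  rewrite ge0_fin_numE; last exact: integral_ge0.
  by apply: le_lt_trans (mean_intervals_le 2 _) _; rewrite ?ltry// ltrDl.
have cv z : (1 + n.+1%:R^-1) `^ z @[n --> \oo] --> (1 : R).
  have h : (1 + n.+1%:R^-1 : R) @[n --> \oo] --> (1 : R).
    by rewrite -[X in _ --> X]addr0; apply: cvgD; [exact: cvg_cst|exact: cvg_harmonic].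
  by have h2 := cvg_powR _ _ _ _ z ltr01 h; rewrite one_powR in h2; exact: h2.
have t1 n : 1 < 1 + n.+1%:R^-1 :> R by rewrite ltrDl invr_gt0.
apply/eqP; rewrite -(fineK ELfin) eqe eq_le; apply/andP; split.
  have cvU : 2 + edge_constant * (1 + n.+1%:R^-1) `^ (2 * alpha) @[n --> \oo]
      --> 2 + edge_constant.
    apply: cvgD; first exact: cvg_cst.
    by rewrite -[X in _ --> X]mulr1; apply: cvgM; [exact: cvg_cst|exact: cv].
  rewrite -(cvg_lim _ cvU)//; apply: limr_ge; first by apply/cvg_ex; eexists; exact: cvU.
  by apply: nearW => n; rewrite -lee_fin fineK//; exact: mean_intervals_le.
have cvL : 2 + edge_constant / ((1 + n.+1%:R^-1) ^+ 2 * (1 + n.+1%:R^-1) `^ (4 * alpha))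
    @[n --> \oo] --> 2 + edge_constant.
  apply: cvgD; first exact: cvg_cst.
  rewrite -[X in _ --> X]divr1; apply: cvgM; first exact: cvg_cst.
  apply: cvgV; first exact: oner_neq0.
  rewrite -[X in _ --> X]mulr1; apply: cvgM; last exact: cv.
  by under eq_fun do rewrite -powR_mulrn ?(ltW (lt_trans ltr01 (t1 _)))//; exact: cv.
rewrite -(cvg_lim _ cvL)//; apply: limr_le; first by apply/cvg_ex; eexists; exact: cvL.
by apply: nearW => n; rewrite -lee_fin fineK//; exact: mean_intervals_ge.
Qed.
End mean_number_of_intervals.

Theorem theorem1p8 (R : realType) (alpha : R) (alpha_gt0 : 0 < alpha)
    (alpha_lt1 : alpha < 1) (d : measure_display) (T : measurableType d)
    (P : probability T R) (X : nat -> T -> R * R)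
    (XP : poisson_point_process P (strip R) (stable_intensity alpha) X) :
  let EL := (\int[P]_w num_linearity_intervals (fun k => X k w))%E in
  (alpha != 2^-1 -> EL = (mean_formula alpha)%:E) /\
  (alpha = 2^-1 -> exists l : R,
     mean_formula a @[a --> (2^-1 : R)^'] --> l /\ EL = l%:E).
Proof.
have alpha01 : 0 < alpha < 1 by rewrite alpha_gt0.
move=> EL; have ELE : EL = (2 + edge_constant alpha)%:E by exact: mean_intervals XP.
split=> [ah|ah].
  by rewrite ELE mean_formula_edge_integral.
exists (2 + edge_integral 2^-1); split; first exact: cvg_mean_formula_half.
rewrite ELE /edge_constant ah; have -> : 1 - 2^-1 = 2^-1 :> R by field.
by rewrite mulfV ?mul1r.
Qed.
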